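(* Let $n,m\ge 1$ be integers, let $\mu>0$, let $D_{n,m}=\{(z,\zeta)\in\mathbb{C}^n\times\mathbb{C}^m : \|\zeta\|^2<e^{-\mu\|z\|^2}\}$, and let $K_{D_{n,m}}$ be its Bergman kernel, a function on $D_{n,m}\times D_{n,m}$. (i) If $n=1$ and $m\ge 1$, then $K_{D_{n,m}}$ is zero-free, i.e. $K_{D_{n,m}}((z,\zeta),(z',\zeta'))\ne 0$ for all $(z,\zeta),(z',\zeta')\in D_{n,m}$. (ii) If $m=1$ and $n\ge 2$, then $K_{D_{n,m}}$ has a zero, i.e. there exist $(z,\zeta),(z',\zeta')\in D_{n,m}$ with $K_{D_{n,m}}((z,\zeta),(z',\zeta'))=0$.
   Context: $\|\cdot\|$ is the Euclidean norm on $\mathbb{C}^n$ or $\mathbb{C}^m$. For a domain $\Omega\subset\mathbb{C}^N$, $L^2_a(\Omega)$ is the Hilbert space of holomorphic functions on $\Omega$ that are square integrable with respect to Lebesgue measure, with inner product $\langle f,g\rangle=\int_\Omega f\overline{g}\,dz$; the Bergman kernel $K(z,w)=\overline{K_z(w)}$ of $\Omega$ is its reproducing kernel, i.e. $K_z\in L^2_a(\Omega)$ and $f(z)=\langle f,K_z\rangle=\int_\Omega f(w)K(z,w)\,dw$ for all $f\in L^2_a(\Omega)$ and $z\in\Omega$. *)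

(* Defs.v *)
From HB Require Import structures.
From mathcomp Require Import all_boot all_order all_algebra.
From mathcomp Require Import all_classical all_reals all_analysis.
From mathcomp Require Import complex.

Set Implicit Arguments.
Unset Strict Implicit.
Unset Printing Implicit Defensive.

Import Order.TTheory GRing.Theory Num.Theory.
Import numFieldNormedType.Exports.

Local Open Scope classical_set_scope.
Local Open Scope ring_scope.
Local Open Scope complex_scope.

Lemma product_measure_sigma_finite d d' (T : measurableType d)
    (T' : measurableType d') (R : realType)
    (mu : {sigma_finite_measure set T -> \bar R})
    (nu : {sigma_finite_measure set T' -> \bar R}) :
  sigma_finite setT (mu \x nu)%E.
Proof.
have /sigma_finiteP[F [TF ndF Foo]] := sigma_finiteT mu.
have /sigma_finiteP[G [TG ndG Goo]] := sigma_finiteT nu.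
exists (fun n => F n `*` G n).
  rewrite -setXTT TF TG predeqE => -[x y]; split.
    move=> [/= [n _ Fnx] [k _ Gky]]; exists (maxn n k) => //; split.
    - by move: x Fnx; exact/subsetPset/ndF/leq_maxl.
    - by move: y Gky; exact/subsetPset/ndG/leq_maxr.
  by move=> [n _ []/= ? ?]; split; exists n.
move=> k; have [? ?] := Foo k; have [? ?] := Goo k.
split; first exact: measurableX.
by rewrite product_measure1E// lte_mul_pinfty// ge0_fin_numE.
Qed.

Lemma pushforward_sigma_additive d d' (T : measurableType d)
    (T' : measurableType d') (R : realType) (mu : {measure set T -> \bar R})
    (f : T -> T') : measurable_fun setT f ->
  semi_sigma_additive (pushforward mu f).
Proof. by move=> mf; exact: measure_semi_sigma_additive. Qed.

Section tuple_product_step.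
Context d (T : measurableType d) (R : realType).
Variables (mu : {sigma_finite_measure set T -> \bar R}) (n : nat).
Variable nu : {sigma_finite_measure set (n.-tuple T) -> \bar R}.

Definition tuple_cons (x : T * n.-tuple T) : n.+1.-tuple T :=
  [tuple of x.1 :: x.2].

Definition tuple_uncons (t : n.+1.-tuple T) : T * n.-tuple T :=
  (thead t, [tuple of behead t]).

Lemma measurable_tuple_cons : measurable_fun setT tuple_cons.
Proof. exact: measurable_cons. Qed.

Lemma measurable_tuple_uncons : measurable_fun setT tuple_uncons.
Proof.
by apply/measurable_fun_pair; [exact: measurable_tnth|exact: measurable_behead].
Qed.

Lemma tuple_consK : cancel tuple_cons tuple_uncons.
Proof. by case=> x t; congr pair; apply/val_inj. Qed.

Definition tuple_step : set (n.+1.-tuple T) -> \bar R :=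
  pushforward (mu \x nu)%E tuple_cons.

Let tuple_step0 : tuple_step set0 = 0%E.
Proof. by rewrite /tuple_step /pushforward preimage_set0 measure0. Qed.

Let tuple_step_ge0 A : (0 <= tuple_step A)%E.
Proof. by rewrite /tuple_step /pushforward measure_ge0. Qed.

Let tuple_step_sigma_additive : semi_sigma_additive tuple_step.
Proof.
apply: (@pushforward_sigma_additive _ _ _ _ _ (mu \x nu)%E).
exact: measurable_tuple_cons.
Qed.

HB.instance Definition _ := isMeasure.Build _ _ _ tuple_step
  tuple_step0 tuple_step_ge0 tuple_step_sigma_additive.

Let tuple_step_sigma_finite : sigma_finite setT tuple_step.
Proof.
have [F TF Foo] := product_measure_sigma_finite mu nu.
exists (fun i => tuple_uncons @^-1` F i).
  by rewrite -preimage_bigcup -TF.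
move=> i; have [mF Flt] := Foo i; split.
  by rewrite -[X in measurable X]setTI; exact: measurable_tuple_uncons.
rewrite /tuple_step /pushforward -comp_preimage.
by rewrite (_ : _ \o _ = id)//; apply/funext => x /=; rewrite tuple_consK.
Qed.

HB.instance Definition _ := Measure_isSigmaFinite.Build _ _ _ tuple_step
  tuple_step_sigma_finite.

End tuple_product_step.

Fixpoint tuple_measure d (T : measurableType d) (R : realType)
    (mu : {sigma_finite_measure set T -> \bar R}) (n : nat) :
    {sigma_finite_measure set (n.-tuple T) -> \bar R} :=
  if n is n'.+1 then tuple_step mu (tuple_measure mu n')
  else \d_([tuple] : 0.-tuple T).

Lemma tuple_measure_box d (T : measurableType d) (R : realType)
    (mu : {sigma_finite_measure set T -> \bar R}) (n : nat)
    (A : 'I_n -> set T) : (forall i, measurable (A i)) ->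
  tuple_measure mu n [set t | forall i, A i (tnth t i)] =
  (\prod_(i < n) mu (A i))%E.
Proof.
elim: n A => [|n IHn] A mA.
  by rewrite big_ord0 /= diracE mem_set//= => -[].
have mbox : measurable
    [set t : n.-tuple T | forall i : 'I_n, A (lift ord0 i) (tnth t i)].
  rewrite (_ : [set t | _] = \bigcap_(i in [set: 'I_n])
      ((fun t : n.-tuple T => tnth t i) @^-1` A (lift ord0 i))).
    apply: fin_bigcap_measurable => // i _; rewrite -[X in measurable X]setTI.
    exact: measurable_tnth.
  by apply/seteqP; split => [t h i _|t h i]; exact: h.
rewrite big_ord_recl -IHn// -product_measure1E//.
rewrite /= /tuple_step /pushforward; congr (_ _).
apply/seteqP; split => [[x t] /= h|[x t] /= [h0 h] i].
  split; first exact: (h ord0).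
  by move=> i; have := h (lift ord0 i); rewrite tnthS.
case: (unliftP ord0 i) => [j ->|->//].
rewrite tnthS; exact: h.
Qed.

Section lebesgue_Cn.
Variable R : realType.
Local Notation M := (measurableTypeR R).
Local Notation leb := (@lebesgue_measure R).

Definition lebesgue_plane : set (M * M) -> \bar R := (leb \x leb)%E.

HB.instance Definition _ := Measure.on lebesgue_plane.

HB.instance Definition _ := Measure_isSigmaFinite.Build _ _ _ lebesgue_plane
  (product_measure_sigma_finite leb leb).

(* C^N is read as (R x R)^N through x + i y, so that the measure dz is the
   N-fold product of the planar Lebesgue measure dx dy. *)
Definition lebesgue_Cn (N : nat) :
    {sigma_finite_measure set (N.-tuple (M * M)) -> \bar R} :=
  tuple_measure lebesgue_plane N.

Definition Cn_of_tuple (N : nat) (t : N.-tuple (M * M)) : 'rV[R[i]]_N :=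
  \row_j ((tnth t j).1 +i* (tnth t j).2).

Definition Cn_integral (N : nat) (Omega : set 'rV[R[i]]_N)
    (F : 'rV[R[i]]_N -> R[i]) : R[i] :=
  (\int[lebesgue_Cn N]_(t in @Cn_of_tuple N @^-1` Omega)
     complex.Re (F (Cn_of_tuple t))) +i*
  (\int[lebesgue_Cn N]_(t in @Cn_of_tuple N @^-1` Omega)
     complex.Im (F (Cn_of_tuple t))).

End lebesgue_Cn.

Section bergman.
Variables (R : realType) (N : nat).
Implicit Types (Omega : set 'rV[R[i]]_N) (f g : 'rV[R[i]]_N -> R[i]).

(* 'differentiable' is Frechet differentiability over the scalar field R[i]:
   the differential is complex-linear. Omega is meant to be open. *)
Definition holomorphic_on Omega f :=
  forall z : 'rV[R[i]]_N, Omega z ->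
    differentiable (f : 'rV[R[i]]_N -> R[i]^o)
      (z : ('rV[R[i]]_N : normedModType R[i])).

Definition square_integrable_on Omega f :=
  (lebesgue_Cn R N).-integrable (@Cn_of_tuple R N @^-1` Omega)
    (fun t => ((complex.Re `|f (Cn_of_tuple t)|) ^+ 2)%:E).

(* Functions on Omega are total functions whose values off Omega are
   irrelevant. *)
Definition L2a Omega f := holomorphic_on Omega f /\ square_integrable_on Omega f.

Definition L2_inner Omega f g : R[i] :=
  Cn_integral Omega (fun w => f w * (g w)^*).

Definition is_bergman_kernel Omega (K : 'rV[R[i]]_N -> 'rV[R[i]]_N -> R[i]) :=
  forall z, Omega z ->
    let K_ := fun w => (K z w)^* in
    L2a Omega K_ /\ forall f, L2a Omega f -> f z = L2_inner Omega f K_.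

Definition euclidean_norm (z : 'rV[R[i]]_N) : R :=
  Num.sqrt (\sum_j (complex.Re `|z 0 j|) ^+ 2).

End bergman.

(* The point (z, zeta) of C^n x C^m is the row vector row_mx z zeta. *)
Definition hartogs_domain (R : realType) (n m : nat) (mu : R) :
    set 'rV[R[i]]_(n + m) :=
  [set p | euclidean_norm (rsubmx p) ^+ 2
           < expR (- mu * euclidean_norm (lsubmx p) ^+ 2)].
Arguments hartogs_domain {R} n m mu _.

(* Main.v *)
(* The monomials in the last coordinate of C^m are orthogonal to all other
   monomials, so averaging over rotations shows that, on the last axis, the kernel
   K(p, .) is the power series with general term (conj(p_L) s)^k / ||v_L^k||^2, and
   1 / ||v_L^k||^2 is proportional to (k + m)!/k! * (k + m)^n.

   For n = 1 the automorphisms (z, zeta) |-> (z + a, c(z) zeta U), with U unitary,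
   c(z) = exp(- mu z conj(a) - mu |a|^2/2) and Jacobian c(z)^m up to a unimodular
   constant, move any point of the domain to the last axis; the kernel then equals,
   up to nonzero factors, the sum of (k + m)!/k! * (k + m) t^k, which is
   m! (m + t) / (1 - t)^(m + 2) and has no zero in the unit disc.

   For m = 1 and t = conj(p_L) s the kernel is proportional to the sum of
   (k + 1)^(n + 1) t^k, which is y q(y) for y = 1 / (1 - t) and a polynomial q
   that, by iterating Rolle's theorem, has a root in ]1/2, 1[ as soon as n >= 2;
   the corresponding t lies in ]-1, 0[. *)

Require Import Defs.
From mathcomp Require Import all_boot all_order all_algebra.
From mathcomp Require Import all_classical all_reals all_analysis.
From mathcomp Require Import complex.
From mathcomp Require Import measurable_realfun ring lra.
From mathcomp Require spectral polyrcf.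

Import Order.TTheory GRing.Theory Num.Theory.
Import numFieldNormedType.Exports.

Local Open Scope classical_set_scope.
Local Open Scope ring_scope.
Local Open Scope complex_scope.

Set Implicit Arguments.
Unset Strict Implicit.
Unset Printing Implicit Defensive.

Local Notation normc := Normc.normc.
Local Notation Re := complex.Re.
Local Notation Im := complex.Im.

(** * Complex numbers and complex-valued integrals *)

(** The kernel is given only through its reproducing property, and no orthonormal basis is ever
    built. For fixed [p], the function [l |-> conj (K (Phi p) (Phi (l *: e_L))) * J (l *: e_L)] is
    holomorphic on the unit disc, hence determined by its Taylor coefficients, and each coefficient
    comes from pairing the kernel with one square-integrable function. Completeness of the monomials
    is thereby replaced by one-variable function theory: Goursat on rectangles, Cauchy on circles
    through the exponential, Taylor series on a disc. Averaging over rotations transports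
    integrability together with the integral (Fubini on the domain times [[0, 2 pi]]), so no
    exhaustion of the domain is involved. Both halves use the same series, attached to an
    automorphism [Phi]: a nontrivial one for n = 1, the identity for m = 1, where two points of the
    last axis suffice. The bound n >= 2 is where the root enters the disc: for n = m = 1 the
    polynomial q is X (2 X - 1), and its root 1/2 gives t = -1, on the boundary. *)

Section normc_theory.
Variable R : realType.
Implicit Types x y z : R[i].

Lemma normr_normc z : `|z| = (normc z)%:C.
Proof. by case: z. Qed.

Lemma normc_ge0 z : 0 <= normc z.
Proof. by case: z => a b; exact: sqrtr_ge0. Qed.

Lemma sqr_normc_ReIm z : normc z ^+ 2 = Re z ^+ 2 + Im z ^+ 2.
Proof. by case: z => a b /=; rewrite sqr_sqrtr// addr_ge0 ?sqr_ge0. Qed.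

Lemma normcD_le x y : normc (x + y) <= normc x + normc y.
Proof. exact: le_normcD. Qed.

Lemma normc_opp x : normc (- x) = normc x.
Proof. exact: normcN. Qed.

Lemma normcB_le x y : normc (x - y) <= normc x + normc y.
Proof. by rewrite (le_trans (normcD_le _ _))// normc_opp. Qed.

Lemma normc_distC x y : normc (x - y) = normc (y - x).
Proof. by rewrite -normc_opp opprB. Qed.

Lemma normc_Re_le z : `|Re z| <= normc z.
Proof.
by rewrite -(ler_pXn2r (n := 2))// ?nnegrE ?normc_ge0// sqr_normc_ReIm
   real_normK ?num_real// lerDl sqr_ge0.
Qed.

Lemma normc_Im_le z : `|Im z| <= normc z.
Proof.
by rewrite -(ler_pXn2r (n := 2))// ?nnegrE ?normc_ge0// sqr_normc_ReIm
   real_normK ?num_real// lerDr sqr_ge0.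
Qed.

Lemma normc_le_ReIm z : normc z <= `|Re z| + `|Im z|.
Proof.
rewrite -(ler_pXn2r (n := 2))// ?nnegrE ?normc_ge0 ?addr_ge0//.
rewrite sqr_normc_ReIm sqrrD !real_normK ?num_real//.
by rewrite -addrA lerD2l lerDr mulrn_wge0// mulr_ge0.
Qed.

Lemma normcR (a : R) : normc a%:C = `|a|.
Proof. by rewrite /= expr0n/= addr0 sqrtr_sqr. Qed.

Lemma normcX z n : normc (z ^+ n) = normc z ^+ n.
Proof.
elim: n => [|n IH]; first by rewrite !expr0 Normc.normc1.
by rewrite !exprS Normc.normcM IH.
Qed.

Lemma normcJ z : normc (z^*) = normc z.
Proof. by case: z => a b /=; rewrite sqrrN. Qed.

Lemma normc_eq0 z : (normc z == 0) = (z == 0).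
Proof.
by apply/eqP/eqP => [/Normc.eq0_normc//|->]; rewrite Normc.normc0.
Qed.

Lemma normc_gt0 z : (0 < normc z) = (z != 0).
Proof. by rewrite lt_neqAle normc_ge0 andbT eq_sym normc_eq0. Qed.

Lemma normc_nat n : normc (n%:R : R[i]) = n%:R.
Proof. by rewrite -[n%:R](rmorph_nat (real_complex R)) normcR normr_nat. Qed.

Lemma mulcJ z : z * z^* = ((normc z) ^+ 2)%:C.
Proof. by rewrite -sqr_normc normr_normc rmorphXn. Qed.

Lemma normcB_ge x y : normc x - normc y <= normc (x - y).
Proof. by rewrite lerBlDr -{1}(subrK y x) normcD_le. Qed.

Lemma ReM x y : Re (x * y) = Re x * Re y - Im x * Im y.
Proof. by case: x y => [a b] [c d]. Qed.

Lemma ImM x y : Im (x * y) = Re x * Im y + Im x * Re y.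
Proof. by case: x y => [a b] [c d]. Qed.

Lemma ReD x y : Re (x + y) = Re x + Re y.
Proof. by case: x y => [a b] [c d]. Qed.

Lemma ImD x y : Im (x + y) = Im x + Im y.
Proof. by case: x y => [a b] [c d]. Qed.

Lemma ReN x : Re (- x) = - Re x.
Proof. by case: x. Qed.

Lemma ImN x : Im (- x) = - Im x.
Proof. by case: x. Qed.

Lemma eqcP x y : Re x = Re y -> Im x = Im y -> x = y.
Proof. by case: x y => [a b] [c d] /= -> ->. Qed.

End normc_theory.

Section complex_topology.
Variable R : realType.
Local Notation C := (R[i]^o).

(** The norm of [R[i]^o] takes values in [R[i]] itself, where a positive element is necessarily
    real. Epsilon arguments below go through this real-valued form. *)
Lemma cvg_normcP (T : Type) (F : set_system T) (FF : Filter F) (f : T -> C)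
    (l : C) :
  f @ F --> l <-> forall e : R, 0 < e -> \forall x \near F, normc (f x - l) < e.
Proof.
split=> [/cvgrPdist_lt fl e e0|fl].
  have /fl : (0 : R[i]) < e%:C by rewrite ltcR.
  by apply: filterS => x; rewrite normr_normc ltcR normc_distC.
apply/cvgrPdist_lt => e e0.
have eE : e = (Re e)%:C.
  by rewrite RRe_real// gtr0_real.
have /fl : 0 < Re e by rewrite -ltcR -eE.
by apply: filterS => x; rewrite normr_normc eE ltcR normc_distC.
Qed.

Lemma nbhs_normcP (z : C) (P : set C) :
  nbhs z P <-> exists2 e : R, 0 < e & forall w, normc (w - z) < e -> P w.
Proof.
split=> [/nbhs_ballP[e /= e0 zP]|[e e0 eP]].
  have eE : e = (Re e)%:C by rewrite RRe_real// gtr0_real.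
  exists (Re e); first by rewrite -ltcR -eE.
  move=> w wz; apply: zP; rewrite /ball/= normr_normc eE ltcR.
  by rewrite normc_distC.
apply/nbhs_ballP; exists e%:C; first by rewrite /= ltcR.
by move=> w; rewrite /ball/= normr_normc ltcR normc_distC => /eP.
Qed.

Lemma normc_lipschitz_continuous (f : C -> R) :
  (forall w z, `|f w - f z| <= normc (w - z)) -> continuous f.
Proof.
move=> fL z; have [_] := @cvgrPdist_lt _ R^o C (nbhs z) _ f (f z).
apply => e e0; apply/nbhs_normcP; exists e => // w; apply: le_lt_trans.
by rewrite distrC.
Qed.

Lemma continuous_Re : continuous (@complex.Re R : C -> R).
Proof.
apply: normc_lipschitz_continuous => w z.
by rewrite -ReN -ReD; exact: normc_Re_le.
Qed.

Lemma continuous_Im : continuous (@complex.Im R : C -> R).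
Proof.
apply: normc_lipschitz_continuous => w z.
by rewrite -ImN -ImD; exact: normc_Im_le.
Qed.

Lemma continuous_normc : continuous (@Normc.normc R : C -> R).
Proof.
apply: normc_lipschitz_continuous => w z.
rewrite ler_norml normcB_ge andbT.
by rewrite lerNl opprB normc_distC normcB_ge.
Qed.

Lemma cvg_complex (T : Type) (F : set_system T) (FF : Filter F)
    (f : T -> C) (l : C) :
  Re (f x) @[x --> F] --> Re l -> Im (f x) @[x --> F] --> Im l -> f @ F --> l.
Proof.
move=> /cvgrPdist_lt fr /cvgrPdist_lt fi.
apply/cvg_normcP => e e0.
have e20 : 0 < e / 2 by rewrite divr_gt0.
apply: filterS2 (fr _ e20) (fi _ e20) => x xr xi.
rewrite (le_lt_trans (normc_le_ReIm _))// !(ReD, ImD) !(ReN, ImN).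
by rewrite [e]splitr ltrD// distrC.
Qed.

Lemma continuous_complex (T : topologicalType) (f : T -> C) (x : T) :
  {for x, continuous (fun t => Re (f t))} ->
  {for x, continuous (fun t => Im (f t))} -> {for x, continuous f}.
Proof. by move=> ? ?; apply: cvg_complex. Qed.

End complex_topology.

Section complex_integral.
Local Open Scope ereal_scope.
Context d (T : measurableType d) (R : realType).
Variable mu : {measure set T -> \bar R}.
Implicit Types (D : set T) (F G : T -> R[i]).

Definition cintegrable D F :=
  mu.-integrable D (EFin \o (fun t => Re (F t))) /\ mu.-integrable D (EFin \o (fun t => Im (F t))).

Definition cint D F : R[i] :=
  (\int[mu]_(t in D) Re (F t) +i* \int[mu]_(t in D) Im (F t))%R%C.

Lemma eq_cint D F G : (forall t, D t -> F t = G t) -> cint D F = cint D G.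
Proof.
move=> FG; congr Complex; apply: eq_Rintegral => t /set_mem Dt.
  by rewrite FG.
by rewrite FG.
Qed.

Lemma cintegrableD D F G : measurable D -> cintegrable D F -> cintegrable D G ->
  cintegrable D (fun t => F t + G t)%R.
Proof.
move=> mD [Fr Fi] [Gr Gi]; split.
  apply: (eq_integrable mD _ _ _ (integrableD mD Fr Gr)) => t _ /=.
  by rewrite ReD EFinD.
apply: (eq_integrable mD _ _ _ (integrableD mD Fi Gi)) => t _ /=.
by rewrite ImD EFinD.
Qed.

Lemma cintegrableZ D (c : R[i]) F : measurable D -> cintegrable D F ->
  cintegrable D (fun t => c * F t)%R.
Proof.
move=> mD [Fr Fi]; split.
  apply: (eq_integrable mD _ _ _ (integrableB mD (integrableZl mD (Re c) Fr)
    (integrableZl mD (Im c) Fi))) => t _ /=.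
  by rewrite ReM EFinB !EFinM.
apply: (eq_integrable mD _ _ _ (integrableD mD (integrableZl mD (Re c) Fi)
  (integrableZl mD (Im c) Fr))) => t _ /=.
by rewrite ImM EFinD !EFinM.
Qed.

Lemma cintegrableN D F : measurable D -> cintegrable D F ->
  cintegrable D (fun t => - F t)%R.
Proof.
move=> mD iF; rewrite (_ : (fun _ => _) = (fun t => (-1) * F t)%R).
  exact: cintegrableZ.
by apply/funext => t; rewrite mulN1r.
Qed.

Lemma cintegrableB D F G : measurable D -> cintegrable D F -> cintegrable D G ->
  cintegrable D (fun t => F t - G t)%R.
Proof. by move=> mD iF iG; apply: cintegrableD => //; exact: cintegrableN. Qed.

Lemma cintD D F G : measurable D -> cintegrable D F -> cintegrable D G ->
  (cint D (fun t => F t + G t) = cint D F + cint D G)%R.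
Proof.
move=> mD [Fr Fi] [Gr Gi]; apply: eqcP; rewrite ?ReD ?ImD /=.
  by under eq_Rintegral do rewrite ReD; rewrite RintegralD.
by under eq_Rintegral do rewrite ImD; rewrite RintegralD.
Qed.

Lemma integrableZl_EFin D (k : R) (f : T -> R) : measurable D ->
  mu.-integrable D (EFin \o f) -> mu.-integrable D (EFin \o (fun t => k * f t)%R).
Proof. by move=> mD /(integrableZl mD k); apply: eq_integrable. Qed.

Lemma cintZ D (c : R[i]) F : measurable D -> cintegrable D F ->
  (cint D (fun t => c * F t) = c * cint D F)%R.
Proof.
move=> mD [Fr Fi]; apply: eqcP; rewrite ?ReM ?ImM /=.
  under eq_Rintegral do rewrite ReM.
  by rewrite RintegralB ?RintegralZl//; exact: integrableZl_EFin.
under eq_Rintegral do rewrite ImM.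
by rewrite RintegralD ?RintegralZl//; exact: integrableZl_EFin.
Qed.

Lemma cintN D F : measurable D -> cintegrable D F ->
  (cint D (fun t => - F t) = - cint D F)%R.
Proof.
by move=> mD iF; rewrite -mulN1r -cintZ//; apply: eq_cint => t _; rewrite mulN1r.
Qed.

Lemma cintB D F G : measurable D -> cintegrable D F -> cintegrable D G ->
  (cint D (fun t => F t - G t) = cint D F - cint D G)%R.
Proof.
by move=> mD iF iG; rewrite cintD ?cintN//; exact: cintegrableN.
Qed.

Lemma cint_conj D F : measurable D -> cintegrable D F ->
  (cint D (fun t => (F t)^*) = (cint D F)^*)%R.
Proof.
move=> mD [Fr Fi]; apply: eqcP => /=.
  by apply: eq_Rintegral => t _; case: (F t).
under eq_Rintegral => t _.
  rewrite (_ : Im _ = (-1) * Im (F t))%R; last by case: (F t) => ? ?; rewrite mulN1r.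
  over.
by rewrite RintegralZl// mulN1r.
Qed.

Lemma cint_cst D (c : R[i]) : measurable D ->
  (cint D (fun=> c) = (fine (mu D))%:C * c)%R.
Proof.
move=> mD; apply: eqcP; rewrite ?ReM ?ImM/= Rintegral_cst//= mul0r ?subr0 ?addr0.
  by rewrite mulrC.
by rewrite mulrC.
Qed.

Lemma integrable_cst_ltey D (c : R) : measurable D -> mu D < +oo ->
  mu.-integrable D (EFin \o cst c).
Proof.
move=> mD Doo; apply/integrableP; split; first exact/measurable_EFinP/measurable_cst.
rewrite (_ : (fun _ => _) = cst `|c|%:E)// integral_cst//.
by rewrite lte_mul_pinfty// ?lee_fin.
Qed.

Lemma cintegrable_cst D (c : R[i]) : measurable D -> mu D < +oo ->
  cintegrable D (fun=> c).
Proof. by move=> mD Doo; split; exact: integrable_cst_ltey. Qed.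

(** The factor 2 comes from bounding real and imaginary parts separately. All uses let the bound
    tend to 0, so the constant is immaterial. *)
Lemma cint_norm_le D F (B : R) : measurable D -> mu D < +oo -> cintegrable D F ->
  (forall t, D t -> normc (F t) <= B)%R ->
  (normc (cint D F) <= 2 * B * fine (mu D))%R.
Proof.
move=> mD Doo [Fr Fi] FB.
have key (f : T -> R) : mu.-integrable D (EFin \o f) ->
    (forall t, D t -> `|f t| <= B)%R ->
    (`|\int[mu]_(t in D) f t| <= B * fine (mu D))%R.
  move=> intf fB; rewrite (le_trans (le_normr_Rintegral _ _))//.
  rewrite -Rintegral_cst//; apply: le_Rintegral => //.
    exact: (integrable_norm intf).
  exact: integrable_cst_ltey.
rewrite (le_trans (normc_le_ReIm _))//= -mulrA mulr_natl mulr2n lerD//.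
  by apply: key => // t Dt; rewrite (le_trans (normc_Re_le _))// FB.
by apply: key => // t Dt; rewrite (le_trans (normc_Im_le _))// FB.
Qed.

End complex_integral.
Section interval_integral.
Variable R : realType.
Local Notation C := (R[i]^o).
Local Notation leb := (@lebesgue_measure R).
Local Notation cintg a b F := (cint leb `[a, b] F).

Definition ccontinuous_on (a b : R) (F : R -> C) :=
  forall t, a <= t <= b -> {for t, continuous F}.

Lemma cintegrable_itv a b F : ccontinuous_on a b F -> cintegrable leb `[a, b] F.
Proof.
move=> cF.
have key (f : C -> R) : continuous f ->
    leb.-integrable `[a, b] (EFin \o (fun t => f (F t))).
  move=> cf; apply: continuous_compact_integrable; first exact: segment_compact.
  apply: continuous_in_subspaceT => t /set_mem; rewrite /= in_itv/= => tab.
  by apply: (@continuous_comp _ _ _ F f) => //; [exact: cF|exact: cf].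
by split; apply: key; [exact: continuous_Re|exact: continuous_Im].
Qed.

Lemma lebesgue_itvcc (a b : R) : a <= b -> leb `[a, b] = (b - a)%:E.
Proof.
move=> ab; rewrite lebesgue_measure_itv/= lte_fin; case: ltP => //.
by move=> ba; rewrite (le_anti (_ : a <= b <= a)) ?ab// subrr.
Qed.

Lemma cint_itv_split a e b F : a <= e <= b -> ccontinuous_on a b F ->
  cintg a b F = cintg a e F + cintg e b F.
Proof.
move=> /andP[ae eb] cF; have [Fr Fi] := cintegrable_itv cF.
have ebc : ccontinuous_on e b F.
  by move=> t /andP[et tb]; apply: cF; rewrite tb (le_trans ae et).
have [Er Ei] := cintegrable_itv ebc.
have obS : `]e, b]%classic `<=` (`[e, b]%classic : set R).
  by move=> t /=; rewrite !in_itv/= => /andP[/ltW -> ->].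
have key (f : R -> R) : leb.-integrable `[a, b] (EFin \o f) ->
    leb.-integrable `[e, b] (EFin \o f) ->
    \int[leb]_(t in `[a, b]) f t =
    \int[leb]_(t in `[a, e]) f t + \int[leb]_(t in `[e, b]) f t.
  move=> fi fi'; apply/eqP; rewrite addrC -subr_eq; apply/eqP.
  rewrite Rintegral_itvB//; try by rewrite bnd_simp.
  rewrite -Rintegral_itv_obnd_cbnd//.
  by apply: (integrableS _ _ _ fi') => //; exact: measurable_itv.
by apply: eqcP; rewrite ?ReD ?ImD /=; apply: key.
Qed.

Lemma cint_itv_near_cst a b F (K : R[i]) (B : R) : a <= b ->
  ccontinuous_on a b F ->
  (forall t, a <= t <= b -> normc (F t - K) <= B) ->
  normc (cintg a b F - (b - a)%:C * K) <= 2 * B * (b - a).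
Proof.
move=> ab cF FK.
have mu_ab : (leb `[a, b] < +oo)%E by rewrite lebesgue_itvcc// ltry.
have iK : cintegrable leb `[a, b] (fun=> K) by exact: cintegrable_cst.
have iF := cintegrable_itv cF.
have -> : (b - a)%:C * K = cintg a b (fun=> K).
  by rewrite cint_cst//= lebesgue_itvcc.
rewrite -cintB//.
have iFK : cintegrable leb `[a, b] (fun t => F t - K) by exact: cintegrableB.
have -> : b - a = fine (leb `[a, b]) by rewrite lebesgue_itvcc.
by apply: cint_norm_le.
Qed.

End interval_integral.

(** * Goursat's theorem *)

Section goursat.
Variable R : realType.
Local Notation C := (R[i]^o).
Local Notation leb := (@lebesgue_measure R).
Local Notation cintg a b F := (cint leb `[a, b] F).

(** The derivative in the form that Goursat's argument consumes: a first-order expansion without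
    quotient, valid at [w = u] too. *)
Lemma derivable_affine (g : C -> C) (u : C) : derivable g u 1 ->
  exists b : R[i], forall e : R, 0 < e -> exists2 r : R, 0 < r &
    forall w, normc (w - u) < r ->
      normc (g w - g u - b * (w - u)) <= e * normc (w - u).
Proof.
move=> /cvg_ex[/= b /cvg_normcP gb]; exists b => e /gb.
rewrite near_withinE => /nbhs_normcP[r r0 er].
exists r => // w wr.
have [->|wu] := eqVneq w u.
  by rewrite !subrr mulr0 subr0 Normc.normc0 mulr0.
have wu0 : w - u != 0 by rewrite subr_eq0.
have := er (w - u); rewrite subr0 => /(_ wr wu0) /ltW.
rewrite /shift/= [_ *: 1]mulr1 subrK => h.
have -> : g w - g u - b * (w - u) =
    ((w - u)^-1 *: (g w - g u) - b) * (w - u).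
  by rewrite mulrBl [_ *: _]mulrC mulfVK.
by rewrite Normc.normcM ler_wpM2r// normc_ge0.
Qed.

Lemma derivable_continuous (g : C -> C) (u : C) : derivable g u 1 ->
  {for u, continuous g}.
Proof. by move/derivable1_diffP/differentiable_continuous. Qed.

Lemma continuous_vline (x y : R) : {for y, continuous (fun t : R => (x +i* t : C))}.
Proof.
by apply: continuous_complex => /=; [exact: cst_continuous|exact: cvg_id].
Qed.

Lemma continuous_hline (x y : R) : {for x, continuous (fun t : R => (t +i* y : C))}.
Proof.
by apply: continuous_complex => /=; [exact: cvg_id|exact: cst_continuous].
Qed.

(** The counterclockwise integral of [g dz] along the boundary of [[a, b] x [c, d]], with opposite
    sides grouped. *)
Definition rect_form (g : C -> C) (a b c d : R) : R[i] :=
  'i%C * cintg c d (fun y => g (b +i* y) - g (a +i* y)) -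
  cintg a b (fun x => g (x +i* d) - g (x +i* c)).

Variable g : C -> C.

Definition rect_derivable a b c d := forall x y, a <= x <= b -> c <= y <= d ->
  derivable g (x +i* y) 1.

Lemma rect_continuous_v a b c d x : a <= x <= b -> rect_derivable a b c d ->
  ccontinuous_on c d (fun y => g (x +i* y)).
Proof.
move=> xab gd y ycd.
apply: (@continuous_comp _ _ _ (fun y : R => (x +i* y : C)) g).
  exact: continuous_vline.
by apply: derivable_continuous; exact: gd.
Qed.

Lemma rect_continuous_h a b c d y : c <= y <= d -> rect_derivable a b c d ->
  ccontinuous_on a b (fun x => g (x +i* y)).
Proof.
move=> ycd gd x xab.
apply: (@continuous_comp _ _ _ (fun x : R => (x +i* y : C)) g).
  exact: continuous_hline.
by apply: derivable_continuous; exact: gd.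
Qed.

Lemma ccontinuousB a b (F G : R -> C) : ccontinuous_on a b F ->
  ccontinuous_on a b G -> ccontinuous_on a b (fun x => F x - G x).
Proof. by move=> cF cG x xab; apply: cvgB; [exact: cF|exact: cG]. Qed.

(** The two integrals over the common vertical side cancel. *)
Lemma rect_form_split_h a e b c d : a <= e <= b -> c <= d ->
  rect_derivable a b c d ->
  rect_form g a b c d = rect_form g a e c d + rect_form g e b c d.
Proof.
move=> /[dup] aeb /andP[ae eb] cd gd; rewrite /rect_form.
have cv x : a <= x <= b -> ccontinuous_on c d (fun y => g (x +i* y)).
  by move=> xab; exact: rect_continuous_v gd.
have ch y : c <= y <= d -> ccontinuous_on a b (fun x => g (x +i* y)).
  by move=> ycd; exact: rect_continuous_h gd.
have mI (u v : R) : measurable (`[u, v]%classic : set (measurableTypeR R)).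
  exact: measurable_itv.
rewrite (@cint_itv_split _ a e b)//; last first.
  by apply: ccontinuousB; apply: ch; rewrite lexx ?cd.
have ab := le_trans ae eb.
have iv x x' : a <= x <= b -> a <= x' <= b ->
    cintegrable leb `[c, d] (fun y => g (x +i* y) - g (x' +i* y)).
  by move=> ? ?; apply: cintegrable_itv; apply: ccontinuousB; exact: cv.
rewrite [X in 'i%C * X](_ : _ = cintg c d (fun y => g (e +i* y) - g (a +i* y)) +
   cintg c d (fun y => g (b +i* y) - g (e +i* y))); first by ring.
rewrite -cintD//; try by apply: iv; rewrite ?lexx ?ab ?ae ?eb.
by apply: eq_cint => y _; ring.
Qed.

Lemma rect_form_split_v a b c e d : c <= e <= d -> a <= b ->
  rect_derivable a b c d ->
  rect_form g a b c d = rect_form g a b c e + rect_form g a b e d.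
Proof.
move=> /[dup] ced /andP[ce ed] ab gd; rewrite /rect_form.
have cv x : a <= x <= b -> ccontinuous_on c d (fun y => g (x +i* y)).
  by move=> xab; exact: rect_continuous_v gd.
have ch y : c <= y <= d -> ccontinuous_on a b (fun x => g (x +i* y)).
  by move=> ycd; exact: rect_continuous_h gd.
rewrite (@cint_itv_split _ c e d)//; last first.
  by apply: ccontinuousB; apply: cv; rewrite lexx ?ab.
have cd := le_trans ce ed.
have ih y y' : c <= y <= d -> c <= y' <= d ->
    cintegrable leb `[a, b] (fun x => g (x +i* y) - g (x +i* y')).
  by move=> ? ?; apply: cintegrable_itv; apply: ccontinuousB; exact: ch.
rewrite [X in _ * _ - X](_ : _ = cintg a b (fun x => g (x +i* e) - g (x +i* c)) +
   cintg a b (fun x => g (x +i* d) - g (x +i* e))); first by ring.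
rewrite -cintD//; try by apply: ih; rewrite ?lexx ?cd ?ce ?ed.
by apply: eq_cint => y _; ring.
Qed.

(** An affine function has zero boundary integral: on opposite sides the differences of [g] are
    [K (b - a)] and [i K (d - c)] up to [2 B], and these two constants contribute opposite amounts.
    Only the remainder, of modulus at most [B], is left. *)
Lemma rect_form_small a b c d (u : C) (K : R[i]) (B : R) : a <= b -> c <= d ->
  rect_derivable a b c d ->
  (forall x y, a <= x <= b -> c <= y <= d ->
    normc (g (x +i* y) - g u - K * ((x +i* y) - u)) <= B) ->
  normc (rect_form g a b c d) <= 4 * B * ((b - a) + (d - c)).
Proof.
move=> ab cd gd gB; rewrite /rect_form.
have cv x : a <= x <= b -> ccontinuous_on c d (fun y => g (x +i* y)).
  by move=> xab; exact: rect_continuous_v gd.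
have ch y : c <= y <= d -> ccontinuous_on a b (fun x => g (x +i* y)).
  by move=> ycd; exact: rect_continuous_h gd.
have ea : a <= a <= b by rewrite lexx.
have eb : a <= b <= b by rewrite lexx andbT.
have ec : c <= c <= d by rewrite lexx.
have ed : c <= d <= d by rewrite lexx andbT.
set I1 := cintg c d _; set I2 := cintg a b _.
have h1 : normc (I1 - (d - c)%:C * (K * (b - a)%:C)) <= 2 * (B + B) * (d - c).
  apply: cint_itv_near_cst => //; first by apply: ccontinuousB; exact: cv.
  move=> y ycd; have := gB _ _ eb ycd; have := gB _ _ ea ycd.
  set A1 := (X in normc X <= B -> _); set A2 := (X in _ -> normc X <= B -> _).
  move=> h1 h2; rewrite (_ : _ - _ = A2 - A1).
    by rewrite (le_trans (normcB_le _ _))// lerD.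
  rewrite /A1 /A2.
  have -> : (b - a)%:C = (b +i* y) - (a +i* y) :> R[i].
    by apply: eqcP => /=; rewrite ?subrr.
  ring.
have h2 : normc (I2 - (b - a)%:C * (K * ('i%C * (d - c)%:C))) <=
    2 * (B + B) * (b - a).
  apply: cint_itv_near_cst => //; first by apply: ccontinuousB; exact: ch.
  move=> x xab; have := gB _ _ xab ed; have := gB _ _ xab ec.
  set A1 := (X in normc X <= B -> _); set A2 := (X in _ -> normc X <= B -> _).
  move=> h3 h2; rewrite (_ : _ - _ = A2 - A1).
    by rewrite (le_trans (normcB_le _ _))// lerD.
  rewrite /A1 /A2.
  have -> : 'i%C * (d - c)%:C = (x +i* d) - (x +i* c) :> R[i].
    by apply: eqcP; rewrite ?ReM ?ImM ?ReD ?ImD ?ReN ?ImN /=; ring.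
  ring.
rewrite (_ : _ - _ = 'i%C * (I1 - (d - c)%:C * (K * (b - a)%:C)) -
    (I2 - (b - a)%:C * (K * ('i%C * (d - c)%:C)))); last by ring.
rewrite (le_trans (normcB_le _ _))// Normc.normcM.
rewrite (_ : normc 'i%C = 1); last by rewrite /= expr0n/= expr1n add0r sqrtr1.
rewrite mul1r (le_trans (lerD h1 h2))// le_eqVlt; apply/orP; left.
by apply/eqP; ring.
Qed.

End goursat.

Section goursat_theorem.
Variable R : realType.
Local Notation C := (R[i]^o).

Lemma expn_half_lt (A r : R) : 0 <= A -> 0 < r -> exists n, A / 2 ^+ n < r.
Proof.
move=> A0 r0; have := archi_boundP (divr_ge0 A0 (ltW r0)).
move: (Num.bound (A / r)) => n An; exists n.
rewrite ltr_pdivrMr ?exprn_gt0// mulrC -ltr_pdivrMr//.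
by rewrite (lt_le_trans An)// -natrX ler_nat ltnW// ltn_expl.
Qed.

(** The left ends increase and stay below every right end, so their limit lies in all the
    intervals. *)
Lemma nested_bisection (u : nat -> R) (A : R) :
  (forall n, u n <= u n.+1) ->
  (forall n, u n.+1 + A / 2 ^+ n.+1 <= u n + A / 2 ^+ n) -> 0 <= A ->
  exists s, forall n, u n <= s <= u n + A / 2 ^+ n.
Proof.
move=> u1 u2 A0.
have A20 n : 0 <= A / 2 ^+ n by rewrite divr_ge0// exprn_ge0.
have nd : {homo u : n m / (n <= m)%N >-> n <= m} by apply/nondecreasing_seqP.
have ni : {homo (fun n => u n + A / 2 ^+ n) : n m / (n <= m)%N >-> m <= n}.
  by apply/nonincreasing_seqP.
have uv m n : u m <= u n + A / 2 ^+ n.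
  have [mn|/ltnW nm] := leqP m n.
    by rewrite (le_trans (nd _ _ mn))// lerDl.
  by rewrite (le_trans _ (ni _ _ nm))// lerDl.
have cu : cvgn u.
  apply: nondecreasing_is_cvgn => //; exists (u 0 + A / 2 ^+ 0) => _ [m _ <-].
  exact: uv.
exists (limn u) => n; apply/andP; split; first exact: nondecreasing_cvgn_le.
by apply: limr_le => //; apply: nearW => m; exact: uv.
Qed.

Variable g : C -> C.

Lemma rect_derivableS a b c d a' b' c' d' : a <= a' -> b' <= b -> c <= c' ->
  d' <= d -> rect_derivable g a b c d -> rect_derivable g a' b' c' d'.
Proof.
move=> aa bb cc dd gd x y /andP[xa xb] /andP[yc yd]; apply: gd.
  by rewrite (le_trans aa)//= (le_trans xb).
by rewrite (le_trans cc)//= (le_trans yd).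
Qed.

(** The boundary integral is the sum of those of the four quarters, so one of them carries at least
    a fourth of its modulus. *)
Lemma rect_form_quarter a c h k : 0 <= h -> 0 <= k ->
  rect_derivable g a (a + (h + h)) c (c + (k + k)) ->
  exists a' c', [/\ a <= a' <= a + h, c <= c' <= c + k &
    normc (rect_form g a (a + (h + h)) c (c + (k + k))) <=
    4 * normc (rect_form g a' (a' + h) c' (c' + k))].
Proof.
move=> h0 k0 gd; set E := normc (rect_form g a _ c _).
apply: contrapT => no.
have lt4 a' c' : a <= a' <= a + h -> c <= c' <= c + k ->
    normc (rect_form g a' (a' + h) c' (c' + k)) < E / 4.
  move=> aa cc; rewrite ltNge; apply/negP => le4; apply: no.
  by exists a', c'; split => //; rewrite mulrC -ler_pdivrMr.
have a1 : a <= a <= a + h by rewrite lexx lerDl.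
have a2 : a <= a + h <= a + h by rewrite lexx lerDl h0.
have c1 : c <= c <= c + k by rewrite lexx lerDl.
have c2 : c <= c + k <= c + k by rewrite lexx lerDl k0.
have E11 := lt4 _ _ a1 c1; have E12 := lt4 _ _ a1 c2.
have E21 := lt4 _ _ a2 c1; have E22 := lt4 _ _ a2 c2.
suff : E < E by rewrite ltxx.
have hh : a <= a + h <= a + (h + h) by rewrite lerDl h0 lerD2l lerDl.
have kk : c <= c + k <= c + (k + k) by rewrite lerDl k0 lerD2l lerDl.
have hh0 : a <= a + (h + h) by rewrite lerDl addr_ge0.
have kk0 : c <= c + (k + k) by rewrite lerDl addr_ge0.
have EE : rect_form g a (a + (h + h)) c (c + (k + k)) =
    rect_form g a (a + h) c (c + k) +
    rect_form g a (a + h) (c + k) (c + k + k) +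
    (rect_form g (a + h) (a + h + h) c (c + k) +
    rect_form g (a + h) (a + h + h) (c + k) (c + k + k)).
  rewrite (rect_form_split_h hh)// !(rect_form_split_v kk) ?addrA ?lerDl//;
    by apply: rect_derivableS gd; rewrite ?lexx ?addrA ?lerDl.
have {EE} : E <= normc (rect_form g a (a + h) c (c + k)) +
    normc (rect_form g a (a + h) (c + k) (c + k + k)) +
    (normc (rect_form g (a + h) (a + h + h) c (c + k)) +
    normc (rect_form g (a + h) (a + h + h) (c + k) (c + k + k))).
  rewrite /E EE; apply: le_trans (normcD_le _ _) _.
  by apply: lerD; exact: normcD_le.
move: E11 E12 E21 E22; do 4 move: (normc (rect_form _ _ _ _ _)) => ?; lra.
Qed.

Theorem goursat a b c d : a <= b -> c <= d -> rect_derivable g a b c d ->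
  rect_form g a b c d = 0.
Proof.
move=> ab cd gd; apply/eqP; rewrite -normc_eq0 -[_ == _]negbK; apply/negP => E0.
set E := normc _ in E0; have {}E0 : 0 < E by rewrite lt_neqAle eq_sym E0 normc_ge0.
set A := b - a; set B := d - c.
have A0 : 0 <= A by rewrite subr_ge0.
have B0 : 0 <= B by rewrite subr_ge0.
(* A state is a depth and a lower left corner; its rectangle has sides [A / 2 ^+ n] and [B / 2 ^+ n]
   and a boundary integral of modulus at least [E / 4 ^+ n]. *)
pose Q (q : nat * (R * R)) :=
  [/\ a <= q.2.1, q.2.1 + A / 2 ^+ q.1 <= b, c <= q.2.2,
      q.2.2 + B / 2 ^+ q.1 <= d & E <= 4 ^+ q.1 *
      normc (rect_form g q.2.1 (q.2.1 + A / 2 ^+ q.1)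
                         q.2.2 (q.2.2 + B / 2 ^+ q.1))].
pose next (p q : nat * (R * R)) := [/\ q.1 = p.1.+1,
  p.2.1 <= q.2.1, q.2.1 + A / 2 ^+ q.1 <= p.2.1 + A / 2 ^+ p.1,
  p.2.2 <= q.2.2 & q.2.2 + B / 2 ^+ q.1 <= p.2.2 + B / 2 ^+ p.1].
have halfE (X : R) n : X / 2 ^+ n = X / 2 ^+ n.+1 + X / 2 ^+ n.+1.
  by rewrite exprS; field; rewrite expf_neq0.
have step (p : {q | Q q}) : {q : {q | Q q} | next (sval p) (sval q)}.
  apply: cid; case: p => -[n [x y]] [/= ax xb cy yd En].
  have xd : rect_derivable g x (x + A / 2 ^+ n) y (y + B / 2 ^+ n).
    exact: rect_derivableS gd.
  rewrite !(halfE _ n) in xd En xb yd *.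
  set h := A / 2 ^+ n.+1 in xd En xb *; set k := B / 2 ^+ n.+1 in xd En yd *.
  have h0 : 0 <= h by rewrite divr_ge0// exprn_ge0.
  have k0 : 0 <= k by rewrite divr_ge0// exprn_ge0.
  have [x' [y' [/andP[xx xh] /andP[yy yk] le4]]] := rect_form_quarter h0 k0 xd.
  have q' : Q (n.+1, (x', y')).
    split => /=; rewrite -/h -/k.
    - exact: le_trans xx.
    - by rewrite (le_trans _ xb)// addrA lerD2r.
    - exact: le_trans yy.
    - by rewrite (le_trans _ yd)// addrA lerD2r.
    - apply: le_trans En _; rewrite (exprSr 4 n) -mulrA.
      by rewrite ler_wpM2l// exprn_ge0.
  exists (exist _ _ q') => /=; split => //=; rewrite (halfE _ n) -/h -/k.
    by rewrite addrA lerD2r.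
  by rewrite addrA lerD2r.
have q0 : Q (0, (a, c)).
  have AE : a + A = b by rewrite /A addrC subrK.
  have BE : c + B = d by rewrite /B addrC subrK.
  by rewrite /Q /= !expr0 !divr1 mul1r AE BE /E !lexx; split.
have [f [f0 fS]] := dependent_choice step (exist _ _ q0).
have f1 n : (sval (f n)).1 = n.
  by elim: n => [|n IH]; [rewrite f0|have [-> _ _ _ _] := fS n; rewrite IH].
pose u n := (sval (f n)).2.1; pose v n := (sval (f n)).2.2.
have [s hs] : exists s, forall n, u n <= s <= u n + A / 2 ^+ n.
  apply: nested_bisection => // n; have [] := fS n; first by [].
  by rewrite !f1.
have [t ht] : exists t, forall n, v n <= t <= v n + B / 2 ^+ n.
  apply: nested_bisection => // n; have [] := fS n; first by [].
  by rewrite !f1.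
have fQ n : [/\ a <= u n, u n + A / 2 ^+ n <= b, c <= v n,
      v n + B / 2 ^+ n <= d & E <= 4 ^+ n *
      normc (rect_form g (u n) (u n + A / 2 ^+ n) (v n) (v n + B / 2 ^+ n))].
  by have := svalP (f n); rewrite /Q f1.
have sab : a <= s <= b.
  have [/= un nb _ _ _] := fQ 0; have /andP[us su] := hs 0.
  by rewrite (le_trans un us) (le_trans su nb).
have tcd : c <= t <= d.
  have [_ _ vn nd _] := fQ 0; have /andP[vt tv] := ht 0.
  by rewrite (le_trans vn vt) (le_trans tv nd).
have [K HK] := derivable_affine (gd _ _ sab tcd).
set M := (A + B) ^+ 2.
have M0 : 0 <= M by rewrite sqr_ge0.
(* With error rate [e], [rect_form_small] at depth [n] gives [4 ^+ n * 4 * e * ((A + B) / 2 ^+ n) ^+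
   2 = 4 * e * M], which is below [E / 2] for this [e]. The [+ 1] covers a rectangle reduced to a
   point, where [M = 0]. *)
have e0 : 0 < E / (8 * (M + 1)) by rewrite divr_gt0// mulr_gt0// ltr_wpDl.
have [r r0 hr] := HK _ e0.
have [n nr] := expn_half_lt (addr_ge0 A0 B0) r0.
have [un nb vn nd En] := fQ n.
have /andP[us su] := hs n; have /andP[vt tv] := ht n.
have D0 : 0 <= (A + B) / 2 ^+ n by rewrite divr_ge0 ?exprn_ge0// addr_ge0.
have := @rect_form_small _ g (u n) (u n + A / 2 ^+ n) (v n) (v n + B / 2 ^+ n)
  (s +i* t) K (E / (8 * (M + 1)) * ((A + B) / 2 ^+ n)).
have uA : u n <= u n + A / 2 ^+ n by rewrite lerDl divr_ge0// exprn_ge0.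
have vB : v n <= v n + B / 2 ^+ n by rewrite lerDl divr_ge0// exprn_ge0.
move=> /(_ uA vB).
have -> : u n + A / 2 ^+ n - u n + (v n + B / 2 ^+ n - v n) = (A + B) / 2 ^+ n.
  by rewrite (mulrDl A B); move: (A / _) (B / _) => A' B'; ring.
have X0 : 0 < 4 ^+ n :> R by rewrite exprn_gt0.
move=> small; suff : E < E by rewrite ltxx.
apply: (le_lt_trans En); apply: (@le_lt_trans _ _ (4 ^+ n *
  (4 * (E / (8 * (M + 1)) * ((A + B) / 2 ^+ n)) * ((A + B) / 2 ^+ n)))).
  rewrite ler_pM2l//; apply: small.
    by apply: rect_derivableS gd.
  move=> x y /andP[ux xu] /andP[vy yv].
  have dist : normc ((x +i* y) - (s +i* t)) <= (A + B) / 2 ^+ n.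
    rewrite (le_trans (normc_le_ReIm _))//= mulrDl lerD// ler_norml; lra.
  rewrite (le_trans (hr _ (le_lt_trans dist nr)))//.
  by rewrite ler_wpM2l// ltW.
have -> : 4 ^+ n * (4 * (E / (8 * (M + 1)) * ((A + B) / 2 ^+ n)) *
    ((A + B) / 2 ^+ n)) = E * (M / (2 * (M + 1))).
  have -> : 4 ^+ n = 2 ^+ n * 2 ^+ n :> R by rewrite -exprMn -natrM.
  rewrite /M; field.
  rewrite expf_neq0// andbT; apply: lt0r_neq0; rewrite -/M; lra.
rewrite -[ltRHS]mulr1 ltr_pM2l// ltr_pdivrMr; lra.
Qed.

End goursat_theorem.

(** * Measure-preserving maps and translations of the line *)

Section measure_preserving.
Local Open Scope ereal_scope.
Context d1 d2 (X : measurableType d1) (Y : measurableType d2) (R : realType).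
Variables (phi : X -> Y) (mu : {measure set X -> \bar R})
  (nu : {measure set Y -> \bar R}).
Hypothesis mphi : measurable_fun setT phi.
Hypothesis mu_phi : forall A, measurable A -> mu (phi @^-1` A) = nu A.

Lemma ge0_integral_preserving D (f : Y -> \bar R) :
  measurable D -> measurable_fun D f -> (forall y, D y -> 0 <= f y) ->
  \int[mu]_(x in phi @^-1` D) f (phi x) = \int[nu]_(y in D) f y.
Proof.
move=> mD mf f0; rewrite -(@ge0_integral_pushforward _ _ _ _ _ _ mphi mu D f)//.
  by apply: eq_measure_integral => A mA _; exact: mu_phi.
by move=> y; rewrite inE; exact: f0.
Qed.

Lemma integral_preserving D (f : Y -> \bar R) :
  measurable D -> measurable_fun D f ->
  \int[mu]_(x in phi @^-1` D) f (phi x) = \int[nu]_(y in D) f y.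
Proof.
move=> mD mf; rewrite integralE [RHS]integralE; congr (_ - _).
  rewrite -(ge0_integral_preserving mD (measurable_funepos mf))//.
  by apply: eq_integral => x _; rewrite !funeposE.
rewrite -(ge0_integral_preserving mD (measurable_funeneg mf))//.
by apply: eq_integral => x _; rewrite !funenegE.
Qed.

End measure_preserving.

Section cint_preserving.
Context d1 d2 (X : measurableType d1) (Y : measurableType d2) (R : realType).
Variables (phi : X -> Y) (mu : {measure set X -> \bar R})
  (nu : {measure set Y -> \bar R}).
Hypothesis mphi : measurable_fun setT phi.
Hypothesis mu_phi : forall A, measurable A -> mu (phi @^-1` A) = nu A.

Lemma cint_preserving D (F : Y -> R[i]) : measurable D -> cintegrable nu D F ->
  cint mu (phi @^-1` D) (fun x => F (phi x)) = cint nu D F.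
Proof.
move=> mD [/integrableP[Fr _] /integrableP[Fi _]].
congr Complex; congr fine.
  exact: (integral_preserving mphi mu_phi mD Fr).
exact: (integral_preserving mphi mu_phi mD Fi).
Qed.

End cint_preserving.

Section translation.
Variable R : realType.
Local Notation leb := (@lebesgue_measure R).

(** Uniqueness of the Lebesgue measure: the translated measure gives half-open intervals their
    length. *)
Lemma lebesgue_measureD (c : R) (A : set (measurableTypeR R)) : measurable A ->
  leb ((fun x => x + c) @^-1` A) = leb A.
Proof.
move=> mA; rewrite -[LHS]/(pushforward leb
  ((fun x => x + c) : measurableTypeR R -> measurableTypeR R) A).
apply/esym/lebesgue_measure_unique => //=.
  exact: measurable_funD.
move=> ? _ [[a b] _ <-].
rewrite /pushforward (_ : _ @^-1` _ = `]a - c, b - c]%classic); last first.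
  by apply/seteqP; split => x /=; rewrite !in_itv/= ltrBlDr lerBrDr.
rewrite !lebesgue_measure_itv/= !lte_fin ltrD2r; case: ifP => // _.
by rewrite -!EFinD; congr EFin; ring.
Qed.

Lemma cint_itv_shift (a b c : R) (F : R -> R[i]^o) :
  ccontinuous_on (a + c) (b + c) F ->
  cint leb `[a, b] (fun t => F (t + c)) = cint leb `[a + c, b + c] F.
Proof.
move=> /cintegrable_itv iF.
have mD : measurable_fun setT
    ((fun x => x + c) : measurableTypeR R -> measurableTypeR R).
  exact: measurable_funD.
rewrite -(cint_preserving mD (@lebesgue_measureD c) _ iF)//.
rewrite (_ : _ @^-1` _ = `[a, b]%classic)//.
by apply/seteqP; split => x /=; rewrite !in_itv/= !lerD2r.
Qed.

(** The shifted interval [[c, p + c]] is cut at [p], and periodicity carries [[p, p + c]] back to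
    [[0, c]]. *)
Lemma cint_period_shift (p c : R) (F : R -> R[i]^o) : 0 <= c <= p ->
  continuous F -> (forall t, F (t + p) = F t) ->
  cint leb `[0, p] (fun t => F (t + c)) = cint leb `[0, p] F.
Proof.
move=> /andP[c0 cp] cF Fp.
have cc a b : ccontinuous_on a b F by move=> t _; exact: cF.
rewrite cint_itv_shift// add0r.
rewrite (@cint_itv_split _ c p (p + c))// ?cp ?lerDl//.
rewrite (addrC p c) -{2}(add0r p) -cint_itv_shift//.
have -> : cint leb `[0, c] (fun t => F (t + p)) = cint leb `[0, c] F.
  by apply: eq_cint => t _; exact: Fp.
by rewrite addrC -cint_itv_split// c0.
Qed.

End translation.

(** * The functions [cis] and [cexp], and polar form *)

Section complex_exponential.
Variable R : realType.
Local Notation C := (R[i]^o).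
Implicit Types z w : R[i].

Definition cis (t : R) : R[i] := cos t +i* sin t.

Definition cexp z : R[i] := (expR (Re z))%:C * cis (Im z).

Lemma cisD s t : cis (s + t) = cis s * cis t.
Proof.
by apply: eqcP; rewrite ?ReM ?ImM /= ?cosD ?sinD//; ring.
Qed.

Lemma normc_cis t : normc (cis t) = 1.
Proof.
by apply/eqP; rewrite -(@eqrXn2 _ 2)// ?normc_ge0// sqr_normc_ReIm/= cos2Dsin2 expr1n.
Qed.

Lemma cis_neq0 t : cis t != 0.
Proof. by rewrite -normc_eq0 normc_cis oner_eq0. Qed.

Lemma cis2pi t : cis (t + pi *+ 2) = cis t.
Proof. by rewrite /cis cosD2pi sinD2pi. Qed.

Lemma cisJ t : (cis t)^* = (cis t)^-1.
Proof.
apply: (mulfI (cis_neq0 t)); rewrite mulfV ?cis_neq0// mulcJ normc_cis.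
by rewrite expr1n.
Qed.

Lemma cexpD z w : cexp (z + w) = cexp z * cexp w.
Proof.
rewrite /cexp ReD ImD expRD cisD rmorphM/=; ring.
Qed.

Lemma normc_cexp z : normc (cexp z) = expR (Re z).
Proof. by rewrite /cexp Normc.normcM normc_cis mulr1 normcR ger0_norm// expR_ge0. Qed.

Lemma cexp_neq0 z : cexp z != 0.
Proof. by rewrite -normc_eq0 normc_cexp gt_eqF// expR_gt0. Qed.

Lemma cexp_ln (r t : R) : 0 < r -> cexp (ln r +i* t) = r%:C * cis t.
Proof. by move=> r0; rewrite /cexp /= lnK. Qed.

Lemma cexp_ReIm (r t : R) : cexp (r +i* t) = (expR r)%:C * cis t.
Proof. by []. Qed.

(** The argument is [acos (Re z / normc z)] in the closed upper half-plane and
    [2 pi - acos (Re z / normc z)] below it. The range of [t] is that of the parameter of circle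
    integrals, so [t] can serve as a shift of the period. *)
Lemma polar z : exists2 t : R, 0 <= t <= pi *+ 2 & z = (normc z)%:C * cis t.
Proof.
have [->|z0] := eqVneq z 0.
  exists 0; last by rewrite Normc.normc0 mul0r.
  by rewrite lexx mulrn_wge0 ?pi_ge0.
have n0 : normc z != 0 by rewrite normc_eq0.
pose x := Re z / normc z; pose y := Im z / normc z.
have xy : x ^+ 2 + y ^+ 2 = 1.
  rewrite /x /y !expr_div_n -mulrDl -sqr_normc_ReIm divff//.
  by rewrite expf_neq0.
have x1 : -1 <= x <= 1.
  rewrite -ler_norml -(@ler_pXn2r _ 2)// ?nnegrE// expr1n real_normK ?num_real//.
  by rewrite -xy lerDl sqr_ge0.
have zE : z = (normc z)%:C * (x +i* y).
  by apply: eqcP; rewrite ?ReM ?ImM /= ?mul0r ?subr0 ?addr0 /x /y mulrCA divff// mulr1.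
have cx : cos (acos x) = x by apply: acosK; rewrite in_itv.
have sx : sin (acos x) = Num.sqrt (1 - x ^+ 2) by rewrite sin_acos.
have yE : y ^+ 2 = 1 - x ^+ 2 by rewrite -xy; ring.
rewrite -yE sqrtr_sqr in sx.
have [y0|y0] := leP 0 y.
  exists (acos x); first by rewrite acos_ge0// (le_trans (acos_lepi x1))// mulr2n lerDl pi_ge0.
  by rewrite /cis cx sx ger0_norm.
exists (pi *+ 2 - acos x).
  rewrite subr_ge0 lerBlDr lerDl acos_ge0// andbT.
  by rewrite (le_trans (acos_lepi x1))// mulr2n lerDl pi_ge0.
rewrite /cis addrC cosD2pi sinD2pi cosN sinN cx sx ltr0_norm// opprK.
exact: zE.
Qed.

End complex_exponential.

(** * The complex exponential *)

Section cexp_derivable.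
Variable R : realType.
Local Notation C := (R[i]^o).

Lemma is_derive_affine (f : R -> R) (x df : R) : is_derive x 1 f df ->
  forall e, 0 < e -> exists2 r, 0 < r &
    forall w, `|w - x| < r -> `|f w - f x - df * (w - x)| <= e * `|w - x|.
Proof.
move=> [/cvg_ex[/= l fl] dfE] e e0.
have {}dfE : l = df by rewrite -dfE; apply/esym/cvg_lim.
subst l; move/cvgrPdist_lt : fl => /(_ _ e0).
rewrite near_withinE => /nbhs_ballP[r /= r0 er].
exists r => // w wr.
have [->|wu] := eqVneq w x; first by rewrite !subrr mulr0 subr0 normr0 mulr0.
have wu0 : w - x != 0 by rewrite subr_eq0.
have := er (w - x); rewrite /ball/= sub0r normrN => /(_ wr wu0) /ltW.
rewrite /shift/= [_ *: 1]mulr1 subrK => h.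
have -> : f w - f x - df * (w - x) = - (df - (w - x)^-1 *: (f w - f x)) * (w - x).
  by rewrite opprB mulrBl [_ *: _]mulrC mulfVK.
by rewrite normrM normrN ler_wpM2r.
Qed.

(** By [cexpD] everything reduces to the expansion [cexp z = 1 + z + o(z)] at 0, which follows from
    those of [expR], [cos] and [sin]. *)
Lemma derivable_cexp (u : C) : derivable (@cexp R : C -> C) u 1.
Proof.
apply/cvg_ex; exists (cexp u : C); apply/cvg_normcP => e e0.
have n0 : 0 < normc (cexp u) by rewrite normc_gt0 cexp_neq0.
(* The real expansions with error rate [d] add up to an error [6 * d * normc z]. Dividing by 8
   rather than 6 leaves a strict inequality, and [d <= 1] controls the products. *)
pose d := Num.min 1 (e / (normc (cexp u) * 8)).
have d0 : 0 < d by rewrite lt_min ltr01/= divr_gt0// mulr_gt0.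
have d1 : d <= 1 by rewrite ge_min lexx.
have [r1 r10 h1] := is_derive_affine (is_derive_expR (0 : R)) d0.
have [r2 r20 h2] := is_derive_affine (is_derive_cos (0 : R)) d0.
have [r3 r30 h3] := is_derive_affine (is_derive_sin (0 : R)) d0.
rewrite near_withinE; apply/nbhs_normcP.
exists (Num.min (Num.min r1 r2) (Num.min r3 (d / 4))).
  by rewrite !lt_min r10 r20 r30 divr_gt0.
move=> -[x y]; rewrite subr0 !lt_min => /andP[/andP[z1 z2] /andP[z3 z4]] zneq0.
set z := x +i* y in z1 z2 z3 z4 zneq0 *.
have xz : `|x| <= normc z by exact: (normc_Re_le z).
have yz : `|y| <= normc z by exact: (normc_Im_le z).
have := h1 x; rewrite subr0 expR0 mul1r => /(_ (le_lt_trans xz z1)) {}h1.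
have := h2 y; rewrite subr0 cos0 sin0 oppr0 mul0r subr0
  => /(_ (le_lt_trans yz z2)) {}h2.
have := h3 y; rewrite subr0 cos0 sin0 subr0 mul1r
  => /(_ (le_lt_trans yz z3)) {}h3.
have nz : 0 < normc z by rewrite normc_gt0.
have key : normc (cexp z - 1 - z) <= 6 * d * normc z.
  have hx : `|expR x - 1| <= 2 * normc z.
    rewrite -(subrK x (expR x - 1)) (le_trans (ler_normD _ _))//.
    rewrite mulr_natl mulr2n lerD// (le_trans h1)//.
    by rewrite (le_trans _ xz)// ler_piMl.
  have hc : `|cos y - 1| <= d * normc z by rewrite (le_trans h2)// ler_wpM2l// ltW.
  have hs : `|sin y - y| <= d * normc z by rewrite (le_trans h3)// ler_wpM2l// ltW.
  have he : `|expR x - 1 - x| <= d * normc z.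
    by rewrite (le_trans h1)// ler_wpM2l// ltW.
  have zd : 2 * normc z <= d.
    by rewrite mulrC -ler_pdivlMr// (le_trans (ltW z4))// ler_pM2l// lef_pV2 ?posrE// ler_nat.
  rewrite (le_trans (normc_le_ReIm _))// !(ReD, ImD, ReN, ImN)/=.
  have -> : expR x * cos y - 0 * sin y - 1 - x =
     (expR x - 1 - x) + (expR x - 1) * (cos y - 1) + (cos y - 1) by ring.
  have -> : expR x * sin y + 0 * cos y - 0 - y =
     (expR x - 1) * (sin y) + (sin y - y) by ring.
  have p1 : `|(expR x - 1) * (cos y - 1)| <= d * normc z.
    rewrite normrM -[leRHS]mul1r ler_pM//.
    by rewrite (le_trans hx)// (le_trans zd).
  have p2 : `|(expR x - 1) * sin y| <= 2 * (d * normc z).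
    rewrite normrM.
    have hsy : `|sin y| <= 2 * normc z.
      rewrite -(subrK y (sin y)) (le_trans (ler_normD _ _))//.
      rewrite mulr_natl mulr2n lerD// (le_trans hs)// ler_piMl// ltW//.
    rewrite (le_trans (ler_pM _ _ hx hsy))//.
    rewrite [leRHS](_ : _ = d * (2 * normc z)); last by ring.
    by rewrite ler_wpM2r// mulr_ge0// ltW.
  have := ler_normD (expR x - 1 - x + (expR x - 1) * (cos y - 1)) (cos y - 1).
  have := ler_normD (expR x - 1 - x) ((expR x - 1) * (cos y - 1)).
  have := ler_normD ((expR x - 1) * sin y) (sin y - y).
  rewrite -[6 * d * _]mulrA.
  move: p1 p2 hs hc he; set P := d * normc z; lra.
rewrite /shift -[_ \o _]/(fun w : C => cexp (w + u)).
rewrite (_ : z%:A = z :> R[i]); last exact: mulr1.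
rewrite cexpD.
have -> : z^-1 *: (cexp z * cexp u - cexp u) - cexp u =
    (cexp z - 1 - z) * cexp u * z^-1.
  by rewrite [_ *: _]mulrC; field.
rewrite (Normc.normcM _ z^-1) (Normc.normcM _ (cexp u)) Normc.normcV.
rewrite ltr_pdivrMr//.
apply: le_lt_trans (ler_wpM2r (ltW n0) key) _.
rewrite mulrAC ltr_pM2r//.
have : d <= e / (normc (cexp u) * 8) by rewrite ge_min lexx orbT.
rewrite ler_pdivlMr ?mulr_gt0//.
have := mulr_gt0 d0 n0; rewrite mulrA; set P := d * normc (cexp u).
rewrite -[6 * d * _]mulrA -/P; lra.
Qed.

End cexp_derivable.

(** * Cauchy's theorem and Taylor series on a disc *)

Section circle_integral.
Variable R : realType.
Local Notation C := (R[i]^o).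
Local Notation leb := (@lebesgue_measure R).
Implicit Types h f : C -> C.

(** Integration is against [dt], that is [dz / (i z)]: a constant [c] gives [2 pi c], and an
    integral against [dz] needs an extra factor [z]. *)
Definition circ_int h (r : R) : R[i] :=
  cint leb `[0, pi *+ 2] (fun t => h (r%:C * cis t)).

Definition circ_continuous h (r : R) :=
  forall z : C, normc z = r -> {for z, continuous h}.

Lemma pi2_ge0 : 0 <= pi *+ 2 :> R.
Proof. by rewrite mulrn_wge0// pi_ge0. Qed.

Lemma pi2C_neq0 : (pi *+ 2 : R)%:C != 0.
Proof. by rewrite -normc_eq0 normcR normr_eq0 mulrn_eq0/= gt_eqF// pi_gt0. Qed.

Lemma normc_circ (r t : R) : 0 <= r -> normc (r%:C * cis t) = r.
Proof. by move=> r0; rewrite Normc.normcM normc_cis mulr1 normcR ger0_norm. Qed.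

Lemma continuous_circ (c : R[i]) : continuous (fun t : R => c * cis t : C).
Proof.
move=> t; apply: cvgMl_tmp.
apply: continuous_complex => /=; first exact: continuous_cos.
exact: continuous_sin.
Qed.

Lemma circ_continuousP h r : 0 <= r -> circ_continuous h r ->
  continuous (fun t : R => h (r%:C * cis t)).
Proof.
move=> r0 ch t.
apply: (@continuous_comp _ _ _ (fun t : R => r%:C * cis t : C) h).
  exact: continuous_circ.
by apply: ch; exact: normc_circ.
Qed.

Lemma circ_cintegrable h r : 0 <= r -> circ_continuous h r ->
  cintegrable leb `[0, pi *+ 2] (fun t => h (r%:C * cis t)).
Proof.
by move=> r0 ch; apply: cintegrable_itv => t _; exact: circ_continuousP.
Qed.

Lemma circ_intB h f r : 0 <= r -> circ_continuous h r -> circ_continuous f r ->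
  circ_int (fun z => h z - f z) r = circ_int h r - circ_int f r.
Proof. by move=> r0 ch cf; rewrite /circ_int cintB//; exact: circ_cintegrable. Qed.

Lemma circ_intZ h c r : 0 <= r -> circ_continuous h r ->
  circ_int (fun z => c * h z) r = c * circ_int h r.
Proof. by move=> r0 ch; rewrite /circ_int cintZ//; exact: circ_cintegrable. Qed.

Lemma circ_int_cst c r : circ_int (fun=> c) r = (pi *+ 2)%:C * c.
Proof.
by rewrite /circ_int cint_cst//= lebesgue_itvcc ?subr0// pi2_ge0.
Qed.

Lemma eq_circ_int h f r : 0 <= r -> (forall z, normc z = r -> h z = f z) ->
  circ_int h r = circ_int f r.
Proof. by move=> r0 hf; apply: eq_cint => t _; apply: hf; exact: normc_circ. Qed.

Lemma circ_int_norm_le h r B : 0 <= r -> circ_continuous h r ->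
  (forall z, normc z = r -> normc (h z) <= B) ->
  normc (circ_int h r) <= 2 * B * (pi *+ 2).
Proof.
move=> r0 ch hB.
have E := lebesgue_itvcc pi2_ge0; rewrite subr0 in E.
have -> : pi *+ 2 = fine (leb `[0, pi *+ 2]) by rewrite E.
apply: cint_norm_le => //.
- by rewrite /= E ltry.
- exact: circ_cintegrable.
- by move=> t _; apply: hB; exact: normc_circ.
Qed.

(* Goursat's theorem for h \o cexp on the rectangle [ln r1, ln r2] x [0, 2 pi]:
   its horizontal sides cancel by periodicity. *)
Lemma circ_int_annulus h r1 r2 : 0 < r1 <= r2 ->
  (forall z : C, r1 <= normc z <= r2 -> derivable h z 1) ->
  circ_int h r1 = circ_int h r2.
Proof.
move=> /andP[r10 r12] hd.
have r20 : 0 < r2 by exact: lt_le_trans r12.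
have lnr : ln r1 <= ln r2 by rewrite ler_ln.
pose g : C -> C := fun u => h (cexp u).
have gd c d : rect_derivable g (ln r1) (ln r2) c d.
  move=> x y /andP[x1 x2] _; apply/derivable1_diffP.
  apply: (@differentiable_comp _ _ _ _ (@cexp R : C -> C) h).
    by apply/derivable1_diffP; exact: derivable_cexp.
  apply/derivable1_diffP; apply: hd; rewrite normc_cexp /=.
  by rewrite -{1}(lnK r10) -{1}(lnK r20) !ler_expR x1.
have := goursat lnr pi2_ge0 (gd _ _); rewrite /rect_form.
rewrite [X in _ - X](_ : _ = 0); last first.
  transitivity (cint leb `[ln r1, ln r2] (fun=> 0)).
    apply: eq_cint => x _.
    by rewrite /g !cexp_ReIm -[pi *+ 2]add0r cis2pi subrr.
  by rewrite cint_cst ?mulr0.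
rewrite subr0 => /eqP; rewrite mulf_eq0 => /orP[|/eqP].
  by rewrite -normc_eq0/= expr0n expr1n add0r sqrtr1 oner_eq0.
have cv x : ln r1 <= x <= ln r2 -> cintegrable leb `[0, pi *+ 2]
    (fun y : R => g (x +i* y)).
  by move=> x12; apply: cintegrable_itv; exact: rect_continuous_v (gd 0 (pi *+ 2)).
rewrite cintB//; try by apply: cv; rewrite lexx ?lnr.
move/eqP; rewrite subr_eq0 => /eqP E; apply/esym; move: E; congr (_ = _).
  by apply: eq_cint => t _; rewrite /g cexp_ln.
by apply: eq_cint => t _; rewrite /g cexp_ln.
Qed.

(** [circ_int h] is continuous in the radius: compactness of [[0, 2 pi]] makes the continuity of [h]
    at the points of the circle uniform in the angle. *)
Lemma circ_int_limit h r0 K : 0 <= r0 -> circ_continuous h r0 ->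
  (forall e, 0 < e -> exists r, [/\ 0 <= r, `|r - r0| < e,
     circ_continuous h r & circ_int h r = K]) -> circ_int h r0 = K.
Proof.
move=> r00 ch lim.
apply/eqP; rewrite -subr_eq0 -normc_eq0 eq_le normc_ge0 andbT.
apply/ler_addgt0Pr => e e0; rewrite add0r.
(* Chosen so that [cint_norm_le] returns exactly [e]. *)
pose B := e / (2 * (pi *+ 2)).
have pi2 : 0 < pi *+ 2 :> R by rewrite mulrn_wgt0// pi_gt0.
have B0 : 0 < B by rewrite divr_gt0// mulr_gt0.
have B20 : 0 < B / 2 by rewrite divr_gt0.
have : near_covering (`[0, pi *+ 2]%classic : set R).
  exact/compact_near_coveringP/segment_compact.
move=> /(_ _ (nbhs r0)
  (fun r t => normc (h (r%:C * cis t) - h (r0%:C * cis t)) < B) _) [].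
  move=> t _.
  have cht : {for r0%:C * cis t, continuous h} by apply: ch; exact: normc_circ.
  move/cvg_normcP : cht => /(_ _ B20) /nbhs_normcP[d d0 hd].
  have c1 : {for t, continuous (fun t : R => r0%:C * cis t : C)}.
    exact: continuous_circ.
  have d20 : 0 < d / 2 by rewrite divr_gt0.
  move/cvg_normcP : c1 => /(_ _ d20) c1.
  exists ([set s | normc (r0%:C * cis s - r0%:C * cis t) < d / 2],
          ball r0 (d / 2)); first by split => //; exact: nbhsx_ballx.
  move=> [s r] /= [st rr0].
  have h1 : normc (h (r%:C * cis s) - h (r0%:C * cis t)) < B / 2.
    apply: hd; rewrite -(subrK (r0%:C * cis s) (r%:C * cis s)) -addrA.
    rewrite (le_lt_trans (normcD_le _ _))// [d]splitr ltrD//.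
    rewrite -mulrBl -rmorphB Normc.normcM normc_cis mulr1 normcR.
    by move: rr0; rewrite /ball/= distrC.
  have h2 : normc (h (r0%:C * cis s) - h (r0%:C * cis t)) < B / 2.
    by apply: hd; rewrite (lt_trans st)// ltr_pdivrMr// ltr_pMr// ltr1n.
  rewrite (_ : _ - _ = (h (r%:C * cis s) - h (r0%:C * cis t)) -
    (h (r0%:C * cis s) - h (r0%:C * cis t))); last by ring.
  by rewrite (le_lt_trans (normcB_le _ _))// [B]splitr ltrD.
move=> d /= d0 hd; have [r [r0' rd chr <-]] := lim _ d0.
have {}hd := hd r; rewrite /ball/= distrC in hd; have {}hd := hd rd.
rewrite normc_distC /circ_int -cintB//; try exact: circ_cintegrable.
have E := lebesgue_itvcc pi2_ge0; rewrite subr0 in E.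
have -> : e = 2 * B * fine (leb `[0, pi *+ 2]).
  rewrite E/= /B; move: (pi *+ 2) pi2 => p p0; field; exact: lt0r_neq0.
apply: cint_norm_le => //.
- by rewrite /= E ltry.
- by apply: cintegrableB => //; exact: circ_cintegrable.
- by move=> t t2; rewrite ltW//; exact: hd.
Qed.

(* The exceptional circle |z| = a leaves room for one singularity of h, as that
   of a difference quotient at its centre. *)
Lemma mean_value h (R0 a r : R) : 0 <= r < R0 ->
  (forall z : C, normc z < R0 -> {for z, continuous h}) ->
  (forall z : C, normc z < R0 -> z != 0 -> normc z != a -> derivable h z 1) ->
  circ_int h r = (pi *+ 2)%:C * h 0.
Proof.
move=> /andP[r0 rR0] ch dh.
have cc s : s < R0 -> circ_continuous h s by move=> sR z zs; apply: ch; rewrite zs.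
have ann0 s t : 0 < s -> s <= t -> t < R0 -> (a < s) || (t < a) ->
    circ_int h s = circ_int h t.
  move=> s0 st tR sa; apply: circ_int_annulus; first by rewrite s0.
  move=> z /andP[sz zt]; apply: dh; first exact: le_lt_trans tR.
    by rewrite -normc_gt0 (lt_le_trans s0).
  case/orP : sa => [as_|ta]; first by rewrite gt_eqF// (lt_le_trans as_).
  by rewrite lt_eqF// (le_lt_trans zt).
(* When the exceptional radius lies between [s] and [t], both circles are compared with that of
   radius [a], approached from inside and from outside by [circ_int_limit]. *)
have ann s t : 0 < s -> s <= t -> t < R0 -> circ_int h s = circ_int h t.
  move=> s0 st tR.
  have [sa|sa] := ltP a s; first by apply: ann0; rewrite ?sa.
  have [ta|ta] := ltP t a; first by apply: ann0; rewrite ?ta ?orbT.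
  have aR := le_lt_trans ta tR.
  have a0 : 0 < a by exact: lt_le_trans sa.
  transitivity (circ_int h a).
    have [->//|sa'] := eqVneq s a.
    have {}sa : s < a by rewrite lt_neqAle sa'.
    apply/esym; apply: circ_int_limit; [exact: ltW|exact: cc|].
    move=> e e0; pose u := Num.max s (a - e / 2).
    have e20 : 0 < e / 2 by rewrite divr_gt0.
    have ua : u < a by rewrite /u gt_max sa ltrBlDr ltrDl.
    have su : s <= u by rewrite /u le_max lexx.
    exists u; split.
    - by rewrite (le_trans (ltW s0)).
    - have : a - e / 2 <= u by rewrite /u le_max lexx orbT.
      rewrite ltr0_norm; lra.
    - by apply: cc; exact: lt_trans aR.
    - by apply/esym; apply: ann0; rewrite ?ua ?orbT ?(lt_trans ua).
  have [->//|ta'] := eqVneq a t.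
  have {}ta : a < t by rewrite lt_neqAle ta'.
  apply: circ_int_limit; [exact: ltW|exact: cc|].
  move=> e e0; pose u := Num.min t (a + e / 2).
  have e20 : 0 < e / 2 by rewrite divr_gt0.
  have ua : a < u by rewrite /u lt_min ta ltrDl.
  have ut : u <= t by rewrite /u ge_min lexx.
  exists u; split.
  - by rewrite ltW// (lt_trans a0).
  - have : u <= a + e / 2 by rewrite /u ge_min lexx orbT.
    rewrite gtr0_norm; lra.
  - by apply: cc; exact: le_lt_trans tR.
  - by apply: ann0; rewrite ?ua// (lt_trans a0).
(* The right-hand side is read as the integral over the circle of radius 0, which is then reached as
   a limit of small circles. *)
rewrite -[RHS](circ_int_cst _ 0).
rewrite -[RHS]/(circ_int (fun=> h 0) 0) -(_ : circ_int h 0 = circ_int (fun=> h 0) 0); last first.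
  by apply: eq_circ_int => // z /Normc.eq0_normc ->.
have [->//|rn0] := eqVneq r 0; have {rn0}r0 : 0 < r by rewrite lt_neqAle eq_sym rn0.
apply/esym; apply: circ_int_limit => //; first by apply: cc; exact: lt_trans rR0.
move=> e e0; pose u := Num.min r (e / 2).
have e20 : 0 < e / 2 by rewrite divr_gt0.
have u0 : 0 < u by rewrite /u lt_min r0.
have ur : u <= r by rewrite /u ge_min lexx.
exists u; split.
- exact: ltW.
- have : u <= e / 2 by rewrite /u ge_min lexx orbT.
  rewrite subr0 gtr0_norm; lra.
- by apply: cc; exact: le_lt_trans rR0.
- exact: ann.
Qed.

End circle_integral.

Section taylor.
Variable R : realType.
Local Notation C := (R[i]^o).
Implicit Types h f : C -> C.
Local Opaque cint.

(** Since [circ_int] integrates against [dz / (i z)], this is Cauchy's formula with denominator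
    [z ^+ k.+1]. *)
Definition taylor_coef f (k : nat) (r : R) : R[i] :=
  (pi *+ 2)%:C^-1 * circ_int (fun z => f z / z ^+ k) r.

Lemma derivable_mulc f h (z : C) : derivable f z 1 -> derivable h z 1 ->
  derivable (fun w : C => f w * h w : C) z 1.
Proof. by move=> df dh; have := @derivableM R[i] C f h z 1 df dh; exact. Qed.

Lemma derivable_invc f (z : C) : f z != 0 -> derivable f z 1 ->
  derivable (fun w : C => (f w)^-1 : C) z 1.
Proof. by move=> f0 df; have := @derivableV R[i] C f z 1 f0 df; exact. Qed.

Lemma derivable_expNc (k : nat) (z : C) (z0 : z != 0) :
  derivable (fun w : C => (w ^+ k)^-1 : C) z 1.
Proof.
apply: (@derivable_invc (fun w : C => w ^+ k)).
  by rewrite expf_neq0.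
by have := @exprn_derivable R[i] k z 1; exact.
Qed.

Lemma derivable_div_exp f k (z : C) : z != 0 -> derivable f z 1 ->
  derivable (fun w : C => f w / w ^+ k : C) z 1.
Proof.
move=> z0 df; exact: derivable_mulc df (@derivable_expNc k z z0).
Qed.

Lemma circ_continuous_derivable h r : (forall z : C, normc z = r -> derivable h z 1) ->
  circ_continuous h r.
Proof. by move=> dh z /dh; exact: derivable_continuous. Qed.

Lemma taylor_coef_radius f R0 k r1 r2 : 0 < r1 < R0 -> 0 < r2 < R0 ->
  (forall z : C, normc z < R0 -> derivable f z 1) ->
  taylor_coef f k r1 = taylor_coef f k r2.
Proof.
move=> + + df; wlog r12 : r1 r2 / r1 <= r2.
  move=> wl r1R r2R; have [r12|/ltW r21] := leP r1 r2; first exact: wl.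
  by apply/esym; exact: wl.
move=> /andP[r10 _] /andP[_ r2R]; rewrite /taylor_coef.
rewrite (@circ_int_annulus _ (fun z : C => f z / z ^+ k) r1 r2) ?r10//.
move=> z /andP[r1z zr2]; apply: derivable_div_exp.
  by rewrite -normc_gt0 (lt_le_trans r10).
by apply: df; exact: le_lt_trans r2R.
Qed.

(** Doubling the radius leaves the integral unchanged, yet homogeneity divides it by [2 ^+ k]; for
    [k > 0] it must vanish. *)
Lemma circ_int_expN k r : 0 < r ->
  circ_int (fun z : C => (z ^+ k)^-1) r = if k == 0 then (pi *+ 2)%:C else 0.
Proof.
move=> r0; case: eqP => [->|/eqP k0].
  rewrite (eq_circ_int (f := fun=> 1)) ?ltW//.
    by rewrite circ_int_cst mulr1.
  by move=> z _; rewrite expr0 invr1.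
have dk (z : C) : z != 0 -> derivable (fun z : C => (z ^+ k)^-1) z 1.
  exact: derivable_expNc.
have E : circ_int (fun z : C => (z ^+ k)^-1) r = circ_int (fun z : C => (z ^+ k)^-1) (2 * r).
  apply: circ_int_annulus; first by rewrite r0 ler_pMl// ler1n.
  by move=> z /andP[rz _]; apply: dk; rewrite -normc_gt0 (lt_le_trans r0).
have cr : circ_continuous (fun z : C => (z ^+ k)^-1) r.
  apply: circ_continuous_derivable => z zr; apply: dk.
  by rewrite -normc_gt0 zr.
have {}E : circ_int (fun z : C => (z ^+ k)^-1) r =
    (2 ^+ k)^-1 * circ_int (fun z : C => (z ^+ k)^-1) r.
  rewrite {1}E -(circ_intZ _ (ltW r0) cr); apply: eq_cint => t _.
  by rewrite -invfM -exprMn rmorphM/= rmorph_nat mulrA.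
have : (1 - (2 ^+ k)^-1) * circ_int (fun z : C => (z ^+ k)^-1) r = 0.
  by rewrite mulrBl mul1r -E subrr.
move/eqP; rewrite mulf_eq0 subr_eq0 => /orP[|/eqP//].
rewrite -{1}[1]invr1 (inj_eq invr_inj) -natrX eq_sym pnatr_eq1.
by rewrite -[X in (_ == X)%N](expn0 2) eqn_exp2l// (negbTE k0).
Qed.

Lemma circ_bounded h r : 0 <= r -> circ_continuous h r ->
  exists M, 0 <= M /\ forall z, normc z = r -> normc (h z) <= M.
Proof.
move=> r0 ch.
have cn : {within `[0, pi *+ 2], continuous (fun t : R => normc (h (r%:C * cis t)))}.
  apply: continuous_subspaceT => t.
  apply: (@continuous_comp _ _ _ (fun t : R => h (r%:C * cis t)) (@Normc.normc R)).
    exact: circ_continuousP.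
  exact: continuous_normc.
have [c _ hc] := EVT_max (pi2_ge0 R) cn.
exists (normc (h (r%:C * cis c))); split; first exact: normc_ge0.
move=> z zr; have [t t2 ->] := polar z; rewrite zr; apply: hc.
by rewrite in_itv.
Qed.

Variables (f : C -> C) (R0 : R).
Hypothesis df : forall z : C, normc z < R0 -> derivable f z 1.

(* h is z times the difference quotient of f at a. *)
Lemma cauchy_kernel (a : C) : normc a < R0 -> exists h : C -> C,
  [/\ forall z, z != a -> h z = (f z - f a) * z / (z - a),
    forall z : C, normc z < R0 -> {for z, continuous h} &
    forall r, 0 <= r < R0 -> circ_int h r = 0].
Proof.
move=> aR; have /cvg_ex[/= l fl] := df aR.
(* The value at [a] is the derivative of [f] there, which makes [q], hence [h], continuous at
   [a]. *)
pose q : C -> C := fun z => if z == a then l else (f z - f a) / (z - a).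
pose h : C -> C := fun z => q z * z.
have hE z : z != a -> h z = (f z - f a) * z / (z - a).
  by move=> za; rewrite /h /q (negbTE za) mulrAC.
have dh (z : C) : normc z < R0 -> z != a -> derivable h z 1.
  move=> zR za; have za0 : z - a != 0 by rewrite subr_eq0.
  apply: (@near_eq_derivable _ _ _ (fun z : C => (f z - f a) * z * (z - a)^-1)).
    have pza : 0 < normc (z - a) by rewrite normc_gt0.
    apply/nbhs_normcP; exists (normc (z - a)) => // w wz.
    rewrite hE//; apply: contraTneq wz => ->.
    by rewrite normc_distC ltxx.
  have dB (g : C -> C) : derivable g z 1 -> forall c, derivable (fun w : C => g w - c) z 1.
    move=> dg c; have dc : derivable (cst c : C -> C) z 1 by exact: derivable_cst.
    by have := @derivableB R[i] C C g (cst c) z 1 dg dc; exact.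
  have d1 := dB _ (df zR) (f a).
  have did : derivable (id : C -> C) z 1 by exact: derivable_id.
  have d2 := dB id did a.
  have d3 := @derivable_invc (fun w : C => w - a) z za0 d2.
  exact: derivable_mulc (derivable_mulc d1 did) d3.
have ch (z : C) : normc z < R0 -> {for z, continuous h}.
  move=> zR; have [za|za] := eqVneq z a; last exact/derivable_continuous/dh.
  subst z; apply: (@cvgM R[i] C (nbhs a) _ q id); last exact: cvg_id.
  apply/cvg_normcP => e e0; move/cvg_normcP : fl => /(_ _ e0).
  rewrite near_withinE => /nbhs_normcP[d d0 hd].
  apply/nbhs_normcP; exists d => // w wa; rewrite /q eqxx.
  have [_|wa'] := eqVneq w a; first by rewrite subrr Normc.normc0.
  have wa0 : w - a != 0 by rewrite subr_eq0.
  have := hd (w - a); rewrite subr0 => /(_ wa wa0).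
  by rewrite /shift/= [_ *: 1]mulr1 subrK [_ *: _]mulrC.
exists h; split => // r rR.
have dh' (z : C) : normc z < R0 -> z != 0 -> normc z != normc a ->
    derivable h z 1.
  move=> zR _ za; have {}za : z != a by apply: contraNneq za => ->; exact: eqxx.
  exact: dh zR za.
(* The exceptional circle is that of radius [normc a]. The mean value is [h 0], which vanishes
   because of the factor [z] of [h]. *)
by rewrite (mean_value rR ch dh') /h !mulr0.
Qed.

(** Up to the factor [2 pi], the remainder after [N > 0] terms is the integral of
    [a ^+ N * (h z / z ^+ N)] over the circle of radius [r]; it is bounded by a constant times
    [(normc a / r) ^+ N]. *)
Lemma taylor_cvg (r : R) (a : C) : 0 < r < R0 -> normc a < r ->
  (fun N => \sum_(k < N) taylor_coef f k r * a ^+ k : C) @ \oo --> f a.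
Proof.
move=> /andP[r0 rR] ar; have aR := lt_trans ar rR.
have [h [hE ch h0]] := cauchy_kernel aR.
have z0 (z : C) : normc z = r -> z != 0 by move=> zr; rewrite -normc_gt0 zr.
have za (z : C) : normc z = r -> z != a.
  by move=> zr; apply: contraTneq ar => <-; rewrite zr ltxx.
have chr : circ_continuous h r by move=> z zr; apply: ch; rewrite zr.
have [M [M0 hM]] := circ_bounded (ltW r0) chr.
have cpow k (g : C -> C) : circ_continuous g r -> circ_continuous (fun z => g z / z ^+ k) r.
  move=> cg z zr; apply: (@cvgM R[i] C (nbhs z) _ g (fun w => (w ^+ k)^-1)).
    exact: cg.
  apply: (derivable_continuous (g := fun w : C => (w ^+ k)^-1)).
  by apply: derivable_expNc; exact: z0.
have cf : circ_continuous f r.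
  by apply: circ_continuous_derivable => z zr; apply: df; rewrite zr.
have cc (c : C) : circ_continuous (fun=> c) r.
  by move=> z _; exact: cst_continuous.
have chN N : circ_continuous (fun z => a ^+ N * (h z / z ^+ N)) r.
  move=> z zr; apply: (@cvgM R[i] C (nbhs z) _ (fun=> a ^+ N) (fun w => h w / w ^+ N)).
    exact: cst_continuous.
  exact: cpow chr z zr.
(* The remainder formula, by induction. The factor [(N != 0)%:R] reflects that the integral of [h]
   is 0: the value [f a] enters at the step from 0 to 1, since the integral of [f a / z ^+ N] is
   nonzero for [N = 0] only, unless [f a = 0]. *)
have key N : (pi *+ 2)%:C * (f a * (N != 0)%:R - \sum_(k < N) taylor_coef f k r * a ^+ k)
    = circ_int (fun z => a ^+ N * (h z / z ^+ N)) r.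
  elim: N => [|N IH].
    rewrite mulr0 big_ord0 subr0 mulr0 (eq_circ_int (f := h)) ?ltW//.
      by rewrite h0// ltW.
    by move=> z _; rewrite !expr0 mul1r divr1.
  have cfN : circ_continuous (fun z : C => f z / z ^+ N) r by exact: cpow cf.
  have caN : circ_continuous (fun z : C => f a / z ^+ N) r by exact: cpow (cc (f a)).
  have cfa : circ_continuous (fun z : C => f z / z ^+ N - f a / z ^+ N) r.
    by move=> z zr; exact: (cvgB (cfN z zr) (caN z zr)).
  have : circ_int (fun z : C => a ^+ N * (h z / z ^+ N) - a ^+ N.+1 * (h z / z ^+ N.+1)) r
      = a ^+ N * circ_int (fun z : C => f z / z ^+ N - f a / z ^+ N) r.
    rewrite -(circ_intZ _ (ltW r0) cfa).
    apply: eq_circ_int; first exact: ltW.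
    move=> z zr; rewrite hE ?za// !exprS; field.
    have zn0 := z0 z zr; have zna : z - a != 0 by rewrite subr_eq0 za.
    by apply/and3P; split => //; exact: expf_neq0.
  rewrite (circ_intB (ltW r0) (chN N) (chN N.+1)) -IH => /eqP.
  rewrite subr_eq => /eqP E; apply: (addrI (a ^+ N *
    circ_int (fun z : C => f z / z ^+ N - f a / z ^+ N) r)).
  rewrite -E {E} (circ_intB (ltW r0) cfN caN).
  rewrite big_ord_recr/= {2}/taylor_coef.
  have -> : circ_int (fun z => f a / z ^+ N) r =
      f a * (if N == 0 then (pi *+ 2)%:C else 0).
    have cN : circ_continuous (fun z : C => (z ^+ N)^-1) r.
      apply: circ_continuous_derivable => z zr.
      by apply: derivable_expNc; exact: z0.
    by rewrite -(circ_int_expN N r0) -(circ_intZ _ (ltW r0) cN).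
  set I := circ_int _ _; set S := \sum_(k < N) _.
  have p0 := pi2C_neq0 R; move: ((pi *+ 2)%:C) p0 => p p0.
  have aN : N = 0 -> a ^+ N = 1 by move=> ->; rewrite expr0.
  case: (eqVneq N 0) => [/aN ->|_] /=; rewrite ?mulr0 ?mulr1; field => //.
have rho : normc (a / (r%:C)) < 1.
  by rewrite Normc.normcM Normc.normcV normcR gtr0_norm// ltr_pdivrMr// mul1r.
apply/cvg_normcP => e e0.
have geo : (fun N : nat => 2 * M * (normc a / r) ^+ N) @ \oo --> (0 : R).
  rewrite -[X in _ --> X](mulr0 (2 * M)); apply: cvgMl_tmp; apply: cvg_expr.
  by rewrite ger0_norm ?divr_ge0 ?normc_ge0 ?ltW// ltr_pdivrMr// mul1r.
move/cvgrPdist_lt : geo => /(_ _ e0) geo.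
near=> N.
have N0 : N != 0.
  by rewrite -lt0n; near: N; exact: nbhs_infty_gt.
rewrite normc_distC.
have := key N; rewrite N0 mulr1.
move/(congr1 (@Normc.normc R)); rewrite Normc.normcM normcR ger0_norm ?pi2_ge0//.
set X := normc (f a - _) => EX.
have pi20 : 0 < pi *+ 2 :> R by rewrite mulrn_wgt0// pi_gt0.
have : (pi *+ 2) * X <= 2 * (M * (normc a / r) ^+ N) * (pi *+ 2).
  rewrite EX; apply: (circ_int_norm_le (ltW r0) (chN N)) => z zr; rewrite Normc.normcM normcX Normc.normcM Normc.normcV normcX zr.
  rewrite mulrCA expr_div_n ler_wpM2r ?hM//.
  by rewrite divr_ge0// exprn_ge0// ?normc_ge0// ltW.
rewrite mulrC ler_pM2r// => /le_lt_trans; apply.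
have : `|0 - 2 * M * (normc a / r) ^+ N| < e by near: N.
rewrite sub0r normrN mulrA; apply: le_lt_trans; exact: ler_norm.
Unshelve. all: by end_near. Qed.

(** Multiplication by [eta] maps the unit circle onto that of radius [normc eta] and shifts the
    angle by the argument of [eta], which periodicity absorbs. The case [eta = 0] is apart, as it
    leaves no circle: both sides are [2 pi f 0] for [k = 0] and 0 otherwise. *)
Lemma circ_int_rotate (eta : C) k r : 0 < r < R0 -> normc eta < R0 ->
  circ_int (fun z => f (z * eta) / z ^+ k) 1 =
  (pi *+ 2)%:C * (eta ^+ k * taylor_coef f k r).
Proof.
move=> rR etaR.
have p0 := pi2C_neq0 R.
have [->|eta0] := eqVneq eta 0.
  have -> : circ_int (fun z => f (z * 0) / z ^+ k) 1 =
      f 0 * circ_int (fun z : C => (z ^+ k)^-1) 1.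
    have c1 : circ_continuous (fun z : C => (z ^+ k)^-1) 1.
      apply: circ_continuous_derivable => z z1.
      have z0 : z != 0 by rewrite -normc_gt0 z1.
      exact: derivable_expNc z0.
    rewrite -(circ_intZ _ ler01 c1).
    by apply: eq_circ_int => // z _; rewrite mulr0.
  rewrite circ_int_expN// expr0n; case: eqP => [->|_]; last by rewrite mul0r !mulr0.
  rewrite mul1r /taylor_coef mulVKf//.
  have /andP[r0 rR'] := rR.
  rewrite (eq_circ_int (f := f)) ?ltW//; last by move=> z _; rewrite expr0 divr1.
  have rR2 : 0 <= r < R0 by rewrite ltW.
  have cf (z : C) : normc z < R0 -> {for z, continuous f}.
    by move=> /df; exact: derivable_continuous.
  have df' (z : C) : normc z < R0 -> z != 0 -> normc z != 0 -> derivable f z 1.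
    by move=> /df d _ _; exact: d.
  by rewrite (mean_value rR2 cf df') mulrC.
have rho0 : 0 < normc eta by rewrite normc_gt0.
rewrite (@taylor_coef_radius f R0 k r (normc eta)) ?rho0//.
rewrite /taylor_coef mulrCA mulVKf//.
have ce : circ_continuous (fun z => f z / z ^+ k) (normc eta).
  apply: circ_continuous_derivable => z zr; apply: derivable_div_exp.
    by rewrite -normc_gt0 zr.
  by apply: df; rewrite zr.
have [t t2 etaE] := polar eta.
rewrite -(circ_intZ _ (normc_ge0 _) ce).
have cF : continuous (fun t : R => eta ^+ k *
    (f ((normc eta)%:C * cis t) / ((normc eta)%:C * cis t) ^+ k) : C).
  move=> s; apply: cvgMl_tmp; apply: (circ_continuousP (normc_ge0 _) ce).
rewrite [RHS]/circ_int -(@cint_period_shift R (pi *+ 2) t _ t2 cF); last first.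
  by move=> s; rewrite cis2pi.
apply: eq_cint => s _; rewrite mul1r.
have -> : (normc eta)%:C * cis (s + t) = cis s * eta.
  by rewrite cisD mulrCA -etaE.
rewrite exprMn; field; apply/andP; split; apply: expf_neq0 => //.
exact: cis_neq0.
Qed.

End taylor.

(** * Changes of variables in C^n *)

Section change_of_variables.
Local Open Scope ereal_scope.

(** Stated for nonnegative functions on the whole space, where no integrability is at stake, so that
    such maps compose freely. Subsets, signed functions and complex functions are recovered
    below. *)
Definition change_of_variables d (T : measurableType d) (R : realType)
    (mu : {measure set T -> \bar R}) (phi : T -> T) (w : T -> R) :=
  [/\ measurable_fun setT phi, measurable_fun setT w,
      forall x, (0 <= w x)%R &
      forall F : T -> \bar R, measurable_fun setT F -> (forall x, 0 <= F x) ->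
        \int[mu]_x F x = \int[mu]_x ((w x)%:E * F (phi x))].

Section theory.
Context d (T : measurableType d) (R : realType).
Variable mu : {measure set T -> \bar R}.
Implicit Types (phi psi : T -> T) (v w : T -> R).

Lemma change_of_variables_ext phi psi v w : phi =1 psi -> v =1 w ->
  change_of_variables mu phi v -> change_of_variables mu psi w.
Proof. by move=> /funext -> /funext ->. Qed.

Lemma change_of_variables_id : change_of_variables mu id (fun=> 1%R).
Proof.
split => //.
by move=> F _ _; apply: eq_integral => x _; rewrite mul1e.
Qed.

Lemma change_of_variables_comp phi psi v w :
  change_of_variables mu phi w -> change_of_variables mu psi v ->
  change_of_variables mu (phi \o psi) (fun x => v x * w (psi x))%R.
Proof.
move=> [mp mw w0 wE] [mps mv v0 vE]; split.
- exact: measurableT_comp.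
- by apply: measurable_funM => //; exact: measurableT_comp.
- by move=> x; rewrite mulr_ge0.
- move=> F mF F0; rewrite wE// vE.
  + by apply: eq_integral => x _; rewrite EFinM muleA.
  + apply: emeasurable_funM; first exact/measurable_EFinP.
    exact: measurableT_comp.
  + by move=> x; rewrite mule_ge0// lee_fin.
Qed.

Lemma ge0_integral_change phi w D (F : T -> \bar R) :
  change_of_variables mu phi w -> measurable D -> measurable_fun D F ->
  (forall x, D x -> 0 <= F x) ->
  \int[mu]_(x in D) F x = \int[mu]_(x in phi @^-1` D) ((w x)%:E * F (phi x)).
Proof.
move=> [mp mw w0 wE] mD mF F0.
have mpD : measurable (phi @^-1` D) by rewrite -[X in measurable X]setTI; exact: mp.
rewrite [LHS]integral_mkcond [RHS]integral_mkcond wE.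
- apply: eq_integral => x _; rewrite /patch.
  have -> : (x \in phi @^-1` D) = (phi x \in D).
    by apply/idP/idP; rewrite !inE.
  by case: ifP => //; rewrite mule0.
- by apply/(measurable_restrictT _ _).1.
- by move=> x; rewrite /patch; case: ifP => // /set_mem; exact: F0.
Qed.

Lemma integral_change phi w D (F : T -> \bar R) :
  change_of_variables mu phi w -> measurable D -> measurable_fun D F ->
  \int[mu]_(x in D) F x = \int[mu]_(x in phi @^-1` D) ((w x)%:E * F (phi x)).
Proof.
move=> cv mD mF; have [_ _ w0 _] := cv.
rewrite integralE [RHS]integralE; congr (_ - _).
  rewrite (ge0_integral_change cv mD (measurable_funepos mF))//.
  apply: eq_integral => x _; rewrite !funeposE.
  by rewrite maxe_pMr ?mule0// lee_fin.
rewrite (ge0_integral_change cv mD (measurable_funeneg mF))//.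
apply: eq_integral => x _; rewrite !funenegE.
by rewrite maxe_pMr ?mule0 ?muleN// lee_fin.
Qed.

Lemma integrable_change phi w D (F : T -> \bar R) :
  change_of_variables mu phi w -> measurable D -> mu.-integrable D F ->
  mu.-integrable (phi @^-1` D) (fun x => (w x)%:E * F (phi x)).
Proof.
move=> cv mD /integrableP[mF iF]; have [mp mw w0 _] := cv.
apply/integrableP; split.
  apply: emeasurable_funM; first exact/measurable_EFinP/measurable_funTS.
  apply: (measurable_comp mD _ mF (measurable_funTS mp)).
  by move=> _ [x Dx <-].
have mabs : measurable_fun D (abse \o F) by exact: measurableT_comp.
move: iF; rewrite (ge0_integral_change cv mD mabs)//; last first.
  by move=> x _; exact: abse_ge0.
congr (_ < _); apply: eq_integral => x _ /=.
by rewrite abseM abse_EFin ger0_norm.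
Qed.

Lemma cint_change phi w D (F : T -> R[i]) :
  change_of_variables mu phi w -> measurable D -> cintegrable mu D F ->
  (cint mu D F = cint mu (phi @^-1` D) (fun x => (w x)%:C * F (phi x))%R)%R.
Proof.
move=> cv mD [/integrableP[Fr _] /integrableP[Fi _]]; congr Complex; congr fine.
  rewrite (integral_change cv mD Fr); apply: eq_integral => x _.
  by rewrite ReM /= mul0r subr0 EFinM.
rewrite (integral_change cv mD Fi); apply: eq_integral => x _.
by rewrite ImM /= mul0r addr0 EFinM.
Qed.

Lemma cintegrable_change phi w D (F : T -> R[i]) :
  change_of_variables mu phi w -> measurable D -> cintegrable mu D F ->
  cintegrable mu (phi @^-1` D) (fun x => (w x)%:C * F (phi x))%R.
Proof.
move=> cv mD [Fr Fi]; have [mp _ _ _] := cv.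
have mpD : measurable (phi @^-1` D) by rewrite -[X in measurable X]setTI; exact: mp.
split.
  apply: (eq_integrable mpD _ _ _ (integrable_change cv mD Fr)) => x _ /=.
  by rewrite ReM /= mul0r subr0 EFinM.
apply: (eq_integrable mpD _ _ _ (integrable_change cv mD Fi)) => x _ /=.
by rewrite ImM /= mul0r addr0 EFinM.
Qed.

End theory.

Section product.
Context d1 d2 (X : measurableType d1) (Y : measurableType d2) (R : realType).
Variables (mu : {sigma_finite_measure set X -> \bar R})
          (nu : {sigma_finite_measure set Y -> \bar R}).

Lemma change_of_variables_prod1 (f : X * Y -> X) (w : X * Y -> R) :
  measurable_fun setT f -> measurable_fun setT w ->
  (forall y, change_of_variables mu (fun x => f (x, y)) (fun x => w (x, y))) ->
  change_of_variables (mu \x nu) (fun z => (f z, z.2)) w.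
Proof.
move=> mf mw fw.
have mp : measurable_fun setT (fun z : X * Y => (f z, z.2)).
  exact/measurable_fun_pair.
have w0 z : (0 <= w z)%R by case: z => x y; have [_ _ + _] := fw y; apply.
split => // F mF F0.
have mG : measurable_fun setT (fun z : X * Y => (w z)%:E * F (f z, z.2)).
  apply: emeasurable_funM; first exact/measurable_EFinP.
  exact: (measurableT_comp mF mp).
have G0 z : 0 <= (w z)%:E * F (f z, z.2) by rewrite mule_ge0// lee_fin.
rewrite (fubini_tonelli2 _ mF)// (fubini_tonelli2 _ mG)//.
apply: eq_integral => y _; rewrite /fubini_G.
have [_ _ _ ->] := fw y => //.
exact: measurableT_comp.
Qed.

Lemma change_of_variables_prod2 (f : X * Y -> Y) (w : X * Y -> R) :
  measurable_fun setT f -> measurable_fun setT w ->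
  (forall x, change_of_variables nu (fun y => f (x, y)) (fun y => w (x, y))) ->
  change_of_variables (mu \x nu) (fun z => (z.1, f z)) w.
Proof.
move=> mf mw fw.
have mp : measurable_fun setT (fun z : X * Y => (z.1, f z)).
  exact/measurable_fun_pair.
have w0 z : (0 <= w z)%R by case: z => x y; have [_ _ + _] := fw x; apply.
split => // F mF F0.
have mG : measurable_fun setT (fun z : X * Y => (w z)%:E * F (z.1, f z)).
  apply: emeasurable_funM; first exact/measurable_EFinP.
  exact: (measurableT_comp mF mp).
have G0 z : 0 <= (w z)%:E * F (z.1, f z) by rewrite mule_ge0// lee_fin.
rewrite (fubini_tonelli1 _ mF)// (fubini_tonelli1 _ mG)//.
apply: eq_integral => x _; rewrite /fubini_F.
have [_ _ _ ->] := fw x => //.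
exact: measurableT_comp.
Qed.

End product.

End change_of_variables.

(** * Affine maps of the line and of the plane *)

Section line_and_plane.
Variable R : realType.
Local Notation M := (measurableTypeR R).
Local Notation leb := (@lebesgue_measure R).

Lemma change_of_variables_preserving d (T : measurableType d)
    (mu : {measure set T -> \bar R}) (phi : T -> T) (c : R) :
  measurable_fun setT phi -> 0 <= c ->
  (forall A, measurable A -> (c%:E * mu (phi @^-1` A) = mu A)%E) ->
  change_of_variables mu phi (fun=> c).
Proof.
move=> mp c0 muA; split => //.
move=> F mF F0.
have mFp : measurable_fun setT (F \o phi) by exact: measurableT_comp.
rewrite (@ge0_integralZl_EFin _ _ _ mu _ measurableT (F \o phi))//=.
rewrite -[in RHS](preimage_setT phi) -(ge0_integral_pushforward mp mu)//.
rewrite -(@ge0_integral_mscale _ _ _ (pushforward mu phi) _ measurableT (NngNum c0))//=.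
by apply: eq_measure_integral => A mA _; exact/esym/muA.
Qed.

Lemma change_of_variables_lineD (c : R) :
  change_of_variables leb (fun x => x + c : M) (fun=> 1).
Proof.
apply: change_of_variables_preserving => //.
  exact: measurable_funD.
by move=> A mA; rewrite mul1e; exact: lebesgue_measureD.
Qed.

Lemma change_of_variables_lineN :
  change_of_variables leb (fun x => - x : M) (fun=> 1).
Proof.
apply: change_of_variables_preserving => //; first exact: oppr_measurable.
by move=> A mA; rewrite mul1e; exact: lebesgue_measureN.
Qed.

Lemma change_of_variables_lineM_gt0 (s : R) : 0 < s ->
  change_of_variables leb (fun x => s * x : M) (fun=> s).
Proof.
move=> s0; have ms : measurable_fun setT (fun x => s * x : M).
  exact: measurable_funM.
apply: change_of_variables_preserving => //; first exact: ltW.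
move=> A mA; apply/esym.
pose nu : {measure set M -> \bar R} :=
  measure_function_pushforward__canonical__measure_function_Measure leb ms.
pose mus : {measure set M -> \bar R} := mscale (NngNum (ltW s0)) nu.
apply: (@lebesgue_measure_unique _ mus) => //= _ [[a b] _ <-].
rewrite /mscale /= /pushforward.
rewrite (_ : _ @^-1` _ = `]a / s, b / s]%classic); last first.
  by apply/seteqP; split => x /=;
    rewrite !in_itv/= ltr_pdivrMr// ler_pdivlMr// (mulrC s).
rewrite !lebesgue_measure_itv/= !lte_fin ltr_pM2r ?invr_gt0//.
case: ifP => _; last by rewrite mule0.
by rewrite -!EFinD -EFinM; congr EFin; field; rewrite gt_eqF.
Qed.

Lemma change_of_variables_lineM (s : R) : s != 0 ->
  change_of_variables leb (fun x => s * x : M) (fun=> `|s|).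
Proof.
move=> s0; have [s1|s1] := ltP 0 s.
  by rewrite gtr0_norm//; exact: change_of_variables_lineM_gt0.
have {}s1 : 0 < - s by rewrite oppr_gt0 lt_neqAle s0.
apply: change_of_variables_ext (change_of_variables_comp
  (change_of_variables_lineM_gt0 s1) change_of_variables_lineN) => x /=.
  by rewrite mulrNN.
by rewrite mul1r ltr0_norm// -oppr_gt0.
Qed.

Local Notation P := (M * M)%type.
Local Notation plane := (@lebesgue_plane R).

Lemma change_of_variables_planeD (c : P) :
  change_of_variables plane (fun z => (z.1 + c.1, z.2 + c.2) : P) (fun=> 1).
Proof.
have h1 : change_of_variables plane (fun z : P => (z.1 + c.1, z.2)) (fun=> 1).
  apply: (@change_of_variables_prod1 _ _ M M R leb leb (fun z => z.1 + c.1)) => //.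
    by apply: measurable_funD => //; exact: measurable_fst.
  by move=> y /=; exact: change_of_variables_lineD.
have h2 : change_of_variables plane (fun z : P => (z.1, z.2 + c.2)) (fun=> 1).
  apply: (@change_of_variables_prod2 _ _ M M R leb leb (fun z => z.2 + c.2)) => //.
    by apply: measurable_funD => //; exact: measurable_snd.
  by move=> y /=; exact: change_of_variables_lineD.
by apply: change_of_variables_ext (change_of_variables_comp h1 h2) => x //=;
  rewrite mul1r.
Qed.

Definition cmul (a : R[i]) (z : P) : P :=
  (Re a * z.1 - Im a * z.2, Im a * z.1 + Re a * z.2).

(** With [a = p + i q], the real matrix of multiplication by [a] is a shear, two scalings by [p] and
    [p + q ^+ 2 / p], and another shear; this elimination needs the pivot [p] to be nonzero. *)
Lemma change_of_variables_plane_Re (a : R[i]) : Re a != 0 ->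
  change_of_variables plane (cmul a) (fun=> normc a ^+ 2).
Proof.
case: a => p q /= p0.
have shear1 (t : R) : change_of_variables plane
    (fun z : P => (z.1 + t * z.2, z.2)) (fun=> 1).
  apply: (@change_of_variables_prod1 _ _ M M R leb leb (fun z => z.1 + t * z.2)) => //.
    apply: measurable_funD; first exact: measurable_fst.
    by apply: measurable_funM => //; exact: measurable_snd.
  by move=> y /=; exact: change_of_variables_lineD.
have shear2 (t : R) : change_of_variables plane
    (fun z : P => (z.1, z.2 + t * z.1)) (fun=> 1).
  apply: (@change_of_variables_prod2 _ _ M M R leb leb (fun z => z.2 + t * z.1)) => //.
    apply: measurable_funD; first exact: measurable_snd.
    by apply: measurable_funM => //; exact: measurable_fst.
  by move=> y /=; exact: change_of_variables_lineD.
have scale1 (t : R) : t != 0 -> change_of_variables plane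
    (fun z : P => (t * z.1, z.2)) (fun=> `|t|).
  move=> t0; apply: (@change_of_variables_prod1 _ _ M M R leb leb (fun z => t * z.1)) => //.
    by apply: measurable_funM => //; exact: measurable_fst.
  by move=> y /=; exact: change_of_variables_lineM.
have scale2 (t : R) : t != 0 -> change_of_variables plane
    (fun z : P => (z.1, t * z.2)) (fun=> `|t|).
  move=> t0; apply: (@change_of_variables_prod2 _ _ M M R leb leb (fun z => t * z.2)) => //.
    by apply: measurable_funM => //; exact: measurable_snd.
  by move=> y /=; exact: change_of_variables_lineM.
have pq : p + q ^+ 2 / p != 0.
  rewrite (_ : _ + _ = (p ^+ 2 + q ^+ 2) / p); last by field.
  rewrite mulf_neq0 ?invr_eq0// gt_eqF// ltr_pwDl ?sqr_ge0//.
  by rewrite exprn_even_gt0.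
apply: change_of_variables_ext (change_of_variables_comp (shear2 (q / p))
  (change_of_variables_comp (scale1 _ p0)
  (change_of_variables_comp (scale2 _ pq) (shear1 (- (q / p)))))) => z /=.
  by rewrite /cmul/=; congr pair; field.
rewrite mul1r mulr1 -normrM sqr_sqrtr ?addr_ge0 ?sqr_ge0//.
rewrite (_ : (p + q ^+ 2 / p) * p = p ^+ 2 + q ^+ 2); last by field.
by rewrite ger0_norm// addr_ge0 ?sqr_ge0.
Qed.

Lemma cmulM (a b : R[i]) z : cmul (a * b) z = cmul a (cmul b z).
Proof. by rewrite /cmul /= ReM ImM; congr pair; ring. Qed.

(** A nonzero [a] that is purely imaginary is the product of [a / (1 + i)] and [1 + i], whose real
    parts are both nonzero. *)
Lemma change_of_variables_planeM (a : R[i]) : a != 0 ->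
  change_of_variables plane (cmul a) (fun=> normc a ^+ 2).
Proof.
move=> a0; have [ra|] := eqVneq (Re a) 0; last exact: change_of_variables_plane_Re.
have i1 : (1 +i* 1 : R[i]) != 0 by rewrite eq_complex /= oner_eq0.
have h1 : Re (1 +i* 1 : R[i]) != 0 by rewrite oner_eq0.
have h2 : Re (a / (1 +i* 1)) != 0.
  rewrite ReM /= ra mul0r sub0r expr1n mul1r oppr_eq0 mulf_neq0 ?oppr_eq0 ?invr_eq0//.
  by apply: contra_neq a0 => ia; apply: eqcP.
have aE : a = a / (1 +i* 1) * (1 +i* 1) by rewrite divfK.
apply: change_of_variables_ext (change_of_variables_comp
  (change_of_variables_plane_Re h2) (change_of_variables_plane_Re h1)) => z.
  by rewrite {2}aE cmulM.
by rewrite [in RHS]aE (Normc.normcM (a / _)) exprMn mulrC.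
Qed.

End line_and_plane.

(** * Measurability of complex-valued functions *)

Section complex_measurability.
Context d (T : measurableType d) (R : realType).
Implicit Types (D : set T) (F G : T -> R[i]).

Definition cmeasurable D F :=
  measurable_fun D (fun t => Re (F t)) /\ measurable_fun D (fun t => Im (F t)).

Lemma cmeasurable_cst D (c : R[i]) : cmeasurable D (fun=> c).
Proof. by split; exact: measurable_cst. Qed.

Lemma cmeasurableD D F G : cmeasurable D F -> cmeasurable D G ->
  cmeasurable D (fun t => F t + G t).
Proof.
move=> [Fr Fi] [Gr Gi]; split.
  by under eq_fun do rewrite ReD; exact: measurable_funD.
by under eq_fun do rewrite ImD; exact: measurable_funD.
Qed.

Lemma cmeasurableM D F G : cmeasurable D F -> cmeasurable D G ->
  cmeasurable D (fun t => F t * G t).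
Proof.
move=> [Fr Fi] [Gr Gi]; split.
  by under eq_fun do rewrite ReM; apply: measurable_funB; exact: measurable_funM.
by under eq_fun do rewrite ImM; apply: measurable_funD; exact: measurable_funM.
Qed.

Lemma cmeasurable_sum D (I : Type) (s : seq I) (F : I -> T -> R[i]) :
  (forall i, cmeasurable D (F i)) -> cmeasurable D (fun t => \sum_(i <- s) F i t).
Proof.
move=> mF; elim: s => [|i s IH].
  by under eq_fun do rewrite big_nil; exact: cmeasurable_cst.
by under eq_fun do rewrite big_cons; exact: cmeasurableD.
Qed.

Lemma cmeasurableJ D F : cmeasurable D F -> cmeasurable D (fun t => (F t)^*).
Proof.
move=> [Fr Fi]; split.
  by rewrite (_ : (fun _ => _) = (fun t => Re (F t)))//; apply/funext => t; case: (F t).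
rewrite (_ : (fun _ => _) = (fun t => - Im (F t))); last first.
  by apply/funext => t; case: (F t).
exact: measurableT_comp.
Qed.

Lemma cmeasurable_cexp D F : cmeasurable D F -> cmeasurable D (fun t => cexp (F t)).
Proof.
move=> [Fr Fi].
have mc : measurable_fun D (fun t => cos (Im (F t))).
  apply: (measurableT_comp (f := cos) _ Fi).
  by apply: continuous_measurable_fun; exact: continuous_cos.
have ms : measurable_fun D (fun t => sin (Im (F t))).
  apply: (measurableT_comp (f := sin) _ Fi).
  by apply: continuous_measurable_fun; exact: continuous_sin.
have me : measurable_fun D (fun t => expR (Re (F t))).
  exact: (measurableT_comp (f := expR) _ Fr).
apply: (@cmeasurableM _ (fun t => (expR (Re (F t)))%:C) (fun t => cis (Im (F t)))).
  by split => //=; exact: measurable_cst.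
by split.
Qed.

Lemma cmeasurable_normc D F : cmeasurable D F ->
  measurable_fun D (fun t => normc (F t)).
Proof.
move=> [Fr Fi].
rewrite (_ : (fun _ => _) = (fun t => Num.sqrt (Re (F t) ^+ 2 + Im (F t) ^+ 2))); last first.
  by apply/funext => t; case: (F t).
have ms : measurable_fun setT (@Num.sqrt R).
  by apply: continuous_measurable_fun; exact: sqrt_continuous.
have m2 : measurable_fun D (fun t => Re (F t) ^+ 2 + Im (F t) ^+ 2).
  by apply: measurable_funD; exact: measurable_funX.
exact: (measurableT_comp ms m2).
Qed.

End complex_measurability.

Lemma cmeasurable_comp d d' (T : measurableType d) (U : measurableType d')
    (R : realType) (F : T -> R[i]) (f : U -> T) :
  cmeasurable setT F -> measurable_fun setT f -> cmeasurable setT (fun u => F (f u)).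
Proof.
move=> [Fr Fi] mf; split.
  exact: (measurableT_comp Fr mf).
exact: (measurableT_comp Fi mf).
Qed.

(** * Translations and invertible linear maps of C^n *)

Section tuples.
Variable R : realType.
Local Notation RT := (measurableTypeR R).
Local Notation P := (RT * RT)%type.
Local Notation plane := (@lebesgue_plane R).

Definition complex_of (z : P) : R[i] := z.1 +i* z.2.
Definition pair_of (c : R[i]) : P := (Re c, Im c).

Lemma complex_ofK : cancel complex_of pair_of. Proof. by case. Qed.
Lemma pair_ofK : cancel pair_of complex_of. Proof. by case. Qed.

Definition row_tuple n (v : 'rV[R[i]]_n) : n.-tuple P :=
  [tuple pair_of (v 0 i) | i < n].

Lemma row_tupleK n : cancel (@row_tuple n) (@Cn_of_tuple R n).
Proof.
move=> v; apply/rowP => i; rewrite !mxE tnth_mktuple /=.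
by case: (v 0 i).
Qed.

Lemma Cn_of_tupleK n : cancel (@Cn_of_tuple R n) (@row_tuple n).
Proof.
move=> t; apply: eq_from_tnth => i; rewrite tnth_mktuple mxE /pair_of/=.
by case: (tnth t i).
Qed.

Lemma Cn_of_tuple_cons n (x : P) (t : n.-tuple P) :
  Cn_of_tuple (tuple_cons (x, t)) = row_mx (complex_of x)%:M (Cn_of_tuple t).
Proof.
apply/rowP => i; rewrite !mxE; case: splitP => j ij.
  have -> : i = ord0 by apply/val_inj; rewrite /= ij ord1.
  by rewrite ord1 mxE eqxx mulr1n (tnth_nth (0, 0)).
have -> : i = lift ord0 j by apply/val_inj.
by rewrite !mxE !(tnth_nth (0, 0)).
Qed.

Lemma row_tuple_row_mx n (c : R[i]) (v : 'rV[R[i]]_n) :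
  row_tuple (row_mx c%:M v : 'rV[R[i]]_(1 + n)) = tuple_cons (pair_of c, row_tuple v).
Proof.
apply: (can_inj (@Cn_of_tupleK _)).
by rewrite Cn_of_tuple_cons !row_tupleK pair_ofK.
Qed.

Lemma measurable_complex_of : cmeasurable setT complex_of.
Proof. by split; [exact: measurable_fst|exact: measurable_snd]. Qed.

Lemma cmeasurable_coord n (i : 'I_n) :
  cmeasurable setT (fun t : n.-tuple P => Cn_of_tuple t 0 i).
Proof.
rewrite (_ : (fun _ => _) = (fun t : n.-tuple P => complex_of (tnth t i))).
  apply: cmeasurable_comp; first exact: measurable_complex_of.
  exact: measurable_tnth.
by apply/funext => t; rewrite mxE.
Qed.

Lemma cmeasurable_mulmx d (T : measurableType d) n m (v : T -> 'rV[R[i]]_n)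
    (A : 'M[R[i]]_(n, m)) j :
  (forall i, cmeasurable setT (fun t => v t 0 i)) ->
  cmeasurable setT (fun t => (v t *m A) 0 j).
Proof.
move=> mv; under eq_fun do rewrite mxE.
by apply: cmeasurable_sum => i; apply: cmeasurableM.
Qed.

Lemma measurable_pair_of d (T : measurableType d) (F : T -> R[i]) :
  cmeasurable setT F -> measurable_fun setT (fun t => pair_of (F t)).
Proof. by move=> [Fr Fi]; exact/measurable_fun_pair. Qed.

Lemma measurable_row_tuple d (T : measurableType d) n (v : T -> 'rV[R[i]]_n) :
  (forall i, cmeasurable setT (fun t => v t 0 i)) ->
  measurable_fun setT (fun t => row_tuple (v t)).
Proof.
move=> mv; apply/measurable_fun_tnthP => i.
rewrite (_ : _ \o _ = (fun t => pair_of (v t 0 i))).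
  exact: measurable_pair_of.
by apply/funext => t; rewrite /= tnth_mktuple.
Qed.

(** [lebesgue_Cn R n.+1] is by construction the image of the product measure under [tuple_cons], so
    a change of variables of the product passes to tuples. *)
Lemma change_of_variables_tuple n phi (w : P * n.-tuple P -> R)
    (psi : n.+1.-tuple P -> n.+1.-tuple P) (v : n.+1.-tuple P -> R) :
  change_of_variables (plane \x lebesgue_Cn R n)%E phi w ->
  (forall z, psi (tuple_cons z) = tuple_cons (phi z)) ->
  (forall z, v (tuple_cons z) = w z) ->
  change_of_variables (lebesgue_Cn R n.+1) psi v.
Proof.
move=> [mp mw w0 wE] psiE vE.
have consE (t : n.+1.-tuple P) : t = tuple_cons (tuple_uncons t).
  by rewrite [LHS]tuple_eta; apply/val_inj.
have mc := @measurable_tuple_cons _ P n; have mu := @measurable_tuple_uncons _ P n.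
have intE (F : n.+1.-tuple P -> \bar R) : measurable_fun setT F ->
    (forall x, 0 <= F x)%E ->
    (\int[lebesgue_Cn R n.+1]_t F t =
     \int[(plane \x lebesgue_Cn R n)]_z F (tuple_cons z))%E.
  move=> mF F0; rewrite -[in RHS](preimage_setT (@tuple_cons _ P n)).
  by rewrite -(ge0_integral_pushforward mc).
have psiE' : psi = @tuple_cons _ P n \o (phi \o @tuple_uncons _ P n).
  by apply/funext => t; rewrite {1}(consE t) psiE.
have vE' : v = w \o @tuple_uncons _ P n.
  by apply/funext => t; rewrite {1}(consE t) vE.
have mpsi : measurable_fun setT psi.
  rewrite psiE'; apply: (measurableT_comp mc); exact: measurableT_comp.
have mv : measurable_fun setT v by rewrite vE'; exact: measurableT_comp.
have v0 t : 0 <= v t by rewrite vE'; exact: w0.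
split => // F mF F0.
rewrite intE// intE//.
- rewrite wE//; last exact: measurableT_comp.
  by apply: eq_integral => z _; rewrite vE psiE.
- apply: emeasurable_funM; first exact/measurable_EFinP.
  exact: measurableT_comp.
- by move=> x; rewrite mule_ge0// lee_fin.
Qed.

Lemma change_of_variables_CnD n (c : 'rV[R[i]]_n) :
  change_of_variables (lebesgue_Cn R n)
    (fun t => row_tuple (Cn_of_tuple t + c)) (fun=> 1).
Proof.
elim: n c => [|n IH] c.
  apply: change_of_variables_ext (change_of_variables_id _) => // t.
  by rewrite tuple0; apply/esym; exact: tuple0.
rewrite -[c](@hsubmxK _ 1 1 n); move: (lsubmx _) (rsubmx _) => a v.
pose f1 (z : P * n.-tuple P) : P := (z.1.1 + Re (a 0 0), z.1.2 + Im (a 0 0)).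
pose f2 (z : P * n.-tuple P) : n.-tuple P := row_tuple (Cn_of_tuple z.2 + v).
have m1 : measurable_fun setT f1.
  apply/measurable_fun_pair; apply: measurable_funD => //.
    exact: (measurableT_comp measurable_fst measurable_fst).
  exact: (measurableT_comp measurable_snd measurable_fst).
have m2 : measurable_fun setT f2.
  apply: measurable_row_tuple => i; under eq_fun do rewrite mxE.
  apply: cmeasurableD; last exact: cmeasurable_cst.
  exact: (cmeasurable_comp (cmeasurable_coord i) measurable_snd).
have h1 : change_of_variables (plane \x lebesgue_Cn R n)%E
    (fun z => (f1 z, z.2)) (fun=> 1).
  apply: change_of_variables_prod1 => // y.
  exact: (change_of_variables_planeD (pair_of (a 0 0))).
have h2 : change_of_variables (plane \x lebesgue_Cn R n)%E
    (fun z => (z.1, f2 z)) (fun=> 1).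
  by apply: change_of_variables_prod2 => // y; exact: IH.
apply: (change_of_variables_tuple (change_of_variables_comp h1 h2)) => -[x t].
  rewrite Cn_of_tuple_cons (@add_row_mx _ 1 1 n).
  rewrite [a]mx11_scalar -raddfD row_tuple_row_mx /=.
  by rewrite /pair_of ReD ImD.
by rewrite mul1r.
Qed.

Definition tuple_mulmx n (A : 'M[R[i]]_n) (t : n.-tuple P) : n.-tuple P :=
  row_tuple (Cn_of_tuple t *m A).

Lemma tuple_mulmxM n (A B : 'M[R[i]]_n) t :
  tuple_mulmx (A *m B) t = tuple_mulmx B (tuple_mulmx A t).
Proof. by rewrite /tuple_mulmx row_tupleK mulmxA. Qed.

Lemma tuple_mulmx_block n (a : R[i]) v u (S : 'M[R[i]]_n) x t :
  tuple_mulmx (block_mx a%:M v u S : 'M[R[i]]_(1 + n)) (tuple_cons (x, t)) =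
  tuple_cons (pair_of (complex_of x * a + (Cn_of_tuple t *m u) 0 0),
    row_tuple ((complex_of x) *: v + Cn_of_tuple t *m S)).
Proof.
rewrite /tuple_mulmx Cn_of_tuple_cons mul_row_block -scalar_mxM mul_scalar_mx.
rewrite [X in (_ + X)](_ : Cn_of_tuple t *m u = ((Cn_of_tuple t *m u) 0 0)%:M);
  last exact: mx11_scalar.
by rewrite -raddfD row_tuple_row_mx.
Qed.

Lemma complex_of_planeD (x : P) c :
  pair_of (complex_of x + c) = (x.1 + (pair_of c).1, x.2 + (pair_of c).2).
Proof. by rewrite /pair_of ReD ImD. Qed.

(** The real Jacobian of a complex linear map is the squared modulus of its complex determinant. *)
Definition linear_change n (A : 'M[R[i]]_n) :=
  change_of_variables (lebesgue_Cn R n) (tuple_mulmx A)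
    (fun=> normc (\det A) ^+ 2).

Lemma linear_changeM n (A B : 'M[R[i]]_n) : linear_change A -> linear_change B ->
  linear_change (A *m B).
Proof.
move=> lA lB.
apply: change_of_variables_ext (change_of_variables_comp lB lA) => t.
  by rewrite tuple_mulmxM.
by rewrite det_mulmx Normc.normcM exprMn.
Qed.

(** With the first coordinate frozen, the shear is a translation of the other ones. *)
Lemma linear_change_shear1 n (v : 'rV[R[i]]_n) :
  linear_change (block_mx 1%:M v 0 1%:M : 'M[R[i]]_(1 + n)).
Proof.
have h : change_of_variables (plane \x lebesgue_Cn R n)%E
    (fun z => (z.1, row_tuple (Cn_of_tuple z.2 + complex_of z.1 *: v))) (fun=> 1).
  apply: (@change_of_variables_prod2 _ _ P (n.-tuple P) R plane (lebesgue_Cn R n)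
    (fun z : P * n.-tuple P =>
    row_tuple (Cn_of_tuple z.2 + complex_of z.1 *: v))) => // [|x].
    apply: measurable_row_tuple => i; under eq_fun do rewrite !mxE.
    apply: cmeasurableD.
      rewrite (_ : (fun _ => _) = (fun x : P * n.-tuple P => Cn_of_tuple x.2 0 i)).
        exact: (cmeasurable_comp (cmeasurable_coord i) measurable_snd).
      by apply/funext => x; rewrite mxE.
    apply: cmeasurableM; last exact: cmeasurable_cst.
    exact: (cmeasurable_comp measurable_complex_of measurable_fst).
  exact: (change_of_variables_CnD (complex_of x *: v)).
apply: (change_of_variables_tuple h) => -[x t].
  by rewrite tuple_mulmx_block mulr1 mulmx0 mxE addr0 complex_ofK mulmx1 addrC.
by rewrite det_ublock !det1 mulr1 Normc.normc1 expr1n.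
Qed.

Lemma linear_change_shear2 n (u : 'cV[R[i]]_n) :
  linear_change (block_mx 1%:M 0 u 1%:M : 'M[R[i]]_(1 + n)).
Proof.
pose f (z : P * n.-tuple P) := pair_of (complex_of z.1 + (Cn_of_tuple z.2 *m u) 0 0).
have h : change_of_variables (plane \x lebesgue_Cn R n)%E
    (fun z => (f z, z.2)) (fun=> 1).
  apply: (@change_of_variables_prod1 _ _ P (n.-tuple P) R plane (lebesgue_Cn R n) f) => // [|t].
    apply: measurable_pair_of; apply: cmeasurableD.
      exact: (cmeasurable_comp measurable_complex_of measurable_fst).
    apply: cmeasurable_mulmx => i.
    exact: (cmeasurable_comp (cmeasurable_coord i) measurable_snd).
  apply: change_of_variables_ext (change_of_variables_planeD
    (pair_of ((Cn_of_tuple t *m u) 0 0))) => // x.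
  by rewrite /f complex_of_planeD.
apply: (change_of_variables_tuple h) => -[x t].
  by rewrite tuple_mulmx_block mulr1 scaler0 add0r mulmx1 Cn_of_tupleK.
by rewrite det_lblock !det1 mulr1 Normc.normc1 expr1n.
Qed.

Lemma linear_change_diag n (a : R[i]) (S : 'M[R[i]]_n) : a != 0 ->
  linear_change S -> linear_change (block_mx a%:M 0 0 S : 'M[R[i]]_(1 + n)).
Proof.
move=> a0 lS.
have mS : measurable_fun setT (fun z : P * n.-tuple P => tuple_mulmx S z.2).
  apply: measurable_row_tuple => i; apply: cmeasurable_mulmx => j.
  exact: (cmeasurable_comp (cmeasurable_coord j) measurable_snd).
have ma : measurable_fun setT (fun z : P * n.-tuple P => cmul a z.1).
  apply/measurable_fun_pair; [apply: measurable_funB|apply: measurable_funD];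
    apply: measurable_funM => //.
  - exact: (measurableT_comp measurable_fst measurable_fst).
  - exact: (measurableT_comp measurable_snd measurable_fst).
  - exact: (measurableT_comp measurable_fst measurable_fst).
  - exact: (measurableT_comp measurable_snd measurable_fst).
have h1 : change_of_variables (plane \x lebesgue_Cn R n)%E
    (fun z => (cmul a z.1, z.2)) (fun=> normc a ^+ 2).
  apply: (@change_of_variables_prod1 _ _ P (n.-tuple P) R plane (lebesgue_Cn R n)
    (fun z => cmul a z.1)) => // y.
  exact: change_of_variables_planeM.
have h2 : change_of_variables (plane \x lebesgue_Cn R n)%E
    (fun z => (z.1, tuple_mulmx S z.2)) (fun=> normc (\det S) ^+ 2).
  by apply: (@change_of_variables_prod2 _ _ P (n.-tuple P) R plane (lebesgue_Cn R n)
    (fun z => tuple_mulmx S z.2)).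
apply: (change_of_variables_tuple (change_of_variables_comp h1 h2)) => -[x t].
  rewrite tuple_mulmx_block mulmx0 mxE addr0 scaler0 add0r /=.
  by congr (tuple_cons (_, _)); rewrite /cmul /pair_of ReM ImM /=; congr pair; ring.
by rewrite det_ublock det_scalar1 Normc.normcM exprMn mulrC.
Qed.

Lemma block_mx_00 n (a : R[i]) v u (S : 'M[R[i]]_n) :
  (block_mx a%:M v u S : 'M[R[i]]_(1 + n)) 0 0 = a.
Proof.
rewrite (_ : (0 : 'I_(1 + n)) = lshift n 0); last exact: val_inj.
by rewrite block_mxEul mxE eqxx mulr1n.
Qed.

Lemma block_mx_0S n (a : R[i]) v u (S : 'M[R[i]]_n) j :
  (block_mx a%:M v u S : 'M[R[i]]_(1 + n)) 0 (lift ord0 j) = v 0 j.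
Proof.
rewrite (_ : (0 : 'I_(1 + n)) = lshift n 0); last exact: val_inj.
rewrite (_ : lift ord0 j = rshift 1 j :> 'I_(1 + n)); last exact: val_inj.
by rewrite block_mxEur.
Qed.

(** Gaussian elimination: with a nonzero pivot the matrix is a product of two shears and a block
    diagonal matrix, whose smaller block falls under the induction hypothesis. *)
Theorem linear_change_unit n (A : 'M[R[i]]_n) : A \in unitmx -> linear_change A.
Proof.
elim: n A => [|n IH] A uA.
  apply: change_of_variables_ext (change_of_variables_id _) => // t.
    by rewrite tuple0; apply/esym; exact: tuple0.
  by rewrite det_mx00 Normc.normc1 expr1n.
have pivot (B : 'M[R[i]]_(1 + n)) : B \in unitmx -> B 0 0 != 0 -> linear_change B.
  rewrite -[B](@submxK _ 1 n 1 n).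
  move: (ulsubmx B) (ursubmx B) (dlsubmx B) (drsubmx B) => a v u S.
  rewrite [a]mx11_scalar; move: (a 0 0) => {}a uB.
  rewrite block_mx_00 => a0.
  (* The Schur complement of the pivot. *)
  pose S' := S - u *m (a^-1 *: v).
  have BE : block_mx a%:M v u S = block_mx 1%:M 0 (a^-1 *: u) 1%:M *m
      (block_mx a%:M 0 0 S' *m block_mx 1%:M (a^-1 *: v) 0 1%:M).
    rewrite !mulmx_block !mulmx0 !mul0mx !mulmx1 !mul1mx !addr0 !add0r.
    rewrite mul_scalar_mx mul_mx_scalar !scalerA mulfV// !scale1r.
    by rewrite /S' -scalemxAl -scalemxAr addrC subrK.
  have dB : \det (block_mx a%:M v u S) = a * \det S'.
    rewrite BE !det_mulmx det_lblock !det_ublock !det1 det_scalar1.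
    by rewrite !mul1r mulr1.
  rewrite BE; apply: linear_changeM; first exact: linear_change_shear2.
  apply: linear_changeM; last exact: linear_change_shear1.
  apply: linear_change_diag => //; apply: IH.
  by move: uB; rewrite !unitmxE dB unitrM => /andP[].
have [A00|A00] := eqVneq ((A : 'M[R[i]]_(1 + n)) 0 0) 0; last exact: pivot.
have [j Aj0] : exists j, A (lift ord0 j) 0 != 0.
  apply: contrapT => /forallNP A0.
  move: uA; rewrite unitmxE unitfE (expand_det_col _ 0) big1 ?eqxx// => i _.
  case: (unliftP ord0 i) => [k ->|->]; last by rewrite A00 mul0r.
  by move/negP : (A0 k); rewrite negbK => /eqP ->; rewrite mul0r.
(* Left multiplication by [E 1] adds row [lift ord0 j] to row 0 and so creates a nonzero pivot;
   [E (-1)] undoes it. *)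
pose E (s : R[i]) : 'M[R[i]]_(1 + n) := block_mx 1%:M (s *: delta_mx 0 j) 0 1%:M.
have EE : E (-1) *m E 1 = 1%:M.
  rewrite /E mulmx_block !mulmx0 !mul0mx !mulmx1 !mul1mx !addr0 add0r.
  by rewrite -scalerDl subrr scale0r -scalar_mx_block.
have -> : A = E (-1) *m (E 1 *m (A : 'M[R[i]]_(1 + n))) by rewrite mulmxA EE mul1mx.
apply: linear_changeM; first exact: linear_change_shear1.
apply: pivot.
  rewrite unitmx_mul uA andbT unitmxE /E det_ublock !det1 mulr1; exact: unitr1.
rewrite mxE big_ord_recl/= A00 mulr0 add0r (bigD1 j)//= big1 ?addr0.
  by rewrite /E block_mx_0S !mxE !eqxx !mul1r.
by move=> k kj; rewrite /E block_mx_0S !mxE eqxx (negbTE kj) mulr0 mul0r.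
Qed.

End tuples.

(** * Moments of the Hartogs domain *)

Section radial.
Variable R : realType.
Local Notation RT := (measurableTypeR R).
Local Notation P := (RT * RT)%type.
Local Notation leb := (@lebesgue_measure R).
Local Notation plane := (@lebesgue_plane R).

Definition sqmod (z : P) : R := z.1 ^+ 2 + z.2 ^+ 2.

Lemma sqmod_ge0 z : 0 <= sqmod z.
Proof. by rewrite addr_ge0 ?sqr_ge0. Qed.

Lemma measurable_sqmod : measurable_fun setT (sqmod : P -> RT).
Proof.
by apply: measurable_funD; apply: measurable_funX;
  [exact: measurable_fst|exact: measurable_snd].
Qed.

Definition disc (r : R) : set P := [set z | sqmod z <= r].

Lemma measurable_disc r : measurable (disc r).
Proof.
rewrite (_ : disc r = sqmod @^-1` `]-oo, r]%classic); last first.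
  by apply/seteqP; split => z /=; rewrite in_itv.
rewrite -[X in measurable X]setTI; exact: measurable_sqmod.
Qed.

(* Equal to pi; the proof only uses that it is finite and positive. *)
Definition disc_area : R := fine (plane (disc 1)).

Lemma plane_box (a b c d : R) : (plane (`[a, b]%classic `*` `[c, d]%classic) =
  leb `[a, b] * leb `[c, d])%E.
Proof. by rewrite /lebesgue_plane product_measure1E. Qed.

Lemma disc_subset_box : disc 1 `<=` `[-1, 1]%classic `*` `[-1, 1]%classic.
Proof.
move=> [x y]; rewrite /disc/= /sqmod/= !in_itv/= => h.
have key (a b : R) : a ^+ 2 + b ^+ 2 <= 1 -> -1 <= a <= 1.
  move=> ab; rewrite -ler_norml -(@ler_pXn2r _ 2)// ?nnegrE// expr1n.
  by rewrite real_normK ?num_real// (le_trans _ ab)// lerDl sqr_ge0.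
by split; [exact: key h|apply: (key _ x); rewrite addrC].
Qed.

Lemma plane_disc1_fin : (plane (disc 1) < +oo)%E.
Proof.
apply: (@le_lt_trans _ _ (plane (`[-1, 1]%classic `*` `[-1, 1]%classic))).
  rewrite le_measure ?inE//; [exact: measurable_disc|exact: measurableX|].
  exact: disc_subset_box.
by rewrite plane_box !lebesgue_itvcc ?lerN10// -?EFinM ?ltry//; lra.
Qed.

Lemma plane_disc1E : plane (disc 1) = disc_area%:E.
Proof. by rewrite fineK// ge0_fin_numE// plane_disc1_fin. Qed.

Lemma disc_area_gt0 : 0 < disc_area.
Proof.
rewrite -lte_fin -plane_disc1E.
apply: (@lt_le_trans _ _ (plane (`[0, 2^-1]%classic `*` `[0, 2^-1]%classic))).
  by rewrite plane_box !lebesgue_itvcc ?invr_ge0// subr0 -EFinM lte_fin mulr_gt0 ?invr_gt0.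
rewrite le_measure ?inE//; [exact: measurableX|exact: measurable_disc|].
move=> [x y] [/=]; rewrite !in_itv/= => /andP[x0 x1] /andP[y0 y1].
rewrite /disc/= /sqmod/=.
have h (a : R) : 0 <= a -> a <= 2^-1 -> a ^+ 2 <= 2^-1 ^+ 2.
  by move=> a0 a1; rewrite lerXn2r ?nnegrE// invr_ge0.
have := h _ x0 x1; have := h _ y0 y1; rewrite !expr2; lra.
Qed.

Lemma sqmod_cmul a z : sqmod (cmul a z) = normc a ^+ 2 * sqmod z.
Proof. rewrite /sqmod /cmul sqr_normc_ReIm /=; ring. Qed.

(* Rotation-dilations multiply both the measure and sqmod by |a|^2. *)
Lemma plane_disc_gt0 r : 0 < r -> plane (disc r) = (disc_area * r)%:E.
Proof.
move=> r0; have s0 : 0 < Num.sqrt r by rewrite sqrtr_gt0.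
have n2 : normc (Num.sqrt r)%:C ^+ 2 = r.
  by rewrite normcR ger0_norm ?ltW// sqr_sqrtr// ltW.
have a0 : (Num.sqrt r)%:C != 0 by rewrite -normc_eq0 normcR normr_eq0 gt_eqF.
have cv := change_of_variables_planeM a0.
have m1 : measurable_fun (disc r) (cst 1%E : P -> \bar R) by exact: measurable_cst.
have c1 (z : P) : disc r z -> (0 <= (cst 1 : P -> \bar R) z)%E by [].
rewrite -[LHS]mul1e -(integral_cst _ (measurable_disc r)).
rewrite (ge0_integral_change cv (measurable_disc r) m1 c1).
rewrite (_ : _ @^-1` _ = disc 1); last first.
  apply/seteqP; split => z; rewrite /disc/= sqmod_cmul n2.
    by rewrite -ler_pdivlMl// mulVf// gt_eqF.
  by move=> z1; rewrite -[leRHS]mulr1 ler_pM2l.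
rewrite n2 (eq_integral (fun=> r%:E)); last by move=> z _; rewrite mule1.
by rewrite (integral_cst _ (measurable_disc 1)) [X in (_ * X)%E]plane_disc1E -EFinM mulrC.
Qed.

(** The maximum makes the formula cover degenerate and empty discs, as needed for half-open
    intervals that meet the negative half-line. *)
Lemma plane_disc r : plane (disc r) = (disc_area * Num.max r 0)%:E.
Proof.
have [r0|r0] := ltP 0 r; first by rewrite plane_disc_gt0.
rewrite mulr0; move: r0; rewrite le_eqVlt => /orP[/eqP ->|r0].
  rewrite (_ : disc 0 = `[0, 0]%classic `*` `[0, 0]%classic).
    by rewrite plane_box lebesgue_itvcc// subrr mul0e.
  apply/seteqP; split => -[x y]; rewrite /disc/= /sqmod/= !in_itv/=.
    move=> h; have /eqP : x ^+ 2 + y ^+ 2 = 0.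
      by apply/eqP; rewrite eq_le h addr_ge0 ?sqr_ge0.
    rewrite paddr_eq0 ?sqr_ge0// !sqrf_eq0 => /andP[/eqP -> /eqP ->].
    by rewrite lexx.
  move=> [/le_anti <- /le_anti <-].
  by rewrite expr0n addr0.
rewrite (_ : disc r = set0) ?measure0//; apply/seteqP; split => // z.
by rewrite /disc/= => /(le_trans (sqmod_ge0 z)); rewrite leNgt r0.
Qed.

(** Discs show that the image of the plane measure under [sqmod], divided by [disc_area], is the
    length on the nonnegative half-line. Adding the Lebesgue measure of the negative half-line gives
    a measure on the whole line, to which uniqueness of the Lebesgue measure applies. *)
Lemma plane_radial (A : set RT) : measurable A -> A `<=` `[0, +oo[%classic ->
  (plane (sqmod @^-1` A) = disc_area%:E * leb A)%E.
Proof.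
move=> mA A0.
pose push : {measure set RT -> \bar R} :=
  measure_function_pushforward__canonical__measure_function_Measure plane measurable_sqmod.
have Cinv : 0 <= disc_area^-1 by rewrite invr_ge0 ltW// disc_area_gt0.
have Cn0 : disc_area != 0 by rewrite gt_eqF// disc_area_gt0.
pose m1 : {measure set RT -> \bar R} := mscale (NngNum Cinv) push.
have mneg : measurable (`]-oo, 0[%classic : set RT) by exact: measurable_itv.
pose m2 : {measure set RT -> \bar R} := mrestr leb mneg.
pose mu : {measure set RT -> \bar R} := measure_add m1 m2.
have pushE (a b : R) : a <= b ->
    push `]a, b]%classic = (disc_area * (Num.max b 0 - Num.max a 0))%:E.
  move=> ab; rewrite /push /= /pushforward.
  rewrite (_ : _ @^-1` _ = disc b `\` disc a); last first.
    apply/seteqP; split => z /=; rewrite in_itv/= /disc/=.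
      by move=> /andP[az zb]; split => //; apply/negP; rewrite -ltNge.
    by move=> [-> /negP]; rewrite -ltNge => ->.
  rewrite measureD; [|exact: measurable_disc|exact: measurable_disc|].
    rewrite (_ : _ `&` _ = disc a); last first.
      apply/setIidPr => z; rewrite /disc/= => /le_trans; apply; exact: ab.
    by rewrite [X in (X - _)%E]plane_disc [X in (_ - X)%E]plane_disc mulrBr.
  by rewrite [X in (X < _)%E]plane_disc ltry.
have muE : forall A, measurable A -> leb A = mu A.
  apply: lebesgue_measure_unique => _ [[a b] _ <-].
  rewrite -[RHS]/(measure_add m1 m2 _) measure_addE.
  have [ba|ab] := ltP b a.
    have -> : `]a, b]%classic = set0 :> set R.
      by rewrite set_itv_ge// bnd_simp -leNgt ltW.
    by rewrite !measure0 adde0.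
  rewrite -[RHS]/((disc_area^-1)%:E * push `]a, b]%classic +
    leb (`]a, b]%classic `&` `]-oo, 0%R[%classic))%E.
  rewrite (pushE _ _ ab) -EFinM mulrA mulVf// mul1r.
  have [b0|b0] := ltP b 0.
    rewrite (_ : _ `&` _ = `]a, b]%classic); last first.
      apply/setIidPl => z; rewrite /= !in_itv/= => /andP[_ zb].
      exact: le_lt_trans b0.
    have a0 : a <= 0 by rewrite ltW// (le_lt_trans ab).
    by rewrite (max_r a0) ?subrr ?add0e.
  rewrite (_ : _ `&` _ = `]a, 0[%classic); last first.
    apply/seteqP; split => z; rewrite /= !in_itv/=.
      by move=> [/andP[-> _] ->].
    by move=> /andP[-> z0]; rewrite z0 (le_trans (ltW z0)).
  rewrite !lebesgue_measure_itv/= !lte_fin.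
  have [a0|a0] := ltP a 0.
    by rewrite (lt_le_trans a0 b0) subr0 -!EFinD sub0r.
  rewrite adde0; move: ab; rewrite le_eqVlt => /orP[/eqP ->|->//].
  by rewrite ltxx subrr.
have := muE A mA; rewrite -[RHS]/(measure_add m1 m2 _) measure_addE.
rewrite -[RHS]/((disc_area^-1)%:E * plane (sqmod @^-1` A) +
  leb (A `&` `]-oo, 0%R[%classic))%E.
rewrite (_ : A `&` _ = set0); last first.
  apply/seteqP; split => // z [/A0]; rewrite /= !in_itv/= andbT => z0.
  by rewrite ltNge z0.
rewrite measure0 adde0 => ->.
by rewrite muleA -EFinM divff// mul1e.
Qed.

(** Polar coordinates with the angle integrated out. The variable is the square of the radius, so
    the density is constant. *)
Lemma integral_radial (f : R -> \bar R) : measurable_fun setT (f : RT -> \bar R) ->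
  (forall x, 0 <= f x)%E ->
  (\int[plane]_z f (sqmod z) = disc_area%:E * \int[leb]_(s in `[0%R, +oo[) f s)%E.
Proof.
move=> mf f0.
have mI : measurable (`[0%R, +oo[%classic : set RT) by exact: measurable_itv.
have mfI : measurable_fun (`[0%R, +oo[%classic : set RT) f by exact: measurable_funTS.
pose push : {measure set RT -> \bar R} :=
  measure_function_pushforward__canonical__measure_function_Measure plane measurable_sqmod.
have -> : (\int[plane]_z f (sqmod z) = \int[push]_(s in `[0%R, +oo[) f s)%E.
  rewrite (ge0_integral_pushforward measurable_sqmod plane mI mfI)//.
  congr (integral _ _ _); apply/seteqP; split => // z _.
  by rewrite /= in_itv/= sqmod_ge0.
pose c := NngNum (ltW disc_area_gt0).
rewrite -(@ge0_integral_mscale _ _ _ leb _ mI c)//.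
apply: eq_measure_integral => A mA AI.
exact: (plane_radial mA AI).
Qed.

End radial.

Section line_integrals.
Variable R : realType.
Local Notation RT := (measurableTypeR R).
Local Notation leb := (@lebesgue_measure R).

Lemma integral_primitive (f F : R -> R) (a b : R) : a < b -> continuous f ->
  (forall x : R, is_derive x 1 F (f x)) ->
  (\int[leb]_(x in `[a, b]) (f x)%:E = (F b - F a)%:E)%E.
Proof.
move=> ab cf dF; rewrite EFinB.
have cF : continuous F.
  move=> x; apply: differentiable_continuous; apply/derivable1_diffP.
  by have [] := dF x.
apply: continuous_FTC2 => //.
- exact: continuous_subspaceT.
- split.
  + by move=> x _; have [] := dF x.
  + exact/cvg_at_right_filter/cF.
  + exact/cvg_at_left_filter/cF.
- by move=> x _; rewrite derive1E; have [_ ->] := dF x.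
Qed.

Lemma integral_cut (f : R -> R) (r : R) : 0 < r -> continuous f ->
  (\int[leb]_(s in `[0%R, +oo[) (if s < r then f s else 0)%:E =
   \int[leb]_(s in `[0%R, r]) (f s)%:E)%E.
Proof.
move=> r0 cf.
have mf : measurable_fun setT f by exact: continuous_measurable_fun.
rewrite -integral_itv_bndo_bndc; last first.
  by apply/measurable_EFinP; exact: measurable_funTS.
rewrite integral_mkcond [RHS]integral_mkcond; apply: eq_integral => s _.
rewrite /patch !mem_setE !in_itv/= andbT.
by case: (0 <= s) => //=; case: ifP.
Qed.

Lemma is_derive_scaled_pow (f : R -> R) (c df x : R) (k : nat) :
  is_derive x 1 f df ->
  is_derive x 1 (fun s => c * f s ^+ k.+1) (c * (k.+1%:R * f x ^+ k * df)).
Proof.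
move=> h; have := is_deriveZ c (is_deriveX k.+1 h).
rewrite (_ : c \*: (f ^+ k.+1) = (fun s => c * f s ^+ k.+1))//.
by apply/funext => s; rewrite exprfctE.
Qed.

Lemma integral_pow (k : nat) (r : R) : 0 < r ->
  (\int[leb]_(s in `[0%R, +oo[) (if s < r then s ^+ k else 0)%:E =
   (r ^+ k.+1 / k.+1%:R)%:E)%E.
Proof.
move=> r0; rewrite integral_cut//; last exact: exprn_continuous.
have k0 : k.+1%:R != 0 :> R by rewrite pnatr_eq0.
have dF (x : R) : is_derive x 1 (fun s => k.+1%:R^-1 * s ^+ k.+1) (x ^+ k).
  have := is_derive_scaled_pow k.+1%:R^-1 k (is_derive_id x (1 : R)).
  by rewrite mulr1 mulrA mulVf// mul1r.
rewrite (integral_primitive r0 _ dF); last exact: exprn_continuous.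
by rewrite expr0n/= mulr0 subr0 mulrC.
Qed.

Lemma integral_pow_sub (k : nat) (r : R) : 0 < r ->
  (\int[leb]_(s in `[0%R, +oo[) (if s < r then (r - s) ^+ k else 0)%:E =
   (r ^+ k.+1 / k.+1%:R)%:E)%E.
Proof.
move=> r0.
have dB (x : R) : is_derive x 1 (fun s : R => r - s) (- 1).
  have := is_deriveB (is_derive_cst r x (1 : R)) (is_derive_id x (1 : R)).
  by rewrite sub0r; exact.
have cB : continuous (fun s : R => (r - s) ^+ k).
  move=> x; apply: (@continuous_comp _ _ _ (fun s => r - s) (fun s => s ^+ k)).
    by apply: cvgB; [exact: cst_continuous|exact: cvg_id].
  exact: exprn_continuous.
rewrite integral_cut//.
have k0 : k.+1%:R != 0 :> R by rewrite pnatr_eq0.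
have dF (x : R) :
    is_derive x 1 (fun s => - k.+1%:R^-1 * (r - s) ^+ k.+1) ((r - x) ^+ k).
  have := is_derive_scaled_pow (- k.+1%:R^-1) k (dB x).
  by rewrite mulrN1 mulrNN mulrA mulVf// mul1r.
rewrite (integral_primitive r0 cB dF).
by rewrite subrr expr0n/= mulr0 subr0 sub0r mulNr opprK mulrC.
Qed.

Lemma integral_exp (a : R) : 0 < a ->
  (\int[leb]_(s in `[0%R, +oo[) (expR (- a * s))%:E = (a^-1)%:E)%E.
Proof.
move=> a0.
have := integral_exponential_pdf a0.
have an0 : a != 0 by rewrite gt_eqF.
rewrite (_ : (\int[leb]_x _)%E =
    (\int[leb]_(x in `[0%R, +oo[) (a%:E * (expR (- a * x))%:E))%E); last first.
  rewrite [RHS]integral_mkcond; apply: eq_integral => x _.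
  by rewrite /exponential_pdf /patch; case: ifP.
have me : measurable_fun (`[0%R, +oo[%classic : set RT) (fun s : RT => (expR (- a * s))%:E).
  apply/measurable_EFinP; apply: measurable_funTS.
  by apply: measurableT_comp => //; exact: measurable_funM.
have e0 (s : RT) : (`[0%R, +oo[%classic : set RT) s -> (0 <= (expR (- a * s))%:E)%E.
  by move=> _; rewrite lee_fin expR_ge0.
rewrite (ge0_integralZl_EFin _ _ e0 me (ltW a0))// => h.
by rewrite -[LHS]mul1e -(mulVf an0) EFinM -muleA h mule1.
Qed.

End line_integrals.

Section moments.
Variable R : realType.
Local Notation RT := (measurableTypeR R).
Local Notation P := (RT * RT)%type.
Local Notation plane := (@lebesgue_plane R).
Local Notation area := (disc_area R).

Lemma measurable_fun_cut d (T : measurableType d) (h r g : T -> R) :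
  measurable_fun setT h -> measurable_fun setT r -> measurable_fun setT g ->
  measurable_fun setT (fun t => (if h t < r t then g t else 0)%:E).
Proof.
move=> mh mr mg; apply/measurable_EFinP.
apply: (measurable_fun_ifT (f := fun t => h t < r t)) => //.
exact: measurable_fun_ltr.
Qed.

Lemma integral_plane_pow (k : nat) (r : R) : 0 < r ->
  (\int[plane]_z (if sqmod z < r then sqmod z ^+ k else 0)%:E =
   (area * (r ^+ k.+1 / k.+1%:R))%:E)%E.
Proof.
move=> r0; rewrite EFinM -(integral_pow k r0).
have mf : measurable_fun setT (fun s : RT => (if s < r then s ^+ k else 0)%:E).
  by apply: measurable_fun_cut => //; exact: measurable_funX.
have mf0 (z : P) : (0 <= (if sqmod z < r then sqmod z ^+ k else 0)%:E)%E.
  by rewrite lee_fin; case: ifP => // _; rewrite exprn_ge0 ?sqmod_ge0.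
(* [integral_radial] asks for nonnegativity on the whole line, while [s ^+ k] may be negative for
   [s < 0]. *)
pose f (s : R) : \bar R := (if 0 <= s then (if s < r then s ^+ k else 0) else 0)%:E.
have fE (s : R) : 0 <= s -> f s = (if s < r then s ^+ k else 0)%:E.
  by move=> s0; rewrite /f s0.
have f0 s : (0 <= f s)%E.
  by rewrite /f lee_fin; case: ifP => // s0; case: ifP => // _; rewrite exprn_ge0.
have mf' : measurable_fun setT (f : RT -> \bar R).
  apply/measurable_EFinP; apply: measurable_fun_ifT => //.
    by apply: measurable_fun_ler.
  by apply/measurable_EFinP.
transitivity (\int[plane]_z f (sqmod z))%E.
  by apply: eq_integral => z _; rewrite fE ?sqmod_ge0.
rewrite integral_radial//; congr (_ * _)%E; apply: eq_integral => s.
by rewrite inE/= in_itv/= andbT => /fE.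
Qed.

Lemma integral_plane_pow_sub (k : nat) (r : R) : 0 < r ->
  (\int[plane]_z (if sqmod z < r then (r - sqmod z) ^+ k else 0)%:E =
   (area * (r ^+ k.+1 / k.+1%:R))%:E)%E.
Proof.
move=> r0; rewrite EFinM -(integral_pow_sub k r0).
rewrite -(@integral_radial _ (fun s => (if s < r then (r - s) ^+ k else 0)%:E))//.
  apply: measurable_fun_cut => //; apply: measurable_funX.
  exact: measurable_funB.
move=> s; rewrite lee_fin; case: ifP => // sr; rewrite exprn_ge0// subr_ge0.
exact: ltW.
Qed.

Lemma integral_plane_exp (a : R) : 0 < a ->
  (\int[plane]_z (expR (- a * sqmod z))%:E = (area / a)%:E)%E.
Proof.
move=> a0; rewrite EFinM -(integral_exp a0).
rewrite -(@integral_radial _ (fun s => (expR (- a * s))%:E))//.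
by apply/measurable_EFinP; apply: measurableT_comp => //; exact: measurable_funM.
Qed.

Lemma Cn_fubini n (F : n.+1.-tuple P -> \bar R) : measurable_fun setT F ->
  (forall t, 0 <= F t)%E ->
  (\int[lebesgue_Cn R n.+1]_t F t =
   \int[plane]_x \int[lebesgue_Cn R n]_t F (tuple_cons (x, t)))%E.
Proof.
move=> mF F0; have mc := @measurable_tuple_cons _ P n.
transitivity (\int[plane \x lebesgue_Cn R n]_z F (tuple_cons z))%E.
  rewrite -[in RHS](preimage_setT (@tuple_cons _ P n)).
  by rewrite -(ge0_integral_pushforward mc).
have mFc : measurable_fun setT (F \o @tuple_cons _ P n) by exact: measurableT_comp.
exact: (fubini_tonelli1 _ mFc (fun z => F0 _)).
Qed.

(** With [n] coordinates in z, [head_sq] is the squared norm of z and [tail_sq] that of zeta. They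
    select by index instead of splitting the tuple, so that both follow [tuple_cons] in
    inductions. *)
Definition head_sq n N (t : N.-tuple P) : R :=
  \sum_(i < N | (i < n)%N) sqmod (tnth t i).

Definition tail_sq n N (t : N.-tuple P) : R :=
  \sum_(i < N | (n <= i)%N) sqmod (tnth t i).

Lemma head_sq_cons n N (x : P) (t : N.-tuple P) :
  head_sq n.+1 (tuple_cons (x, t)) = sqmod x + head_sq n t.
Proof.
rewrite /head_sq big_mkcond big_ord_recl /= tnth0; congr (_ + _).
rewrite [RHS]big_mkcond; apply: eq_bigr => i _.
by rewrite tnthS.
Qed.

Lemma tail_sq_cons n N (x : P) (t : N.-tuple P) :
  tail_sq n.+1 (tuple_cons (x, t)) = tail_sq n t.
Proof.
rewrite /tail_sq big_mkcond big_ord_recl /= add0r.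
rewrite [RHS]big_mkcond; apply: eq_bigr => i _.
by rewrite tnthS.
Qed.

Lemma tail_sq0_cons N (x : P) (t : N.-tuple P) :
  tail_sq 0 (tuple_cons (x, t)) = sqmod x + tail_sq 0 t.
Proof.
rewrite /tail_sq big_mkcond big_ord_recl /= tnth0; congr (_ + _).
rewrite [RHS]big_mkcond; apply: eq_bigr => i _.
by rewrite tnthS.
Qed.

Lemma measurable_sum_sqmod N (p : pred 'I_N) : measurable_fun setT
  (fun t : N.-tuple P => \sum_(i < N | p i) sqmod (tnth t i) : RT).
Proof.
under eq_fun do rewrite big_mkcond.
apply: measurable_sum => i; case: (p i); last exact: measurable_cst.
apply: measurableT_comp; [exact: measurable_sqmod|exact: measurable_tnth].
Qed.

Lemma measurable_head_sq n N : measurable_fun setT (@head_sq n N : _ -> RT).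
Proof. exact: measurable_sum_sqmod. Qed.

Lemma measurable_tail_sq n N : measurable_fun setT (@tail_sq n N : _ -> RT).
Proof. exact: measurable_sum_sqmod. Qed.

(** Indexing by a natural number with a default value, so that [nth_sq_cons] holds by
    computation. *)
Definition nth_sq j N (t : N.-tuple P) : R := sqmod (nth (0, 0) t j).

Lemma nth_sq_cons j N (x : P) (t : N.-tuple P) :
  nth_sq j.+1 (tuple_cons (x, t)) = nth_sq j t.
Proof. by []. Qed.

Lemma nth_sq_ge0 j N (t : N.-tuple P) : 0 <= nth_sq j t.
Proof. exact: sqmod_ge0. Qed.

Lemma measurable_nth_sq j N : (j < N)%N ->
  measurable_fun setT (@nth_sq j N : _ -> RT).
Proof.
move=> jN; rewrite (_ : @nth_sq j N = (fun t => sqmod (tnth t (Ordinal jN)))).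
  by apply: measurableT_comp; [exact: measurable_sqmod|exact: measurable_tnth].
by apply/funext => t; rewrite (tnth_nth (0, 0)).
Qed.

(** For [m > 0], the integral of [|zeta_m| ^ (2 k)] over the unit ball of C^m, [area] being pi. *)
Definition ball_moment_cst m k : R :=
  area ^+ m * k`!%:R / (k + m)`!%:R.

Lemma ball_moment_cst_gt0 m k : 0 < ball_moment_cst m k.
Proof.
by rewrite divr_gt0 ?mulr_gt0 ?exprn_gt0 ?disc_area_gt0// ltr0n fact_gt0.
Qed.

Lemma integral_Cn0 (F : 0.-tuple P -> \bar R) : measurable_fun setT F ->
  (\int[lebesgue_Cn R 0]_t F t = F [tuple])%E.
Proof.
move=> mF; rewrite -[LHS]/(\int[\d_([tuple] : 0.-tuple P)]_t F t)%E.
by rewrite integral_dirac// diracT mul1e.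
Qed.

Lemma tail_sq_nil n : tail_sq n ([tuple] : 0.-tuple P) = 0.
Proof. by rewrite /tail_sq big_ord0. Qed.

(** Coordinates are integrated out from the first one: freezing [x] leaves the ball of squared
    radius [r - sqmod x], and the base case is the coordinate that carries the power. The test
    [0 < r] is there because this squared radius may be negative. *)
Lemma ball_moment m k (r : R) :
  (\int[lebesgue_Cn R m.+1]_t
     (if tail_sq 0 t < r then nth_sq m t ^+ k else 0)%:E =
   (if 0 < r then ball_moment_cst m.+1 k * r ^+ (k + m.+1) else 0)%:E)%E.
Proof.
elim: m r => [|m IH] r.
  have mF : measurable_fun setT (fun t : 1.-tuple P =>
      (if tail_sq 0 t < r then nth_sq 0 t ^+ k else 0)%:E).
    apply: measurable_fun_cut => //; first exact: measurable_tail_sq.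
    by apply: measurable_funX; exact: measurable_nth_sq.
  have F0 (t : 1.-tuple P) :
      (0 <= (if tail_sq 0 t < r then nth_sq 0 t ^+ k else 0)%:E)%E.
    by rewrite lee_fin; case: ifP => // _; rewrite exprn_ge0 ?nth_sq_ge0.
  rewrite Cn_fubini//.
  transitivity (\int[plane]_z (if sqmod z < r then sqmod z ^+ k else 0)%:E)%E.
    apply: eq_integral => x _; rewrite integral_Cn0; last first.
      apply: (measurableT_comp mF).
      exact: (measurableT_comp (@measurable_tuple_cons _ P 0) (measurable_pair1 x)).
    by rewrite tail_sq0_cons tail_sq_nil addr0.
  case: ifPn => [r0|]; last first.
    rewrite -leNgt => r0; rewrite integral0_eq// => z _.
    by rewrite ltNge (le_trans r0 (sqmod_ge0 z)).
  rewrite integral_plane_pow// /ball_moment_cst addn1 factS natrM.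
  have x0 : k.+1%:R != 0 :> R by rewrite pnatr_eq0.
  have y0 : k`!%:R != 0 :> R by rewrite pnatr_eq0 -lt0n fact_gt0.
  congr EFin; move: (k.+1%:R) (k`!%:R) x0 y0 => x y x0 y0.
  by field; rewrite x0 y0.
have mF : measurable_fun setT (fun t : m.+2.-tuple P =>
    (if tail_sq 0 t < r then nth_sq m.+1 t ^+ k else 0)%:E).
  apply: measurable_fun_cut => //; first exact: measurable_tail_sq.
  by apply: measurable_funX; exact: measurable_nth_sq.
have F0 (t : m.+2.-tuple P) :
    (0 <= (if tail_sq 0 t < r then nth_sq m.+1 t ^+ k else 0)%:E)%E.
  by rewrite lee_fin; case: ifP => // _; rewrite exprn_ge0 ?nth_sq_ge0.
rewrite Cn_fubini//.
have E x : (\int[lebesgue_Cn R m.+1]_t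
    (if (tail_sq 0 (tuple_cons (x, t)) < r)%R then
      (nth_sq m.+1 (tuple_cons (x, t)) ^+ k)%R else 0%R)%:E =
    (ball_moment_cst m.+1 k)%:E *
    (if (sqmod x < r)%R then ((r - sqmod x) ^+ (k + m.+1))%R else 0%R)%:E)%E.
  under eq_integral do rewrite tail_sq0_cons nth_sq_cons -ltrBrDl.
  by rewrite IH subr_gt0; case: ifP => _; rewrite ?mule0 ?EFinM.
under eq_integral do rewrite E.
have mG : measurable_fun setT (fun x : P =>
    (if sqmod x < r then (r - sqmod x) ^+ (k + m.+1) else 0)%:E).
  apply: measurable_fun_cut => //; first exact: measurable_sqmod.
  by apply: measurable_funX; apply: measurable_funB => //; exact: measurable_sqmod.
have G0 (x : P) : setT x ->
    (0 <= (if sqmod x < r then (r - sqmod x) ^+ (k + m.+1) else 0)%:E)%E.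
  move=> _; rewrite lee_fin; case: ifP => // xr; rewrite exprn_ge0// subr_ge0.
  exact: ltW.
rewrite (ge0_integralZl_EFin _ _ G0 mG (ltW (ball_moment_cst_gt0 _ _)))//.
case: ifPn => [r0|]; last first.
  rewrite -leNgt => r0; rewrite integral0_eq ?mule0// => z _.
  by rewrite ltNge (le_trans r0 (sqmod_ge0 z)).
rewrite integral_plane_pow_sub// /ball_moment_cst (addnS k m.+1) factS natrM -EFinM.
have x0 : (k + m.+1).+1%:R != 0 :> R by rewrite pnatr_eq0.
have y0 : (k + m.+1)`!%:R != 0 :> R by rewrite pnatr_eq0 -lt0n fact_gt0.
congr EFin; rewrite [in RHS]exprS.
move: ((k + m.+1).+1%:R) ((k + m.+1)`!%:R) x0 y0 => x y x0 y0.
by field; rewrite x0 y0.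
Qed.

(** The scale [c] makes the induction on [n] possible: freezing the first coordinate [x] replaces
    [c] by [c * expR (- mu * sqmod x)], and the power [c ^+ (k + m.+1)] turns into a Gaussian of
    rate [mu * (k + m.+1)]. Each coordinate of z thus contributes one factor
    [area / (mu * (k + m.+1))]. *)
Lemma hartogs_moment n m k (mu c : R) : 0 < mu -> 0 < c ->
  (\int[lebesgue_Cn R (n + m.+1)]_t
     (if tail_sq n t < c * expR (- mu * head_sq n t)
      then nth_sq (n + m) t ^+ k else 0)%:E =
   (ball_moment_cst m.+1 k * c ^+ (k + m.+1) *
     (area / (mu * (k + m.+1)%:R)) ^+ n)%:E)%E.
Proof.
move=> mu0; elim: n c => [|n IH] c c0.
  have := ball_moment m k c; rewrite c0 expr0 mulr1 => <-.
  apply: eq_integral => t _; rewrite (_ : head_sq 0 t = 0) ?mulr0 ?expR0 ?mulr1//.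
  by rewrite /head_sq big_pred0.
have mF : measurable_fun setT (fun t : (n + m.+1).+1.-tuple P =>
    (if tail_sq n.+1 t < c * expR (- mu * head_sq n.+1 t)
     then nth_sq (n + m).+1 t ^+ k else 0)%:E).
  apply: measurable_fun_cut => //; first exact: measurable_tail_sq.
    apply: measurable_funM => //; apply: measurableT_comp => //.
    by apply: measurable_funM => //; exact: measurable_head_sq.
  by apply: measurable_funX; apply: measurable_nth_sq; rewrite ltnS addnS.
have F0 (t : (n + m.+1).+1.-tuple P) :
    (0 <= (if tail_sq n.+1 t < c * expR (- mu * head_sq n.+1 t)
     then nth_sq (n + m).+1 t ^+ k else 0)%:E)%E.
  by rewrite lee_fin; case: ifP => // _; rewrite exprn_ge0 ?nth_sq_ge0.
rewrite (Cn_fubini mF F0).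
set B := ball_moment_cst _ _; set A := (_ / _) ^+ n in IH *.
have km0 : 0 < (k + m.+1)%:R :> R by rewrite addnS ltr0n.
have E x : (\int[lebesgue_Cn R (n + m.+1)]_t
    (if (tail_sq n.+1 (tuple_cons (x, t)) <
         c * expR (- mu * head_sq n.+1 (tuple_cons (x, t))))%R
     then (nth_sq (n + m).+1 (tuple_cons (x, t)) ^+ k)%R else 0%R)%:E =
    (B * c ^+ (k + m.+1) * A)%:E *
    (expR (- (mu * (k + m.+1)%:R) * sqmod x))%:E)%E.
  under eq_integral do rewrite tail_sq_cons head_sq_cons nth_sq_cons mulrDr expRD mulrA.
  rewrite IH ?mulr_gt0 ?expR_gt0// exprMn -expRM_natl -EFinM; congr EFin.
  rewrite (_ : _ * (- mu * _) = - (mu * (k + m.+1)%:R) * sqmod x); last by ring.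
  by rewrite mulrA mulrAC.
under eq_integral do rewrite E.
have mG : measurable_fun setT (fun x : P =>
    (expR (- (mu * (k + m.+1)%:R) * sqmod x))%:E).
  apply/measurable_EFinP; apply: measurableT_comp => //.
  by apply: measurable_funM => //; exact: measurable_sqmod.
have G0 (x : P) : setT x -> (0 <= (expR (- (mu * (k + m.+1)%:R) * sqmod x))%:E)%E.
  by move=> _; rewrite lee_fin expR_ge0.
have K0 : 0 <= B * c ^+ (k + m.+1) * A.
  rewrite mulr_ge0 ?exprn_ge0//.
    by rewrite mulr_ge0 ?exprn_ge0 ?ltW// ball_moment_cst_gt0.
  by rewrite divr_ge0 ?mulr_ge0 ?ltW// disc_area_gt0.
rewrite (ge0_integralZl_EFin _ _ G0 mG K0)//.
rewrite integral_plane_exp ?mulr_gt0// -EFinM; congr EFin.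
by rewrite exprS /A; ring.
Qed.

End moments.

(** * Averaging over rotations *)

Section open_sets.
Variables (R : realType) (N : nat).
Local Notation RT := (measurableTypeR R).
Local Notation P := (RT * RT)%type.
Local Notation V := ('rV[R[i]]_N : normedModType R[i]).

Lemma nbhs_rowP (v : V) (A : set V) : nbhs v A <-> exists2 e : R, 0 < e &
  forall w : V, (forall i, normc (w 0 i - v 0 i) < e) -> A w.
Proof.
split=> [/nbhs_ballP[e /= e0 vA]|[e e0 vA]].
  have eE : e = (Re e)%:C by rewrite RRe_real// gtr0_real.
  exists (Re e); first by rewrite -ltcR -eE.
  move=> w wv; apply: vA; split => // i j; rewrite ord1 /ball/=.
  by rewrite normr_normc eE ltcR normc_distC.
apply/nbhs_ballP; exists e%:C; first by rewrite /= ltcR.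
move=> w [_ wv]; apply: vA => i; have := wv 0 i.
by rewrite /ball/= normr_normc ltcR normc_distC.
Qed.

Let box (q : N.-tuple (rat * rat) * nat) : set (N.-tuple P) :=
  [set t | forall i, `|(tnth t i).1 - ratr (tnth q.1 i).1| < q.2.+1%:R^-1 /\
                     `|(tnth t i).2 - ratr (tnth q.1 i).2| < q.2.+1%:R^-1].

Let measurable_box q : measurable (box q).
Proof.
have mB (c e : R) : measurable ([set x | `|x - c| < e] : set RT).
  rewrite (_ : [set x | _] = `]c - e, c + e[%classic); first exact: measurable_itv.
  by apply/seteqP; split => x /=; rewrite in_itv/= ltr_distl.
rewrite (_ : box q = \bigcap_(i in [set: 'I_N])
   ((fun t : N.-tuple P => tnth t i) @^-1`
     ([set x | `|x - ratr (tnth q.1 i).1| < q.2.+1%:R^-1] `*`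
      [set x | `|x - ratr (tnth q.1 i).2| < q.2.+1%:R^-1]))).
  apply: fin_bigcap_measurable => // i _; rewrite -[X in measurable X]setTI.
  by apply: measurable_tnth => //; exact: measurableX.
by apply/seteqP; split => [t h i _|t h i]; [exact: h|exact: (h i I)].
Qed.

(** An open set is the union of the boxes with rational centre and radius [1 / (n + 1)] that it
    contains; [pickle] enumerates them. *)
Lemma measurable_preimage_open (O : set V) : open O ->
  measurable (@Cn_of_tuple R N @^-1` O).
Proof.
move=> oO; set O' := _ @^-1` O.
rewrite (_ : O' = \bigcup_k (if unpickle k is Some q then
    (if `[< box q `<=` O' >] then box q else set0) else set0)).
  apply: bigcupT_measurable => k; case: (unpickle k) => [q|//].
  by case: ifP.
apply/seteqP; split => [t Ot|t [k _]]; last first.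
  by case: (unpickle k) => [q|//]; case: asboolP => // h /h.
have /nbhs_rowP[e e0 eO] : nbhs (Cn_of_tuple t : V) O by exact: open_nbhs_nbhs.
(* Two points of a box differ by less than twice the radius in each real coordinate, hence by less
   than four times the radius in each complex one. *)
have [n ne] : exists n, n.+1%:R^-1 < e / 4.
  have := archi_boundP (ltW (divr_gt0 (ltr0n R 4) e0)); move: (Num.bound _) => n hn.
  exists n; rewrite -[ltRHS]invrK ltf_pV2 ?posrE ?invr_gt0 ?divr_gt0//.
  by rewrite invf_div (lt_trans hn)// ltr_nat.
have n0 : 0 < n.+1%:R^-1 :> R by rewrite invr_gt0.
have app (x : R) : exists q : rat, `|x - ratr q| < n.+1%:R^-1.
  have xx : x - n.+1%:R^-1 < x + n.+1%:R^-1 by rewrite ltrBlDr -addrA ltrDl addr_gt0.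
  have [q] := rat_in_itvoo xx.
  by rewrite in_itv/= => h; exists q; rewrite distrC ltr_distl.
pose a (x : R) := projT1 (cid (app x)).
have aE x : `|x - ratr (a x)| < n.+1%:R^-1 by exact: projT2 (cid (app x)).
pose q := ([tuple (a (tnth t i).1, a (tnth t i).2) | i < N], n).
have tq : box q t by move=> i; rewrite /= tnth_mktuple/=; split; exact: aE.
exists (pickle q) => //; rewrite pickleK asboolT// => s sq.
apply: eO => i; rewrite !mxE (le_lt_trans (normc_le_ReIm _))//=.
have [s1 s2] := sq i; have [t1 t2] := tq i.
have tri (x y c d : R) : `|x - c| < d -> `|y - c| < d -> `|x - y| < d + d.
  move=> xc yc; rewrite -(subrK c x) -addrA (le_lt_trans (ler_normD _ _))//.
  by rewrite ltrD// distrC.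
have := tri _ _ _ _ s1 t1; have := tri _ _ _ _ s2 t2.
by rewrite [q.2]/=; move: ne; set x := n.+1%:R^-1; lra.
Qed.

Lemma cmeasurable_continuous (D : set V) (f : V -> R[i]^o) : open D ->
  (forall v, D v -> {for v, continuous f}) ->
  cmeasurable (@Cn_of_tuple R N @^-1` D) (fun t => f (Cn_of_tuple t)).
Proof.
move=> oD cf.
have key (g : R[i]^o -> R) : continuous g ->
    measurable_fun (@Cn_of_tuple R N @^-1` D) (fun t => g (f (Cn_of_tuple t)) : RT).
  move=> cg; apply: (measurability _ (RGenOInfty.measurableE R)).
  move=> /= _ [_ [a ->] <-].
  rewrite (_ : _ `&` _ = @Cn_of_tuple R N @^-1` (D `&` [set v | a < g (f v)])).
    apply: measurable_preimage_open; rewrite openE => v [Dv av].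
    apply: filterI; first exact: open_nbhs_nbhs.
    have cgf : {for v, continuous (g \o f)}.
      by apply: continuous_comp; [exact: cf|exact: cg].
    by have := cvgr_gt _ cgf _ av; apply; exact: nbhs_filter.
  by apply/seteqP; split => t /=; rewrite in_itv/= andbT.
by split; apply: key; [exact: continuous_Re|exact: continuous_Im].
Qed.

End open_sets.

Section averaging.
Variables (R : realType) (N : nat).
Local Notation RT := (measurableTypeR R).
Local Notation P := (RT * RT)%type.
Local Notation leb := (@lebesgue_measure R).
Local Notation Leb := (lebesgue_Cn R N).
Local Notation T := (N.-tuple P).
Variables (D : set T) (A : R -> 'M[R[i]]_N).
Hypothesis mD : measurable D.
Hypothesis mA : forall i j, cmeasurable setT (fun theta : RT => A theta i j).
Hypothesis uA : forall theta, normc (\det (A theta)) = 1.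
Hypothesis DA : forall theta t, D (tuple_mulmx (A theta) t) <-> D t.

Let J : set RT := `[0, pi *+ 2]%classic.

Lemma measurable_tuple_mulmx_param :
  measurable_fun setT (fun z : T * RT => tuple_mulmx (A z.2) z.1).
Proof.
apply: measurable_row_tuple => i; under eq_fun do rewrite mxE.
apply: cmeasurable_sum => j; apply: cmeasurableM.
  exact: (cmeasurable_comp (cmeasurable_coord R j) measurable_fst).
exact: (cmeasurable_comp (mA j i) measurable_snd).
Qed.

Lemma change_of_variables_param theta :
  change_of_variables Leb (tuple_mulmx (A theta)) (fun=> 1).
Proof.
have u : A theta \in unitmx.
  by rewrite unitmxE unitfE -normc_eq0 uA oner_eq0.
apply: change_of_variables_ext (linear_change_unit u) => // t.
by rewrite uA expr1n.
Qed.

(* Fubini on D x [0, 2 pi]: the integral of f is that of its averages over the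
   orbits of the rotations A theta. *)
Lemma average_integral (f g : T -> R) :
  Leb.-integrable D (EFin \o f) ->
  (forall t, D t ->
    (\int[leb]_(theta in J) (f (tuple_mulmx (A theta) t))%:E =
     (pi *+ 2 * g t)%:E)%E) ->
  Leb.-integrable D (EFin \o g) /\
  (\int[Leb]_(t in D) (f t)%:E = \int[Leb]_(t in D) (g t)%:E)%E.
Proof.
move=> intf fg.
pose f0 := (EFin \o f) \_ D.
have intf0 : Leb.-integrable setT f0 by rewrite /f0 -integrable_mkcond.
have mf0 : measurable_fun setT f0 by case/integrableP : intf0.
have mJ : measurable J by exact: measurable_itv.
(* Extension by 0 outside [D] and [J] turns both iterated integrals into integrals over whole
   spaces. *)
pose h (z : T * RT) : \bar R := if z.2 \in J then f0 (tuple_mulmx (A z.2) z.1) else 0%E.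
have mh : measurable_fun setT h.
  apply: measurable_fun_ifT => //.
    apply: (measurableT_comp (f := fun x : RT => x \in J)) => //.
    by apply: (measurable_fun_bool true); rewrite setTI preimage_mem_true.
  exact: (measurableT_comp mf0 measurable_tuple_mulmx_param).
have cv := change_of_variables_param.
have lebJ : leb J = (pi *+ 2)%:E by rewrite /J lebesgue_itvcc ?subr0// pi2_ge0.
have cstJ (x : \bar R) : (\int[leb]_(y in J) x = (pi *+ 2)%:E * x)%E.
  have E := @integral_cst _ _ R leb J mJ x.
  by rewrite E muleC; congr (_ * _)%E; exact: lebJ.
have invE theta (u : T -> \bar R) : measurable_fun setT u ->
    (\int[Leb]_t u (tuple_mulmx (A theta) t) = \int[Leb]_t u t)%E.
  move=> mu; rewrite (integral_change (cv theta) measurableT mu) preimage_setT.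
  by apply: eq_integral => t _; rewrite mul1e.
(* Tonelli with the inner integral over [T]: by invariance it does not depend on the angle, so the
   total is [2 pi] times the integral of the modulus of [f0]. *)
have inth : (Leb \x leb)%E.-integrable setT h.
  apply/(integrable21ltyP _ _ mh).
  rewrite (_ : (\int[leb]_y _)%E = (\int[leb]_(y in J) (\int[Leb]_t `|f0 t|))%E).
    rewrite cstJ; case/integrableP : intf0 => _ lt.
    by rewrite lte_mul_pinfty ?lee_fin ?pi2_ge0// ltry.
  rewrite [RHS]integral_mkcond; apply: eq_integral => y _.
  rewrite /patch /h /=; case: ifP => yJ; last first.
    by apply: integral0_eq => t _; rewrite abse0.
  by rewrite (invE y (abse \o f0)) //; exact: measurableT_comp.
have hE (t : T) : (\int[leb]_y h (t, y) = (((fun t => pi *+ 2 * g t) \_ D) t)%:E)%E.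
  rewrite /h /=; transitivity (\int[leb]_(y in J) f0 (tuple_mulmx (A y) t))%E.
    by rewrite [RHS]integral_mkcond.
  rewrite /patch; case: ifPn => [/set_mem Dt|/negP nDt].
    rewrite -fg//; apply: eq_integral => y _; rewrite /f0 /patch mem_set//.
    by apply/DA.
  apply: integral0_eq => y _; rewrite /f0 /patch; case: ifP => // /set_mem.
  by move/DA => /mem_set.
have intF := integrable_fubini_F inth; have FE := integral12_prod_meas1 inth.
have FE' := integral21_prod_meas1 inth.
have EF : fubini_F leb h = (fun t => (((fun t => pi *+ 2 * g t) \_ D) t)%:E).
  by apply/funext => t; rewrite /fubini_F hE.
have pi0 : pi *+ 2 != 0 :> R by rewrite mulrn_eq0/= gt_eqF// pi_gt0.
have intg2 : Leb.-integrable D (EFin \o (fun t => pi *+ 2 * g t)).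
  apply/(integrable_mkcond _ mD); move: intF; rewrite EF.
  by apply: eq_integrable => // t _; rewrite /patch /=; case: ifP.
have intg : Leb.-integrable D (EFin \o g).
  have := integrableZl_EFin (pi *+ 2)^-1 mD intg2.
  by apply: eq_integrable => // t _ /=; rewrite mulKf.
split => //.
have lhs : (\int[leb]_y fubini_G Leb h y = (pi *+ 2)%:E * \int[Leb]_(t in D) (f t)%:E)%E.
  rewrite [in RHS]integral_mkcond -/f0 -cstJ.
  rewrite [RHS]integral_mkcond; apply: eq_integral => y _.
  rewrite /fubini_G /h /patch /=; case: ifP => yJ; first exact: invE.
  exact: integral0_eq.
have rhs : (\int[Leb]_t fubini_F leb h t = (pi *+ 2)%:E * \int[Leb]_(t in D) (g t)%:E)%E.
  rewrite EF -integralZl// [RHS]integral_mkcond.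
  by apply: eq_integral => t _; rewrite /patch; case: ifP.
have : ((pi *+ 2)%:E * \int[Leb]_(t in D) (f t)%:E =
        (pi *+ 2)%:E * \int[Leb]_(t in D) (g t)%:E)%E by rewrite -lhs -rhs FE FE'.
move=> /(congr1 (fun x => (pi *+ 2)^-1%:E * x)%E).
by rewrite !muleA -EFinM mulVf// !mul1e.
Qed.

Lemma average_cint (F G : T -> R[i]) : cintegrable Leb D F ->
  (forall t, D t ->
    cintegrable leb J (fun theta => F (tuple_mulmx (A theta) t)) /\
    cint leb J (fun theta => F (tuple_mulmx (A theta) t)) = (pi *+ 2)%:C * G t) ->
  cintegrable Leb D G /\ cint Leb D F = cint Leb D G.
Proof.
move=> [Fr Fi] FG.
have fineE (f : RT -> R) (x : R) : leb.-integrable J (EFin \o f) ->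
    \int[leb]_(y in J) f y = x -> (\int[leb]_(y in J) (f y)%:E = x%:E)%E.
  move=> intf <-; rewrite /Rintegral fineK//; apply: integrable_fin_num => //.
  exact: measurable_itv.
have [|Gr Er] := @average_integral _ (fun t => Re (G t)) Fr.
  move=> t Dt; have [[ir _] /(congr1 (@complex.Re R))] := FG t Dt.
  by rewrite ReM /= mul0r subr0; exact: fineE.
have [|Gi Ei] := @average_integral _ (fun t => Im (G t)) Fi.
  move=> t Dt; have [[_ ii] /(congr1 (@complex.Im R))] := FG t Dt.
  by rewrite ImM /= mul0r addr0; exact: fineE.
by split => //; rewrite /cint /Rintegral Er Ei.
Qed.

End averaging.

(** * Openness and Reinhardt symmetry of the Hartogs domain *)

Section hartogs_domain_facts.
Variables (R : realType) (n m : nat) (mu : R).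
Hypothesis mu_gt0 : 0 < mu.
Local Notation RT := (measurableTypeR R).
Local Notation P := (RT * RT)%type.
Local Notation C := (R[i]^o).
Local Notation V := ('rV[R[i]]_(n + m) : normedModType R[i]).
Local Notation D := (@hartogs_domain R n m mu).

Lemma euclidean_norm_sqr k (z : 'rV[R[i]]_k) :
  euclidean_norm z ^+ 2 = \sum_j normc (z 0 j) ^+ 2.
Proof.
rewrite /euclidean_norm sqr_sqrtr; last by apply: sumr_ge0 => j _; exact: sqr_ge0.
by apply: eq_bigr => j _; rewrite normr_normc.
Qed.

Lemma hartogs_domainE (v : 'rV_(n + m)) : D v <->
  \sum_(i < n + m | (n <= i)%N) normc (v 0 i) ^+ 2 <
  expR (- mu * \sum_(i < n + m | (i < n)%N) normc (v 0 i) ^+ 2).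
Proof.
rewrite /hartogs_domain /= !euclidean_norm_sqr.
have -> : \sum_(i < n + m | (n <= i)%N) normc (v 0 i) ^+ 2 = \sum_j normc (rsubmx v 0 j) ^+ 2.
  rewrite big_split_ord /= big_pred0 ?add0r; last first.
    by move=> i /=; rewrite leqNgt ltn_ord.
  by apply: eq_big => [i|i _]; rewrite ?leq_addr// mxE.
have -> : \sum_(i < n + m | (i < n)%N) normc (v 0 i) ^+ 2 = \sum_j normc (lsubmx v 0 j) ^+ 2.
  rewrite big_split_ord /= [X in _ + X]big_pred0 ?addr0; last first.
    by move=> i /=; rewrite ltnNge leq_addr.
  by apply: eq_big => [i|i _]; rewrite ?ltn_ord// mxE.
by [].
Qed.

Lemma sqmod_tnth N (t : N.-tuple P) i :
  sqmod (tnth t i) = normc (Cn_of_tuple t 0 i) ^+ 2.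
Proof. by rewrite mxE sqr_normc_ReIm. Qed.

Lemma hartogs_domain_tuple (t : (n + m).-tuple P) :
  D (Cn_of_tuple t) <-> tail_sq n t < expR (- mu * head_sq n t).
Proof.
rewrite hartogs_domainE /tail_sq /head_sq.
under [in X in _ <-> X]eq_bigr do rewrite sqmod_tnth.
by under [in X in _ <-> _ < X]eq_bigr do rewrite sqmod_tnth.
Qed.

(** Smaller moduli decrease the left side of the defining inequality and increase its right side. *)
Lemma hartogs_domain_reinhardt (v w : 'rV_(n + m)) : D v ->
  (forall i, normc (w 0 i) <= normc (v 0 i)) -> D w.
Proof.
move=> /hartogs_domainE vD wv; apply/hartogs_domainE.
have sq i : normc (w 0 i) ^+ 2 <= normc (v 0 i) ^+ 2.
  by rewrite lerXn2r ?nnegrE ?normc_ge0.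
apply: le_lt_trans (_ : _ <= \sum_(i < n + m | (n <= i)%N) normc (v 0 i) ^+ 2) _.
  exact: ler_sum.
apply: (lt_le_trans vD); rewrite ler_expR !mulNr lerN2.
by apply: ler_wpM2l; [exact: ltW|exact: ler_sum].
Qed.

Lemma open_hartogs_domain : open (D : set V).
Proof.
pose f (v : V) : R^o := expR (- mu * \sum_(i < n + m | (i < n)%N) normc (v 0 i) ^+ 2) -
  \sum_(i < n + m | (n <= i)%N) normc (v 0 i) ^+ 2.
have csq (p : pred 'I_(n + m)) :
    continuous (fun v : V => (\sum_(i | p i) normc (v 0 i) ^+ 2) : R^o).
  apply: (@continuous_big _ _ +%R 0 p _ V _
    (fun i (v : V) => normc (v 0 i) ^+ 2 : R^o)); first exact: add_continuous.
  move=> i _ v.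
  apply: (@continuous_comp _ _ _ (fun v : V => normc (v 0 i) : R^o) (fun x : R^o => x ^+ 2)).
    apply: (@continuous_comp _ _ _ (fun v : V => v 0 i : C) (fun x : C => normc x)).
      exact: coord_continuous.
    exact: continuous_normc.
  exact: exprn_continuous.
have cf : continuous f.
  move=> v.
  have c1 : {for v, continuous (fun v : V =>
      - mu * \sum_(i < n + m | (i < n)%N) normc (v 0 i) ^+ 2 : R^o)}.
    exact: (@cvgM R V (nbhs v) _ (fun=> - mu) _ (- mu) _ (cvg_cst _) (csq (fun i : 'I_(n + m) => (i < n)%N) v)).
  have c2 := continuous_comp c1 (@continuous_expR R _).
  have c3 := csq (fun i : 'I_(n + m) => (n <= i)%N) v.
  exact: (@cvgB _ _ _ (nbhs v) _ _ _ _ _ c2 c3).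
rewrite (_ : (D : set V) = f @^-1` [set x | 0 < x]).
  by apply: open_comp; [move=> v _; exact: cf|exact: open_gt].
by apply/seteqP; split => v; rewrite /= subr_gt0 => /hartogs_domainE.
Qed.

(** As [a] and [b] have disjoint supports, the moduli of [a + l *: b] are at most those of
    [a + (1 + d) *: b], which lies in the domain by openness. A radius beyond 1 is what the mean
    value property on the unit circle asks for. *)
Lemma hartogs_domain_dilate (a b : 'rV_(n + m)) : D (a + b) ->
  (forall i, a 0 i * b 0 i = 0) ->
  exists2 R0 : R, 1 < R0 & forall l, normc l < R0 -> D (a + l *: b).
Proof.
move=> abD ab0.
have := open_nbhs_nbhs (conj open_hartogs_domain abD).
move=> /nbhs_rowP[e e0 eD].
(* The [+ 1] keeps [s] positive when [b = 0]. *)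
pose s := \sum_i normc (b 0 i) + 1.
have s0 : 0 < s by rewrite ltr_wpDl// sumr_ge0// => i _; exact: normc_ge0.
pose d := e / (s *+ 2).
have d0 : 0 < d by rewrite divr_gt0// mulrn_wgt0.
have abd : D (a + (1 + d)%:C *: b).
  apply: eD => i; rewrite !mxE.
  have -> : a 0 i + (1 + d)%:C * b 0 i - (a 0 i + b 0 i) = d%:C * b 0 i.
    by rewrite rmorphD/= rmorph1; ring.
  rewrite Normc.normcM normcR gtr0_norm//.
  apply: (@le_lt_trans _ _ (d * s)).
    apply: ler_wpM2l; first exact: ltW.
    rewrite /s (bigD1 i)//= -addrA lerDl addr_ge0// sumr_ge0// => j _.
    exact: normc_ge0.
  rewrite /d -mulr_natr; set x := s; move: s0; rewrite -/x => x0.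
  have x0' : x != 0 by rewrite gt_eqF.
  rewrite (_ : e / (x * 2%:R) * x = e / 2); last by field.
  by lra.
exists (1 + d); first by lra.
move=> l ld; apply: hartogs_domain_reinhardt abd _ => i; rewrite !mxE.
have [a0|/eqP b0] := boolP (a 0 i == 0); last first.
  have bi0 : b 0 i = 0.
    by have /eqP := ab0 i; rewrite mulf_eq0 => /orP[/eqP//|/eqP].
  by rewrite bi0 !mulr0.
rewrite (eqP a0) !add0r !Normc.normcM; apply: ler_wpM2r; first exact: normc_ge0.
by rewrite normcR gtr0_norm ?(ltW ld)//; lra.
Qed.

End hartogs_domain_facts.

Section affine_lines.
Variables (R : realType) (N : nat).
Local Notation C := (R[i]^o).
Local Notation V := ('rV[R[i]]_N : normedModType R[i]).

Lemma derivable_line (f : 'rV[R[i]]_N -> R[i]) (a b : 'rV[R[i]]_N) (l : C) :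
  differentiable (f : V -> C) (a + l *: b : V) ->
  derivable (fun l : C => f (a + l *: b) : C) l 1.
Proof.
move=> df; apply/derivable1_diffP.
apply: (@differentiable_comp _ _ _ _ (fun l : C => a + l *: b : V) (f : V -> C)) => //.
Qed.

End affine_lines.

Lemma cmeasurable_cis (R : realType) :
  cmeasurable setT (fun theta : measurableTypeR R => cis theta).
Proof.
split.
  exact: (continuous_measurable_fun (@continuous_cos R)).
exact: (continuous_measurable_fun (@continuous_sin R)).
Qed.

Section rotations.
Variables (R : realType) (N : nat).
Implicit Types (v : 'rV[R[i]]_N) (p : pred 'I_N).

Definition rot p (theta : R) : 'M[R[i]]_N :=
  diag_mx (\row_j (if p j then cis theta else 1)).

Lemma mul_rotE v p theta j :
  (v *m rot p theta) 0 j = if p j then cis theta * v 0 j else v 0 j.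
Proof. by rewrite mul_mx_diag !mxE; case: ifP => _; rewrite ?mulr1// mulrC. Qed.

Lemma normc_mul_rot v p theta j : normc ((v *m rot p theta) 0 j) = normc (v 0 j).
Proof. by rewrite mul_rotE; case: ifP => // _; rewrite Normc.normcM normc_cis mul1r. Qed.

Lemma normc_det_rot p theta : normc (\det (rot p theta)) = 1.
Proof.
rewrite det_diag; elim/big_ind: _ => [|x y x1 y1|j _].
- by rewrite -[1]/(1%:C) normcR normr1.
- by rewrite Normc.normcM x1 y1 mulr1.
- by rewrite mxE; case: ifP => _; rewrite ?normc_cis// -[1]/(1%:C) normcR normr1.
Qed.

Lemma cmeasurable_rot p i j :
  cmeasurable setT (fun theta : measurableTypeR R => rot p theta i j).
Proof.
rewrite /rot; have [<-|ij] := eqVneq i j.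
  rewrite (_ : (fun _ => _) = if p i then @cis R else fun=> 1); last first.
    by apply/funext => theta; rewrite !mxE eqxx mulr1n; case: ifP.
  by case: ifP => _; [exact: cmeasurable_cis|exact: cmeasurable_cst].
rewrite (_ : (fun _ => _) = fun=> 0); first exact: cmeasurable_cst.
by apply/funext => theta; rewrite !mxE (negbTE ij) mulr0n.
Qed.

End rotations.

(** * Pairing a holomorphic function with powers of the last coordinate *)

Section hartogs_coefficient.
Variables (R : realType) (n m : nat) (mu : R).
Hypothesis mu_gt0 : 0 < mu.
Local Notation N := (n + m.+1)%N.
Local Notation RT := (measurableTypeR R).
Local Notation P := (RT * RT)%type.
Local Notation C := (R[i]^o).
Local Notation D := (@hartogs_domain R n m.+1 mu).
Local Notation Leb := (lebesgue_Cn R N).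
Local Notation Dt := (@Cn_of_tuple R N @^-1` D).

Definition last_coord : 'I_N := rshift n ord_max.
Local Notation L := last_coord.
Local Notation e_L := (delta_mx 0 L : 'rV[R[i]]_N).

Lemma measurable_hartogs : measurable Dt.
Proof. by apply: measurable_preimage_open; exact: open_hartogs_domain. Qed.

Lemma hartogs_domain_rot p theta (v : 'rV_N) : D (v *m rot p theta) <-> D v.
Proof.
by split=> h; apply: (hartogs_domain_reinhardt mu_gt0 h) => i; rewrite normc_mul_rot.
Qed.

(** The integral over the orbit of [v] is read as the integral over the unit circle of a
    one-variable function [h], to which Cauchy's theory applies. *)
Lemma hartogs_average (p : pred 'I_N) (F G : 'rV[R[i]]_N -> R[i]) :
  cintegrable Leb Dt (F \o @Cn_of_tuple R N) ->
  (forall v, D v -> exists h : C -> C, [/\ circ_continuous h 1,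
    forall theta, F (v *m rot p theta) = h (cis theta) &
    circ_int h 1 = (pi *+ 2)%:C * G v]) ->
  cintegrable Leb Dt (G \o @Cn_of_tuple R N) /\
  cint Leb Dt (F \o @Cn_of_tuple R N) = cint Leb Dt (G \o @Cn_of_tuple R N).
Proof.
move=> intF FG; apply: (@average_cint _ _ _ (rot p)) => //.
- exact: measurable_hartogs.
- exact: cmeasurable_rot.
- exact: normc_det_rot.
- move=> theta t; rewrite /= /tuple_mulmx row_tupleK; exact: hartogs_domain_rot.
move=> t Dt_; have [h [ch Fh hG]] := FG _ Dt_.
have E : (fun theta : RT => (F \o @Cn_of_tuple R N) (tuple_mulmx (rot p theta) t)) =
    (fun theta : RT => h (1%:C * cis theta)).
  by apply/funext => theta; rewrite /= /tuple_mulmx row_tupleK Fh mul1r.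
rewrite E; split; first exact: (circ_cintegrable ler01 ch).
exact: hG.
Qed.

(** The squared norm of the k-th power of the last coordinate; here zeta has [m.+1] coordinates. *)
Definition hartogs_norm_sq k : R :=
  ball_moment_cst R m.+1 k * (disc_area R / (mu * (k + m.+1)%:R)) ^+ n.

Lemma hartogs_norm_sq_gt0 k : 0 < hartogs_norm_sq k.
Proof.
rewrite /hartogs_norm_sq mulr_gt0 ?ball_moment_cst_gt0// exprn_gt0//.
by rewrite divr_gt0 ?disc_area_gt0// mulr_gt0// addnS.
Qed.

Lemma integral_hartogs_coord k :
  (\int[Leb]_(t in Dt) (normc (Cn_of_tuple t 0 L) ^+ 2 ^+ k)%:E =
   (hartogs_norm_sq k)%:E)%E.
Proof.
have := @hartogs_moment R n m k mu 1 mu_gt0 ltr01.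
rewrite expr1n mulr1 => <-.
rewrite integral_mkcond; apply: eq_integral => t _; rewrite /patch mul1r.
have E : normc (Cn_of_tuple t 0 L) ^+ 2 = nth_sq (n + m) t.
  by rewrite -sqmod_tnth /nth_sq (tnth_nth (0, 0)).
have [/set_mem/hartogs_domain_tuple h|/negP h] := boolP (t \in Dt).
  by rewrite h E.
case: ifPn => // h'; exfalso; apply: h; apply/mem_set.
exact/hartogs_domain_tuple.
Qed.

Lemma integrable_hartogs_coord k :
  Leb.-integrable Dt (fun t => (normc (Cn_of_tuple t 0 L) ^+ 2 ^+ k)%:E).
Proof.
apply/integrableP; split.
  apply/measurable_EFinP.
  have E : (fun t : N.-tuple P => normc (Cn_of_tuple t 0 L) ^+ 2 ^+ k) =
      (fun t => nth_sq (n + m) t ^+ k).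
    by apply/funext => t; rewrite -sqmod_tnth /nth_sq (tnth_nth (0, 0)).
  rewrite E; apply: measurable_funX; apply: measurable_funTS.
  by apply: measurable_nth_sq; rewrite ltn_add2l.
under eq_integral do rewrite gee0_abs ?lee_fin ?exprn_ge0 ?normc_ge0//.
by rewrite integral_hartogs_coord ltry.
Qed.

Lemma hartogs_last_coord_lt1 (v : 'rV_N) : D v -> normc (v 0 L) < 1.
Proof.
move=> /hartogs_domainE Dv.
rewrite -(@expr_lt1 _ 2) ?normc_ge0//.
have tl : normc (v 0 L) ^+ 2 <= \sum_(i < N | (n <= i)%N) normc (v 0 i) ^+ 2.
  rewrite (bigD1 L) ?leq_addr//= lerDl.
  by apply: sumr_ge0 => i _; exact: sqr_ge0.
apply: (le_lt_trans tl); apply: (lt_le_trans Dv).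
rewrite -[leRHS]expR0 ler_expR mulNr oppr_le0 mulr_ge0 ?(ltW mu_gt0)//.
by apply: sumr_ge0 => i _; exact: sqr_ge0.
Qed.

Lemma hartogs_last_axis (l : C) : normc l < 1 -> D (l *: e_L).
Proof.
move=> l1; apply/hartogs_domainE.
rewrite (bigD1 L) ?leq_addr//= [X in _ + X < _]big1 ?addr0; last first.
  by move=> i /andP[_ /negbTE iL]; rewrite !mxE iL andbF mulr0 Normc.normc0 expr0n.
rewrite big1 => [|i]; last first.
  move=> ni; rewrite !mxE (_ : (i == L) = false) ?andbF ?mulr0 ?Normc.normc0 ?expr0n//.
  by apply/negbTE; apply: contraTneq ni => ->; rewrite -leqNgt leq_addr.
by rewrite mulr0 expR0 !mxE !eqxx mulr1 expr_lt1 ?normc_ge0.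
Qed.

(* Averaging first over the rotations of the other coordinates replaces f by
   its restriction to the last axis (mean value property), and then over those
   of the last coordinate only leaves the Taylor coefficient of order k. *)
Lemma hartogs_coefficient (f : 'rV[R[i]]_N -> R[i]) k (r : R) :
  0 < r < 1 -> holomorphic_on D f ->
  cintegrable Leb Dt
    (fun t => f (Cn_of_tuple t) * ((Cn_of_tuple t 0 L)^*) ^+ k) ->
  cint Leb Dt (fun t => f (Cn_of_tuple t) * ((Cn_of_tuple t 0 L)^*) ^+ k) =
  taylor_coef (fun l : C => f (l *: e_L)) k r * (hartogs_norm_sq k)%:C.
Proof.
move=> r01 hf intF.
pose F0 v := f v * ((v 0 L)^*) ^+ k.
pose F1 (v : 'rV[R[i]]_N) := f (v 0 L *: e_L) * ((v 0 L)^*) ^+ k.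
set c := taylor_coef _ _ _.
pose F2 (v : 'rV[R[i]]_N) := c * (normc (v 0 L) ^+ 2 ^+ k)%:C.
have [] := @hartogs_average (predC1 L) F0 F1 intF.
  (* Rotating the other coordinates by [theta] sends [v] to [v 0 L *: e_L + cis theta *: b], so the
     average is the value at [l = 0] on this complex line. *)
  move=> v Dv; pose b := v - v 0 L *: e_L.
  have ab i : (v 0 L *: e_L) 0 i * b 0 i = 0.
    rewrite !mxE eqxx /=; case: (eqVneq i L) => [->|_]; last by rewrite mulr0 mul0r.
    by rewrite !mulr1 subrr mulr0.
  have Dab : D (v 0 L *: e_L + b) by rewrite addrC subrK.
  have [R0 R01 Dl] := hartogs_domain_dilate mu_gt0 Dab ab.
  pose h : C -> C := fun l : C => f (v 0 L *: e_L + l *: b) * ((v 0 L)^*) ^+ k.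
  have dh (l : C) : normc l < R0 -> derivable h l 1.
    move=> lR0; have d1 := derivable_line (hf _ (Dl _ lR0)).
    have d2 : derivable (fun _ : C => ((v 0 L)^*) ^+ k : C) l 1 by exact: derivable_cst.
    exact: derivable_mulc d1 d2.
  have ch (l : C) : normc l < R0 -> {for l, continuous h}.
    move=> lR0; have d := dh l lR0.
    exact/differentiable_continuous/derivable1_diffP.
  exists h; split.
  - by move=> l l1; apply: ch; rewrite l1.
  - move=> theta; rewrite /F0 /h.
    have -> : (v *m rot (predC1 L) theta) 0 L = v 0 L by rewrite mul_rotE /= eqxx.
    congr (f _ * _); apply/rowP => i; rewrite mul_rotE /= !mxE eqxx/=.
    case: (eqVneq i L) => [->|_] /=; rewrite ?mulr1 ?mulr0 ?subrr ?mulr0 ?addr0 ?add0r//.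
    by rewrite subr0.
  - have h01 : 0 <= (1 : R) < R0 by rewrite ler01.
    (* No modulus equals [-1]: there is no exceptional circle here. *)
    rewrite (@mean_value R h R0 (-1) 1 h01 ch (fun l lR0 _ _ => dh l lR0)).
    by rewrite /h scale0r addr0.
move=> intF1 E1.
have [] := @hartogs_average (pred1 L) F1 F2 intF1.
  move=> v Dv; set a := v 0 L.
  pose phi : C -> C := fun l : C => f (l *: e_L).
  have a1 : normc a < 1 by exact: hartogs_last_coord_lt1.
  have dphi (l : C) : normc l < 1 -> derivable phi l 1.
    move=> l1; have d := @derivable_line _ _ f 0 e_L l.
    rewrite add0r in d; have {}d := d (hf _ (hartogs_last_axis l1)).
    by rewrite (_ : phi = fun l : C => f (0 + l *: e_L))//; apply/funext => x; rewrite add0r.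
  (* On the unit circle the conjugate of [cis theta] is its inverse, so the conjugate power of the
     last coordinate becomes division by [z ^+ k], which extracts the Taylor coefficient of order
     [k]. *)
  pose g : C -> C := fun z : C => phi (z * a) / z ^+ k.
  pose h : C -> C := fun z : C => (a^*) ^+ k * g z.
  have dg (z : C) : normc z = 1 -> derivable g z 1.
    move=> z1; apply: derivable_div_exp; first by rewrite -normc_gt0 z1.
    have za : normc (z * a) < 1 by rewrite Normc.normcM z1 mul1r.
    have d := @derivable_line _ _ f 0 (a *: e_L) z.
    rewrite add0r scalerA in d; have {}d := d (hf _ (hartogs_last_axis za)).
    rewrite (_ : (fun w : C => phi (w * a)) = fun l : C => f (0 + l *: (a *: e_L)))//.
    by apply/funext => x; rewrite add0r scalerA.
  have dh (z : C) : normc z = 1 -> derivable h z 1.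
    move=> z1; have d := dg z z1.
    have d2 : derivable (fun _ : C => (a^*) ^+ k : C) z 1 by exact: derivable_cst.
    exact: derivable_mulc d2 d.
  exists h; split.
  - exact: circ_continuous_derivable dh.
  - move=> theta; rewrite /F1 /h /g mul_rotE /= eqxx /phi -/a.
    rewrite [X in _ * X ^+ k](_ : _ = a^* * (cis theta)^-1); last first.
      by rewrite -cisJ [RHS]mulrC; exact: (rmorphM (@conjc R)).
    by rewrite exprMn exprVn mulrC mulrAC mulrA.
  - have E := @circ_intZ R g ((a^*) ^+ k) 1 ler01 (circ_continuous_derivable dg).
    have E3 := @circ_int_rotate R phi 1 dphi a k r r01 a1.
    rewrite [LHS]E [in LHS]E3 /F2 -/c -/a -/phi.
    have -> : (normc a ^+ 2 ^+ k)%:C = a ^+ k * (a^*) ^+ k.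
      by rewrite -exprMn mulcJ -rmorphXn.
    by rewrite mulrCA; congr (_ * _); rewrite mulrC [RHS]mulrCA mulrA.
move=> intF2 E2.
have i0 : cintegrable Leb Dt (fun t => (normc (Cn_of_tuple t 0 L) ^+ 2 ^+ k)%:C).
  split => /=; first exact: integrable_hartogs_coord.
  exact: integrable0.
have E3 := cintZ c measurable_hartogs i0.
rewrite [LHS]E1 E2 [LHS]E3; congr (_ * _).
rewrite /cint /= /Rintegral integral_hartogs_coord /=.
by congr (_ +i* _); rewrite integral0.
Qed.

End hartogs_coefficient.

(** * Square-integrable holomorphic functions *)

Section holomorphic_functions.
Variables (R : realType) (N : nat).
Local Notation C := (R[i]^o).
Local Notation V := ('rV[R[i]]_N : normedModType R[i]).
Implicit Types (O : set 'rV[R[i]]_N) (f g : 'rV[R[i]]_N -> R[i]).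

Lemma holomorphic_cst O (c : R[i]) : holomorphic_on O (fun=> c).
Proof. by move=> z _; exact: differentiable_cst. Qed.

Lemma holomorphic_coord O j : holomorphic_on O (fun v => v 0 j).
Proof. by move=> z _; exact: (@differentiable_coord R[i] 1 N z 0 j). Qed.

Lemma holomorphicD O f g : holomorphic_on O f -> holomorphic_on O g ->
  holomorphic_on O (fun v => f v + g v).
Proof. by move=> hf hg z Oz; exact: (differentiableD (hf z Oz) (hg z Oz)). Qed.

Lemma holomorphicM O f g : holomorphic_on O f -> holomorphic_on O g ->
  holomorphic_on O (fun v => f v * g v).
Proof. by move=> hf hg z Oz; exact: (@differentiableM R[i] V f g z (hf z Oz) (hg z Oz)). Qed.

Lemma holomorphic_sum O (I : finType) (F : I -> 'rV[R[i]]_N -> R[i]) :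
  (forall i, holomorphic_on O (F i)) -> holomorphic_on O (fun v => \sum_i F i v).
Proof.
move=> hF; rewrite (_ : (fun _ => _) = \big[(fun f g v => f v + g v)/fun=> 0]_i F i).
  by elim/big_ind: _; [exact: holomorphic_cst|exact: holomorphicD|move=> i _; exact: hF].
apply/funext => v; elim/big_ind2: _ => //.
by move=> x f y g -> ->.
Qed.

Lemma holomorphicV O f : holomorphic_on O f -> (forall v, O v -> f v != 0) ->
  holomorphic_on O (fun v => (f v)^-1).
Proof. by move=> hf f0 z Oz; exact: (@differentiableV R[i] V f z (hf z Oz) (f0 z Oz)). Qed.

Lemma holomorphicX O f k : holomorphic_on O f -> holomorphic_on O (fun v => f v ^+ k).
Proof.
move=> hf; elim: k => [|k IH]; first exact: holomorphic_cst.
rewrite (_ : (fun _ => _) = fun v => f v * f v ^+ k); first exact: holomorphicM.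
by apply/funext => v; rewrite exprS.
Qed.

Lemma holomorphic_cexp O f : holomorphic_on O f -> holomorphic_on O (fun v => cexp (f v)).
Proof.
move=> hf z Oz.
have d : differentiable (@cexp R : C -> C) (f z : C) by exact/derivable1_diffP/derivable_cexp.
exact: (@differentiable_comp _ V C C (f : V -> C) (@cexp R : C -> C) z (hf z Oz) d).
Qed.

Lemma differentiable_rowP (phi : V -> V) (z : V) :
  (forall j, differentiable (fun v : V => phi v 0 j : C) z) -> differentiable phi z.
Proof.
move=> dphi.
rewrite (_ : phi = \sum_j (fun v : V => phi v 0 j *: ('e_j : V))).
  apply: differentiable_sum => j.
  exact: (@differentiableZl _ V V (fun v => phi v 0 j : R[i]) ('e_j : V) z (dphi j)).
by apply/funext => v; rewrite fct_sumE -row_sum_delta.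
Qed.

Lemma holomorphic_comp O O' f (phi : 'rV[R[i]]_N -> 'rV[R[i]]_N) :
  (forall j, holomorphic_on O (fun v => phi v 0 j)) ->
  (forall v, O v -> O' (phi v)) -> holomorphic_on O' f ->
  holomorphic_on O (fun v => f (phi v)).
Proof.
move=> hphi OO' hf z Oz.
have dphi : differentiable (phi : V -> V) (z : V) by apply: differentiable_rowP => j; exact: hphi.
exact: (@differentiable_comp _ V V C (phi : V -> V) (f : V -> C) z dphi (hf _ (OO' _ Oz))).
Qed.

Lemma holomorphic_cmeasurable O f : open (O : set V) -> holomorphic_on O f ->
  cmeasurable (@Cn_of_tuple R N @^-1` O) (fun t => f (Cn_of_tuple t)).
Proof.
move=> oO hf; apply: (@cmeasurable_continuous R N O (f : _ -> C)) => // v Ov.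
exact: differentiable_continuous (hf v Ov).
Qed.

Lemma square_integrableE O f : square_integrable_on O f <->
  (lebesgue_Cn R N).-integrable (@Cn_of_tuple R N @^-1` O)
    (fun t => (normc (f (Cn_of_tuple t)) ^+ 2)%:E).
Proof.
rewrite /square_integrable_on (_ : (fun _ => _) =
  (fun t => (normc (f (Cn_of_tuple t)) ^+ 2)%:E))//.
Qed.

(** Domination by [|f|^2 + |g|^2], from the square of [|f| - |g|]. *)
Lemma cintegrable_L2a_mul_conj O f g : open (O : set V) -> L2a O f -> L2a O g ->
  cintegrable (lebesgue_Cn R N) (@Cn_of_tuple R N @^-1` O)
    (fun t => f (Cn_of_tuple t) * (g (Cn_of_tuple t))^*).
Proof.
move=> oO [hf /square_integrableE sf] [hg /square_integrableE sg].
have mO := measurable_preimage_open oO.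
have [m1 m2] := cmeasurableM (holomorphic_cmeasurable oO hf)
  (cmeasurableJ (holomorphic_cmeasurable oO hg)).
have sfg := integrableD mO sf sg.
have le (t : N.-tuple (measurableTypeR R * measurableTypeR R)) (x : R) :
    `|x| <= normc (f (Cn_of_tuple t) * (g (Cn_of_tuple t))^*) ->
    (`|x%:E| <= `|(normc (f (Cn_of_tuple t)) ^+ 2)%:E +
                  (normc (g (Cn_of_tuple t)) ^+ 2)%:E|)%E.
  move=> xle; rewrite -EFinD !abse_EFin lee_fin.
  rewrite [leRHS]ger0_norm ?addr_ge0 ?sqr_ge0//.
  apply: (le_trans xle); rewrite Normc.normcM normcJ.
  have := sqr_ge0 (normc (f (Cn_of_tuple t)) - normc (g (Cn_of_tuple t))).
  have := mulr_ge0 (normc_ge0 (f (Cn_of_tuple t))) (normc_ge0 (g (Cn_of_tuple t))).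
  by set a := normc _; set b := normc _ => ab; rewrite sqrrB; lra.
split; apply: (le_integrable mO _ _ sfg).
- exact/measurable_EFinP.
- by move=> t _; apply: le; exact: normc_Re_le.
- exact/measurable_EFinP.
- by move=> t _; apply: le; exact: normc_Im_le.
Qed.

(** The reproducing identity, conjugated so that the holomorphic function [w |-> conj (K p w)] is
    the first factor, as [hartogs_coefficient] requires. *)
Lemma bergman_kernel_inner O (K : 'rV[R[i]]_N -> 'rV[R[i]]_N -> R[i]) p g :
  open (O : set V) -> is_bergman_kernel O K -> O p -> L2a O g ->
  cint (lebesgue_Cn R N) (@Cn_of_tuple R N @^-1` O)
    (fun t => (K p (Cn_of_tuple t))^* * (g (Cn_of_tuple t))^*) = (g p)^*.
Proof.
move=> oO hK Op Lg; have [LK /(_ g Lg) gp] := hK p Op.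
rewrite [in RHS]gp.
have i := cintegrable_L2a_mul_conj oO Lg LK.
have E := cint_conj (measurable_preimage_open oO) i.
rewrite [RHS](esym E); apply: eq_cint => t _.
rewrite mulrC [RHS](rmorphM (@conjc R)); congr (_ * _).
exact: esym (conjcK _).
Qed.

End holomorphic_functions.

(** * The Bergman kernel as a power series *)

Lemma eq_cintegrable d (T : measurableType d) (R : realType)
    (mu : {measure set T -> \bar R}) (D : set T) (F G : T -> R[i]) :
  measurable D -> {in D, F =1 G} -> cintegrable mu D F -> cintegrable mu D G.
Proof.
move=> mD FG [Fr Fi]; split.
  by apply: eq_integrable Fr => // t /FG /= ->.
by apply: eq_integrable Fi => // t /FG /= ->.
Qed.

Lemma conj_neq0 (R : realType) (z : R[i]) : z != 0 -> z^* != 0.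
Proof. by rewrite -!normc_gt0 normcJ. Qed.

Lemma conj_expr_div (R : realType) (x y : R[i]) k :
  (x ^+ k / y)^* = x^* ^+ k / y^*.
Proof.
rewrite [LHS](rmorphM (@conjc R)); congr (_ * _); first exact: (rmorphXn (@conjc R)).
exact: (fmorphV (@conjc R)).
Qed.

Section kernel_series.
Variables (R : realType) (n m : nat) (mu : R).
Hypothesis mu_gt0 : 0 < mu.
Local Notation N := (n + m.+1)%N.
Local Notation RT := (measurableTypeR R).
Local Notation C := (R[i]^o).
Local Notation V := ('rV[R[i]]_N : normedModType R[i]).
Local Notation D := (@hartogs_domain R n m.+1 mu).
Local Notation Leb := (lebesgue_Cn R N).
Local Notation Dt := (@Cn_of_tuple R N @^-1` D).
Local Notation L := (last_coord n m).
Local Notation e_L := (delta_mx 0 L : 'rV[R[i]]_N).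
Variables (K : 'rV[R[i]]_N -> 'rV[R[i]]_N -> R[i]).
Hypothesis K_kernel : is_bergman_kernel D K.
Variables (Phi Psi : 'rV[R[i]]_N -> 'rV[R[i]]_N) (J : 'rV[R[i]]_N -> R[i]).
Hypothesis hPhi : forall j, holomorphic_on D (fun v => Phi v 0 j).
Hypothesis hPsi : forall j, holomorphic_on D (fun v => Psi v 0 j).
Hypothesis PhiK : cancel Phi Psi.
Hypothesis DPhi : forall v, D (Phi v) <-> D v.
Hypothesis DPsi : forall v, D v -> D (Psi v).
Hypothesis hJ : holomorphic_on D J.
Hypothesis J_neq0 : forall v, J v != 0.
Hypothesis cvPhi : change_of_variables Leb (fun t => row_tuple (Phi (Cn_of_tuple t)))
  (fun t => normc (J (Cn_of_tuple t)) ^+ 2).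

Let oD : open (D : set V). Proof. exact: open_hartogs_domain. Qed.
Let mD : measurable Dt. Proof. exact: measurable_hartogs. Qed.
Let preD : (fun t => row_tuple (Phi (Cn_of_tuple t))) @^-1` Dt = Dt.
Proof. by apply/seteqP; split => t /=; rewrite row_tupleK => /DPhi. Qed.

Let G k w := Psi w 0 L ^+ k / J (Psi w).

(** The substitution [w = Phi v] cancels [J], and the norm of [G k] becomes that of the k-th power
    of the last coordinate. *)
Let L2a_G k : L2a D (G k).
Proof.
have hG : holomorphic_on D (G k).
  apply: holomorphicM; first exact: holomorphicX.
  apply: holomorphicV; last by move=> v _; exact: J_neq0.
  exact: (holomorphic_comp hPsi DPsi hJ).
split=> //; apply/square_integrableE.
have mG := cmeasurable_normc (holomorphic_cmeasurable oD hG).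
have mG2 : measurable_fun Dt (fun t => (normc (G k (Cn_of_tuple t)) ^+ 2)%:E).
  by apply/measurable_EFinP; exact: measurable_funX.
have ge0 t : Dt t -> (0%R <= (normc (G k (Cn_of_tuple t)) ^+ 2)%:E)%E.
  by move=> _; rewrite lee_fin sqr_ge0.
have E := ge0_integral_change cvPhi mD mG2 ge0.
have E2 := @integral_hartogs_coord R n m mu mu_gt0 k.
have E3 : (\int[Leb]_(t in Dt) `|(normc (G k (Cn_of_tuple t)) ^+ 2)%:E| =
    (hartogs_norm_sq n m mu k)%:E)%E.
  transitivity (\int[Leb]_(t in Dt) (normc (G k (Cn_of_tuple t)) ^+ 2)%:E)%E.
    by apply: eq_integral => t /set_mem Dt_; rewrite gee0_abs; [|exact: ge0].
  rewrite E preD -E2; apply: eq_integral => t _.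
  rewrite row_tupleK /G PhiK -EFinM; congr EFin.
  rewrite -exprMn -Normc.normcM mulrC divfK; last exact: J_neq0.
  by rewrite normcX -!exprM mulnC.
apply/integrableP; split; first exact: mG2.
have E4 : (((hartogs_norm_sq n m mu k)%:E : \bar R) < +oo)%E by exact: ltry.
by rewrite -E3 in E4.
Qed.

(* The kernel is paired with w |-> (Psi w)_L^k / J (Psi w), the image of the
   monomial v_L^k under the unitary operator attached to Phi. *)
Lemma bergman_kernel_series p (s : C) : D p -> normc s < 1 ->
  (\sum_(k < j) ((p 0 L)^* * s) ^+ k * ((hartogs_norm_sq n m mu k)^-1)%:C : C)
     @[j --> \oo] -->
  ((J p)^* * ((K (Phi p) (Phi (s *: e_L)))^* * J (s *: e_L)) : C).
Proof.
move=> Dp s1.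
have Dq : D (Phi p) by exact/DPhi.
(* The kernel function at [Phi p], pulled back by the unitary operator attached to [Phi]; the
   unknowns are its Taylor coefficients on the last axis. *)
pose f v := (K (Phi p) (Phi v))^* * J v.
have [LK _] := K_kernel Dq.
have hf : holomorphic_on D f.
  apply: holomorphicM hJ.
  have DPhi' v : D v -> D (Phi v) by move/DPhi.
  exact: (holomorphic_comp hPhi DPhi' LK.1).
pose phi : C -> C := fun l : C => f (l *: e_L).
have dphi (l : C) : normc l < 1 -> derivable phi l 1.
  move=> l1; have d := @derivable_line _ _ f 0 e_L l.
  rewrite add0r in d; have {}d := d (hf _ (@hartogs_last_axis R n m mu l l1)).
  by rewrite (_ : phi = fun l : C => f (0 + l *: e_L))//; apply/funext => x; rewrite add0r.
pose r := (normc s + 1) / 2.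
have s0 := normc_ge0 s.
have r01 : 0 < r < 1 by rewrite /r; apply/andP; split; lra.
have sr : normc s < r by rewrite /r; lra.
have coef k : taylor_coef phi k r =
    ((p 0 L)^* ^+ k) / (J p)^* * ((hartogs_norm_sq n m mu k)^-1)%:C.
  (* The weight [|J|^2], divided by the conjugate of [J] that comes from [G k], leaves the factor
     [J] of [f]. *)
  have eqf : {in Dt, (fun t => (normc (J (Cn_of_tuple t)) ^+ 2)%:C *
      ((K (Phi p) (Cn_of_tuple (row_tuple (Phi (Cn_of_tuple t)))))^* *
       (G k (Cn_of_tuple (row_tuple (Phi (Cn_of_tuple t)))))^*)) =1
     (fun t => f (Cn_of_tuple t) * ((Cn_of_tuple t 0 L)^*) ^+ k)}.
    move=> t _ /=; have := conj_neq0 (J_neq0 (Cn_of_tuple t)) => Jt0; rewrite row_tupleK /G PhiK /f -mulcJ.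
    rewrite [X in _ * (_ * X)](conj_expr_div (Cn_of_tuple t 0 L) (J (Cn_of_tuple t)) k).
    rewrite mulrACA [J _ * (K _ _)^*]mulrC; congr (_ * _).
    by rewrite mulrC mulfVK.
  have i0 := cintegrable_L2a_mul_conj oD LK (L2a_G k).
  have i1 := cintegrable_change cvPhi mD i0.
  have E1 := cint_change cvPhi mD i0.
  have E0 := bergman_kernel_inner oD K_kernel Dq (L2a_G k).
  rewrite preD in i1 E1.
  have i2 := eq_cintegrable mD eqf i1.
  have E2 := @hartogs_coefficient R n m mu mu_gt0 f k r r01 hf i2.
  (* The reproducing property evaluates the same integral as [E2]; comparing the two values gives
     the coefficient. *)
  have E3 : cint Leb Dt (fun t => f (Cn_of_tuple t) * ((Cn_of_tuple t 0 L)^*) ^+ k) =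
      (G k (Phi p))^*.
    rewrite -E0 [RHS]E1; apply: eq_cint => t tD.
    by rewrite -eqf// inE.
  move: E2; rewrite E3 /G PhiK => E2.
  have M0 : (hartogs_norm_sq n m mu k)%:C != 0 :> R[i].
    by rewrite -normc_gt0 normcR normr_gt0 gt_eqF// hartogs_norm_sq_gt0.
  apply: (mulIf M0); rewrite -[LHS]E2.
  rewrite fmorphV /= mulfVK//.
  exact: conj_expr_div.
have Jp0 := conj_neq0 (J_neq0 p).
have := @taylor_cvg R phi 1 dphi r s r01 sr.
move=> cv.
rewrite (_ : (fun j => _) =
    (fun j => (J p)^* * \sum_(k < j) taylor_coef phi k r * s ^+ k : C)).
  exact: (cvgM (cvg_cst ((J p)^* : C)) cv).
apply/funext => j; rewrite mulr_sumr; apply: eq_bigr => k _.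
have key (a b c d : R[i]) : d != 0 -> a * b * c = d * (a / d * c * b) by move=> d0; field.
by rewrite coef exprMn; exact: key.
Qed.

End kernel_series.

(** * Summation of the series *)

Section negative_binomial_series.
Local Notation binsum j N t := (\sum_(k < N) 'C(k + j, j)%:R * t ^+ k).

(** Pascal's rule. Up to the last term, which tends to 0 when [|t| < 1], multiplication by [1 - t]
    lowers the binomial index by one. *)
Lemma binsum_rec (F : comNzRingType) (t : F) j N :
  (1 - t) * binsum j.+1 N t = binsum j N t - 'C(N + j, j.+1)%:R * t ^+ N.
Proof.
elim: N => [|N IH]; first by rewrite !big_ord0 add0n bin_small// mul0r subr0 mulr0.
rewrite !big_ord_recr /= mulrDr IH exprS addSn addnS !binS !natrD.
by ring.
Qed.

Lemma geometric_sum (F : comNzRingType) (t : F) N :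
  (1 - t) * binsum 0 N t = 1 - t ^+ N.
Proof.
elim: N => [|N IH]; first by rewrite big_ord0 mulr0 expr0 subrr.
by rewrite big_ord_recr /= mulrDr IH bin0 exprS; ring.
Qed.

Variable R : realType.

Lemma binsum_le j N (t : R) : 0 <= t < 1 -> binsum j N t <= (1 - t)^-1 ^+ j.+1.
Proof.
move=> /andP[t0 t1]; have t1' : 0 < 1 - t by rewrite subr_gt0.
elim: j N => [|j IH] N; rewrite exprSr ler_pdivlMr// mulrC.
  by rewrite geometric_sum expr0 lerBlDr lerDl exprn_ge0.
rewrite binsum_rec; apply: le_trans (IH N); rewrite lerBlDr lerDl.
by rewrite mulr_ge0// exprn_ge0.
Qed.

(** At an intermediate ratio [r] a single term is below a partial sum, which [binsum_le] bounds;
    what remains is a constant times [(t / r) ^+ N]. *)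
Lemma bin_expr_cvg0 j (t : R) : 0 <= t < 1 ->
  ('C(N + j, j)%:R * t ^+ N @[N --> \oo] --> (0 : R))%classic.
Proof.
move=> /andP[t0 t1]; pose r := (t + 1) / 2.
have r0 : 0 < r by rewrite /r; lra.
have r1 : r < 1 by rewrite /r; lra.
have tr : `|t / r| < 1.
  have tr0 : 0 <= t / r by apply: divr_ge0 => //; exact: ltW.
  by rewrite (ger0_norm tr0) ltr_pdivrMr// mul1r /r; lra.
have g0 : ((1 - r)^-1 ^+ j.+1 * (t / r) ^+ N @[N --> \oo] --> (0 : R))%classic.
  exact: cvg_geometric.
apply: (squeeze_cvgr _ (cvg_cst 0) g0); near=> N; apply/andP; split.
  by rewrite mulr_ge0// exprn_ge0.
rewrite expr_div_n mulrA ler_pdivlMr ?exprn_gt0// mulrAC.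
apply: ler_wpM2r; first exact: exprn_ge0.
have r01 : 0 <= r < 1 by rewrite ltW.
apply: le_trans (binsum_le j N.+1 r01); rewrite big_ord_recr /= lerDr.
by apply: sumr_ge0 => k _; rewrite mulr_ge0// exprn_ge0// ltW.
Unshelve. all: by end_near.
Qed.

Local Notation C := (R[i]^o).

Lemma binsum_cvg j (t : R[i]) : normc t < 1 ->
  (binsum j N t : C) @[N --> \oo] --> ((1 - t)^-1 ^+ j.+1 : C).
Proof.
move=> t1; have t01 : 0 <= normc t < 1 by rewrite normc_ge0.
have t1' : 1 - t != 0.
  rewrite subr_eq0; apply/eqP => t1E; move: t1.
  by rewrite -t1E -[1]/(1%:C) normcR normr1 ltxx.
have key (u v e : nat -> R[i]) (l : R[i]) :
    (forall N, (1 - t) * u N = v N - e N) -> ((v N : C) @[N --> \oo] --> (l : C)) ->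
    (normc (e N) @[N --> \oo] --> (0 : R)) ->
    (u N : C) @[N --> \oo] --> ((1 - t)^-1 * l : C).
  move=> ue vl e0; rewrite (_ : u = fun N => (1 - t)^-1 * (v N - e N)); last first.
    by apply/funext => N; rewrite -ue mulKf.
  apply: (@cvgM R[i] _ _ _ (fun=> (1 - t)^-1)); first exact: cvg_cst.
  rewrite -[X in _ --> X]subr0; apply: (@cvgB R[i] C) vl _.
  apply/cvg_normcP => d d0; have ed := cvgr_lt _ e0 d d0.
  near=> N; rewrite subr0; near: N; exact: ed.
elim: j => [|j IH].
  rewrite expr1 (_ : (1 - t)^-1 = (1 - t)^-1 * 1); last by rewrite mulr1.
  apply: (key _ (fun=> 1) _ _ (geometric_sum t) (cvg_cst (1 : C))).
  rewrite (_ : (fun N => normc (t ^+ N)) = fun N => normc t ^+ N); last first.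
    by apply/funext => N; rewrite normcX.
  by apply: cvg_expr; rewrite ger0_norm ?normc_ge0.
rewrite exprS; apply: (key _ _ _ _ (binsum_rec t j) IH).
apply: (squeeze_cvgr _ (cvg_cst 0) (bin_expr_cvg0 j.+1 t01)).
near=> N; rewrite normc_ge0 Normc.normcM normcX.
rewrite -[_%:R]/(_ : R[i]) normc_nat; apply: ler_wpM2r; first by rewrite exprn_ge0 ?normc_ge0.
by rewrite ler_nat addnS binS leq_addr.
Unshelve. all: by end_near.
Qed.

(** A pair of [l] is a coefficient and a lower binomial index; the coefficients of both final series
    are such combinations, up to a constant factor. *)
Lemma binsum_comb_cvg (l : seq (R * nat)) (t : R[i]) : normc t < 1 ->
  ((\sum_(k < N) (\sum_(x <- l) x.1 * 'C(k + x.2, x.2)%:R)%:C * t ^+ k : C)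
    @[N --> \oo] --> (\sum_(x <- l) x.1%:C * (1 - t)^-1 ^+ x.2.+1 : C))%classic.
Proof.
move=> t1; elim: l => [|x l IH].
  rewrite big_nil (_ : (fun N => _) = fun=> 0); first exact: cvg_cst.
  by apply/funext => N; rewrite big1// => k _; rewrite big_nil mul0r.
rewrite big_cons (_ : (fun N => _) = fun N =>
    x.1%:C * binsum x.2 N t +
    \sum_(k < N) (\sum_(x <- l) x.1 * 'C(k + x.2, x.2)%:R)%:C * t ^+ k).
  apply: (@cvgD R[i] C) IH; apply: (@cvgM R[i] _ _ _ (fun=> x.1%:C)).
    exact: cvg_cst.
  exact: binsum_cvg.
apply/funext => N; rewrite mulr_sumr -big_split/=; apply: eq_bigr => k _.
by rewrite big_cons rmorphD rmorphM rmorph_nat mulrDl mulrA.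
Qed.

(* With y = 1 / (1 - t), the series sum_k (k + 1)^s t^k sums to
   y * (power_poly s).[y]. *)
Definition power_poly s : {poly R} := iter s (fun q => 'X * (('X - 1) * q)^`()) 1.

(** Multiplying the k-th coefficient by [k + 1] is [S |-> d/dt (t S)]. With [t = 1 - 1 / y] and
    [dy/dt = y^2], a sum [y q(y)] becomes [y] times [y ((y - 1) q)'], the recursion of [power_poly].
    On coefficients it reads [(k + 1) 'C(k + j, j) = (j + 1) 'C(k + j + 1, j + 1) - j 'C(k + j, j)],
    so [l] serves both. *)
Lemma power_poly_comb s : exists l : seq (R * nat),
  (forall k, k.+1%:R ^+ s = \sum_(x <- l) x.1 * 'C(k + x.2, x.2)%:R) /\
  power_poly s = \sum_(x <- l) x.1 *: 'X^(x.2).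
Proof.
elim: s => [|s [l [IHk IHq]]].
  exists [:: (1, 0%N)]; split=> [k|]; rewrite big_seq1/=.
    by rewrite addn0 bin0 mulr1 expr0.
  by rewrite scale1r expr0.
exists (flatten [seq [:: (x.1 * x.2.+1%:R, x.2.+1); (- (x.1 * x.2%:R), x.2)] | x <- l]).
split=> [k|].
  rewrite exprS IHk mulr_sumr big_flatten big_map; apply: eq_bigr => -[c j] _ /=.
  rewrite big_cons big_seq1 /=.
  have /(congr1 (fun x => x%:R : R)) := mul_bin_diag (k + j).+1 j.
  rewrite /= !natrM addnS => E.
  rewrite -[X in X + _]mulrA -E -addSn natrD; ring.
rewrite /power_poly iterS -/(power_poly s) IHq mulr_sumr raddf_sum mulr_sumr.
rewrite big_flatten big_map; apply: eq_bigr => -[c j] _ /=.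
rewrite big_cons big_seq1 /= -!mul_polyC !derivM derivB derivX derivXn.
rewrite -polyC1 !derivC -mulr_natr !(polyCM, polyCN, polyC_natr).
by case: j => [|j] /=; rewrite ?exprS; ring.
Qed.

Lemma power_series_cvg s (t : R) : `|t| < 1 ->
  ((\sum_(k < N) (k.+1%:R ^+ s * t ^+ k)%:C : C) @[N --> \oo] -->
  (((1 - t)^-1 * (power_poly s).[(1 - t)^-1])%:C : C))%classic.
Proof.
move=> t1; have [l [lk lq]] := power_poly_comb s.
have t1' : normc t%:C < 1 by rewrite normcR.
have := @binsum_comb_cvg l _ t1'; set y := (1 - t)^-1.
have yE : (1 - t%:C)^-1 = y%:C by rewrite /y fmorphV rmorphB rmorph1.
rewrite (_ : (fun N => _) = (fun N => \sum_(k < N) (k.+1%:R ^+ s * t ^+ k)%:C)).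
  rewrite (_ : \sum_(x <- l) _ = (y * (power_poly s).[y])%:C)//.
  rewrite lq horner_sum mulr_sumr rmorph_sum; apply: eq_bigr => x _.
  by rewrite yE hornerZ hornerXn -rmorphXn -rmorphM exprS mulrCA.
apply/funext => N; apply: eq_bigr => k _.
by rewrite lk rmorphM rmorphXn.
Qed.

(* Rolle's theorem between a root of power_poly s.+2 and 1, since the next
   polynomial is X times the derivative of (X - 1) * power_poly s.+2. *)
Lemma power_poly_root s : exists2 c, 2^-1 <= c < 1 & (power_poly s.+2).[c] = 0 /\
  ((0 < s)%N -> 2^-1 < c).
Proof.
elim: s => [|s [c /andP[c1 c2] [c0 _]]].
  (* [power_poly 2] is [X (2 X - 1)]. The lower bound becomes strict with the first use of Rolle's
     theorem. *)
  exists 2^-1; first by apply/andP; split; lra.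
  have dX1 : ('X - 1 : {poly R})^`() = 1 by rewrite derivB derivX -polyC1 derivC subr0.
  split=> //; rewrite /power_poly /= mulr1 dX1 mulr1 derivM dX1 derivX mul1r mulr1.
  by rewrite hornerM !hornerD hornerN hornerX -polyC1 hornerC; lra.
have E : (('X - 1) * power_poly s.+2).[c] = (('X - 1) * power_poly s.+2).[1].
  move: c0; move: (power_poly s.+2) => q c0.
  by rewrite !hornerM c0 mulr0 -polyC1 hornerD hornerN hornerX hornerC subrr mul0r.
have [d] := polyrcf.poly_rolle c2 E; rewrite in_itv/= => /andP[cd d1] d0.
exists d; first by apply/andP; split => //; lra.
split; last by move=> _; apply: le_lt_trans cd.
by rewrite hornerM d0 mulr0.
Qed.

End negative_binomial_series.

(** * Inverse norms of the monomials, and the zero for m = 1 *)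

Section hartogs_norms.
Variables (R : realType) (n m : nat) (mu : R).
Hypothesis mu_gt0 : 0 < mu.

(** The part of [1 / ||v_L^k||^2] that does not depend on [k], apart from the factorial of
    [m.+1]. *)
Definition hartogs_cst : R :=
  (disc_area R ^+ m.+1)^-1 * (mu / disc_area R) ^+ n.

Lemma hartogs_cst_gt0 : 0 < hartogs_cst.
Proof.
by rewrite mulr_gt0 ?invr_gt0 ?exprn_gt0 ?divr_gt0 ?disc_area_gt0.
Qed.

Lemma hartogs_norm_sqV k : (hartogs_norm_sq n m mu k)^-1 =
  hartogs_cst * ((m.+1)`! * 'C(k + m.+1, m.+1))%:R * (k + m.+1)%:R ^+ n.
Proof.
have f0 j : j`!%:R != 0 :> R by rewrite pnatr_eq0 -lt0n fact_gt0.
have a0 : disc_area R != 0 by rewrite gt_eqF ?disc_area_gt0.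
have am0 : disc_area R ^+ m.+1 != 0 by rewrite expf_neq0.
have E : ((m.+1)`! * 'C(k + m.+1, m.+1))%:R = (k + m.+1)`!%:R / k`!%:R :> R.
  apply: (mulIf (f0 k)); rewrite divfK// -natrM; congr (_%:R).
  by rewrite -(@bin_fact (k + m.+1) m.+1) ?leq_addl// addnK; ring.
rewrite E /hartogs_norm_sq /hartogs_cst /ball_moment_cst.
have -> : (disc_area R / (mu * (k + m.+1)%:R)) ^+ n =
    (mu / disc_area R) ^- n * (k + m.+1)%:R ^- n.
  by rewrite -!exprVn -exprMn; congr (_ ^+ _); rewrite invf_div invfM mulrA.
rewrite !invfM !invrK; set x := _ ^+ n; set y := _ ^+ n; set z := (_ ^+ m.+1)^-1.
by rewrite mulrACA; ring.
Qed.

End hartogs_norms.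

Lemma bergman_kernel_has_zero (R : realType) (n : nat) (mu : R)
    (K : 'rV[R[i]]_(n + 1) -> 'rV[R[i]]_(n + 1) -> R[i]) :
  (2 <= n)%N -> 0 < mu -> is_bergman_kernel (hartogs_domain n 1 mu) K ->
  exists p q, [/\ hartogs_domain n 1 mu p, hartogs_domain n 1 mu q & K p q = 0].
Proof.
move=> n2 mu0 hK.
(* Taking [s = n.-1] gives [power_poly n.+1], the polynomial of the series with coefficients
   [(k + 1) ^ (n + 1)]; [n >= 2] makes [s] positive, hence [c > 1/2]. *)
have [c /andP[c1 c2] [c0 chalf]] := @power_poly_root R n.-1.
have {chalf}c1 : 2^-1 < c by apply: chalf; case: (n) n2 => [|[]].
have {c0} : (power_poly R n.+1).[c] = 0 by move: c0; case: (n) n2.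
move=> c0; have c_gt0 : 0 < c by lra.
(* [t] solves [c = 1 / (1 - t)], and [c > 1/2] amounts to [t > -1]. The points with last coordinates
   [- u] and [u] realise [t] as the product [- u ^+ 2]. *)
pose t := 1 - c^-1; pose u := Num.sqrt (- t).
have t0 : t < 0 by rewrite subr_lt0 invf_gt1.
have t1 : -1 < t.
  have : c^-1 < 2 by rewrite -[ltRHS]invrK ltf_pV2 ?posrE.
  by rewrite /t; lra.
have u2 : u ^+ 2 = - t by rewrite sqr_sqrtr// oppr_ge0 ltW.
have u1 : `|u| < 1 by rewrite ger0_norm ?sqrtr_ge0// -(@expr_lt1 _ 2) ?sqrtr_ge0// u2; lra.
pose L := last_coord n 0.
pose q : 'rV[R[i]]_(n + 1) := u%:C *: delta_mx 0 L.
pose p : 'rV[R[i]]_(n + 1) := (- u)%:C *: delta_mx 0 L.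
have Dq : hartogs_domain n 1 mu q by apply: hartogs_last_axis; rewrite normcR.
have Dp : hartogs_domain n 1 mu p by apply: hartogs_last_axis; rewrite normcR normrN.
exists p, q; split => //.
have pL : p 0 L = (- u)%:C by rewrite !mxE !eqxx mulr1.
have normc1 : normc (1 : R[i]) = 1 by rewrite -[1]/(1%:C) normcR normr1.
have cv : change_of_variables (lebesgue_Cn R (n + 1))
    (fun t => row_tuple (id (Cn_of_tuple t)))
    (fun t => normc ((fun=> 1 : R[i]) (Cn_of_tuple t)) ^+ 2).
  apply: change_of_variables_ext (change_of_variables_id _) => s.
    by rewrite Cn_of_tupleK.
  by rewrite normc1 expr1n.
have uC : normc u%:C < 1 by rewrite normcR.
have hc (j : 'I_(n + 1)) : holomorphic_on (hartogs_domain n 1 mu) (fun v => id v 0 j).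
  exact: holomorphic_coord.
(* The point [q] is already on the last axis, so the identity serves as automorphism. *)
have := @bergman_kernel_series R n 0 mu mu0 K hK id id (fun=> 1) hc hc (fun=> erefl)
  (fun v => iff_refl _) (fun v => id) (@holomorphic_cst R _ _ 1) (fun=> oner_neq0 _) cv
  p u%:C Dp uC.
have t1' : `|t| < 1 by rewrite ltr0_norm//; lra.
have := @power_series_cvg R n.+1 t t1'.
have -> : (1 - t)^-1 = c by rewrite /t opprB addrC subrK invrK.
rewrite c0 mulr0 => cv0.
pose a : R[i]^o := (hartogs_cst n 0 mu)%:C.
have cv1 : ((a * \sum_(k < N) (k.+1%:R ^+ n.+1 * t ^+ k)%:C : R[i]^o)
    @[N --> \oo] --> (a * 0 : R[i]^o))%classic.
  exact: (cvgM (cvg_cst a) cv0).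
rewrite mulr0 in cv1.
rewrite -/q -/L; set s := fun _ => _ => cv2.
have sE : s = (fun N => a *
    \sum_(k < N) (k.+1%:R ^+ n.+1 * t ^+ k)%:C : R[i]^o).
  apply/funext => N; rewrite /s mulr_sumr; apply: eq_bigr => k _.
  rewrite pL hartogs_norm_sqV addn1 bin1 mul1n.
  have -> : ((- u)%:C)^* * u%:C = t%:C.
    transitivity ((- u)%:C * u%:C : R[i]).
      congr (_ * _); by apply: eqcP => /=; rewrite ?oppr0.
    by rewrite -rmorphM mulNr -expr2 u2 opprK.
  by rewrite -rmorphXn -!rmorphM; congr (_%:C); rewrite exprS; ring.
move: cv2; rewrite sE => cv2.
have E : (1^* * ((K p q)^* * 1) : R[i]^o) = 0.
  by apply: (cvg_unique _ cv2 cv1); exact: norm_hausdorff.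
have one0 : (1 : R[i])^* != 0 by apply: conj_neq0; exact: oner_neq0.
move: E => /eqP; rewrite mulr1 mulf_eq0 (negbTE one0)/= => /eqP h.
by apply/eqP; case: eqP => // /eqP /conj_neq0 /eqP []; exact: h.
Qed.

(** * Automorphisms of the Hartogs domain for n = 1 *)

Section unitary.
Variables (R : realType) (m : nat).
Local Notation conjmx A := (map_mx (@conjc R) A).

(** Gram-Schmidt on a matrix all of whose rows are [v]: only row 0 of the result matters. Its span
    contains [v], also when [v = 0], and a transposition makes it the last row. *)
Lemma unitary_with_row (v : 'rV[R[i]]_m.+1) :
  exists (U : 'M[R[i]]_m.+1) (a : R[i]),
    U *m (conjmx U)^T = 1%:M /\ v = a *: (delta_mx 0 ord_max *m U).
Proof.
pose A : 'M[R[i]]_m.+1 := \matrix_i v.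
pose W := spectral.schmidt A.
have /spectral.unitarymxP uW : W \is spectral.unitarymx by exact: spectral.schmidt_unitarymx.
have uW' : W *m (conjmx W)^T = 1%:M by rewrite -uW; congr (_ *m _); rewrite map_trmx.
pose S : 'M[R[i]]_m.+1 := tperm_mx ord0 ord_max.
exists (S *m W).
have : (row ord0 A <= row ord0 W)%MS.
  apply: submx_trans (spectral.row_schmidt_sub A ord0) _.
  by apply/sumsmx_subP => k; rewrite leqn0 => /eqP k0; rewrite genmxE (_ : k = ord0)//; exact: val_inj.
rewrite rowK => /sub_rVP[a va]; exists a; split.
  rewrite map_mxM trmx_mul mulmxA -[S *m W *m _]mulmxA uW' mulmx1.
  rewrite map_perm_mx tr_perm_mx -perm_mxM.
  by rewrite perm.tpermV perm.tperm2 perm_mx1.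
rewrite va -rowE; congr (_ *: _); apply/rowP => j.
by rewrite -row_permE !mxE perm.tpermR.
Qed.

Lemma sum_normc_mul_unitary (U : 'M[R[i]]_m) (v : 'rV[R[i]]_m) :
  U *m (conjmx U)^T = 1%:M ->
  \sum_j normc ((v *m U) 0 j) ^+ 2 = \sum_j normc (v 0 j) ^+ 2.
Proof.
have sq (w : 'rV[R[i]]_m) : (\sum_j normc (w 0 j) ^+ 2)%:C = (w *m (conjmx w)^T) 0 0.
  by rewrite mxE rmorph_sum; apply: eq_bigr => j _; rewrite !mxE; exact: esym (mulcJ _).
move=> uU; apply: complexI; rewrite !sq map_mxM trmx_mul mulmxA.
by rewrite -[v *m U *m _]mulmxA uU mulmx1.
Qed.

Lemma normc_det_unitary (U : 'M[R[i]]_m) :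
  U *m (conjmx U)^T = 1%:M -> normc (\det U) = 1.
Proof.
move=> /(congr1 (fun A => normc (\det A))).
rewrite det_mulmx det_tr det_map_mx det1 Normc.normcM normcJ Normc.normc1 -expr2.
by move=> /eqP; rewrite sqrf_eq1 => /orP[/eqP//|/eqP h]; have := normc_ge0 (\det U); rewrite h; lra.
Qed.

End unitary.

Section hartogs_automorphism.
Variables (R : realType) (m : nat) (mu : R) (z : R[i]) (U : 'M[R[i]]_m.+1).
Local Notation Uh := (map_mx (@conjc R) U)^T.
Hypothesis unitary_U : U *m Uh = 1%:M.
Local Notation RT := (measurableTypeR R).
Local Notation Pl := (RT * RT)%type.
Local Notation plane := (@lebesgue_plane R).
Local Notation V := 'rV[R[i]]_(1 + m.+1).
Local Notation D := (@hartogs_domain R 1 m.+1 mu).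

(* chosen so that |hartogs_factor x|^2 e^(-mu |x|^2) = e^(-mu |x + z|^2) *)
Definition hartogs_factor (x : R[i]) : R[i] :=
  cexp (- (mu%:C * (x * z^*)) - (mu / 2 * normc z ^+ 2)%:C).
Local Notation c := hartogs_factor.

Lemma normc_hartogs_factor x :
  normc (c x) ^+ 2 * expR (- mu * normc x ^+ 2) = expR (- mu * normc (x + z) ^+ 2).
Proof.
rewrite normc_cexp expr2 -!expRD; congr expR.
rewrite !sqr_normc_ReIm ReD ImD ReD ReN ReM; case: x z => [a b] [d e] /=.
by field.
Qed.

Definition hartogs_map (v : V) : V :=
  row_mx (v 0 (lshift m.+1 0) + z)%:M (c (v 0 (lshift m.+1 0)) *: (rsubmx v *m U)).

Definition hartogs_inv (w : V) : V :=
  row_mx (w 0 (lshift m.+1 0) - z)%:M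
    ((c (w 0 (lshift m.+1 0) - z))^-1 *: (rsubmx w *m Uh)).

Definition hartogs_jacobian (v : V) : R[i] := c (v 0 (lshift m.+1 0)) ^+ m.+1.

Lemma hartogs_factor_neq0 x : c x != 0. Proof. exact: cexp_neq0. Qed.

Lemma hartogs_mapK : cancel hartogs_map hartogs_inv.
Proof.
move=> v; rewrite /hartogs_inv /hartogs_map row_mxKr row_mxEl mxE eqxx mulr1n addrK.
rewrite -scalemxAl scalerA mulVf ?hartogs_factor_neq0// scale1r -mulmxA unitary_U mulmx1.
apply/rowP => i; rewrite mxE; case: splitP => j ij.
  by rewrite !mxE ord1 eqxx mulr1n; congr (v 0 _); apply/val_inj; rewrite /= ij ord1.
by rewrite mxE; congr (v 0 _); apply/val_inj; rewrite /= ij.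
Qed.

Lemma hartogs_invK : cancel hartogs_inv hartogs_map.
Proof.
have UhU : Uh *m U = 1%:M by exact: mulmx1C.
move=> v; rewrite /hartogs_inv /hartogs_map row_mxKr row_mxEl mxE eqxx mulr1n subrK.
rewrite -scalemxAl scalerA mulfV ?hartogs_factor_neq0// scale1r -mulmxA UhU mulmx1.
apply/rowP => i; rewrite mxE; case: splitP => j ij.
  by rewrite !mxE ord1 eqxx mulr1n; congr (v 0 _); apply/val_inj; rewrite /= ij ord1.
by rewrite mxE; congr (v 0 _); apply/val_inj; rewrite /= ij.
Qed.

Lemma hartogs_domain1E v : D v <->
  \sum_j normc (rsubmx v 0 j) ^+ 2 < expR (- mu * normc (v 0 (lshift m.+1 0)) ^+ 2).
Proof.
by rewrite /hartogs_domain /= !euclidean_norm_sqr big_ord1 [lsubmx _ _ _]mxE.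
Qed.

Lemma hartogs_domain_map v : D (hartogs_map v) <-> D v.
Proof.
rewrite !hartogs_domain1E /hartogs_map row_mxKr row_mxEl !mxE eqxx mulr1n.
set x := v 0 _; rewrite -normc_hartogs_factor.
rewrite (eq_bigr (fun j => normc (c x) ^+ 2 * normc ((rsubmx v *m U) 0 j) ^+ 2)); last first.
  by move=> j _; rewrite mxE Normc.normcM exprMn.
rewrite -mulr_sumr (sum_normc_mul_unitary _ unitary_U) ltr_pM2l//.
by rewrite exprn_gt0// normc_gt0 hartogs_factor_neq0.
Qed.

Lemma hartogs_domain_inv v : D v -> D (hartogs_inv v).
Proof.
move=> Dv; have E := hartogs_domain_map (hartogs_inv v).
by rewrite hartogs_invK in E; exact: (proj1 E Dv).
Qed.

Lemma holomorphic_hartogs_factor (f : V -> R[i]) :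
  holomorphic_on D f -> holomorphic_on D (fun v => c (f v)).
Proof.
move=> hf; apply: holomorphic_cexp; apply: holomorphicD; last exact: holomorphic_cst.
rewrite (_ : (fun _ => _) = fun v => (- mu%:C * z^*) * f v); last first.
  by apply/funext => v; ring.
by apply: holomorphicM hf; exact: holomorphic_cst.
Qed.

Lemma holomorphic_row_mx (f g : V -> R[i]) (A : 'M[R[i]]_m.+1) :
  holomorphic_on D f -> holomorphic_on D g -> forall j, holomorphic_on D
    (fun v => (row_mx (f v)%:M (g v *: (rsubmx v *m A)) : V) 0 j).
Proof.
move=> hf hg j; rewrite -(splitK j); case: (fintype.split j) => k /=.
  rewrite (_ : (fun _ => _) = f) //.
  by apply/funext => v; rewrite row_mxEl mxE ord1 eqxx mulr1n.
rewrite (_ : (fun _ => _) = fun v => g v * \sum_i v 0 (rshift 1 i) * A i k); last first.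
  apply/funext => v; rewrite row_mxEr !mxE; congr (_ * _).
  by apply: eq_bigr => i _; rewrite mxE.
apply: holomorphicM hg _; apply: holomorphic_sum => i.
by apply: holomorphicM; [exact: holomorphic_coord|exact: holomorphic_cst].
Qed.

Lemma holomorphic_hartogs_map j : holomorphic_on D (fun v => hartogs_map v 0 j).
Proof.
apply: holomorphic_row_mx.
  by apply: holomorphicD; [exact: holomorphic_coord|exact: holomorphic_cst].
by apply: holomorphic_hartogs_factor; exact: holomorphic_coord.
Qed.

Lemma holomorphic_hartogs_inv j : holomorphic_on D (fun v => hartogs_inv v 0 j).
Proof.
have h : holomorphic_on D (fun v : V => v 0 (lshift m.+1 0) - z).
  by apply: holomorphicD; [exact: holomorphic_coord|exact: holomorphic_cst].
apply: holomorphic_row_mx => //.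
apply: holomorphicV; last by move=> v _; exact: hartogs_factor_neq0.
exact: holomorphic_hartogs_factor.
Qed.

Lemma holomorphic_hartogs_jacobian : holomorphic_on D hartogs_jacobian.
Proof.
apply: holomorphicX; apply: holomorphic_hartogs_factor; exact: holomorphic_coord.
Qed.

(** With the first coordinate [x] frozen, zeta undergoes the linear map [c x *: U], whose
    determinant has modulus [normc (c x) ^+ m.+1]; then [x] is translated. *)
Lemma change_of_variables_hartogs_map :
  change_of_variables (lebesgue_Cn R (1 + m.+1))
    (fun t => row_tuple (hartogs_map (Cn_of_tuple t)))
    (fun t => normc (hartogs_jacobian (Cn_of_tuple t)) ^+ 2).
Proof.
pose n := m.+1.
pose f1 (y : Pl * n.-tuple Pl) : Pl := (y.1.1 + Re z, y.1.2 + Im z).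
pose f2 (y : Pl * n.-tuple Pl) : n.-tuple Pl := tuple_mulmx (c (complex_of y.1) *: U) y.2.
pose w2 (y : Pl * n.-tuple Pl) : R := normc (c (complex_of y.1)) ^+ n ^+ 2.
have m1 : measurable_fun setT f1.
  apply/measurable_fun_pair; apply: measurable_funD => //.
    exact: (measurableT_comp measurable_fst measurable_fst).
  exact: (measurableT_comp measurable_snd measurable_fst).
have mc : cmeasurable setT (fun y : Pl * n.-tuple Pl => c (complex_of y.1)).
  apply: cmeasurable_cexp; apply: cmeasurableD; last exact: cmeasurable_cst.
  have mx : cmeasurable setT (fun y : Pl * n.-tuple Pl => complex_of y.1).
    exact: (cmeasurable_comp (measurable_complex_of R) measurable_fst).
  have := cmeasurableM (cmeasurable_cst setT (- mu%:C * z^*)) mx.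
  congr cmeasurable; apply/funext => y; ring.
have m2 : measurable_fun setT f2.
  apply: measurable_row_tuple => i.
  rewrite (_ : (fun _ => _) = fun y : Pl * n.-tuple Pl =>
      c (complex_of y.1) * (Cn_of_tuple y.2 *m U) 0 i); last first.
    by apply/funext => y; rewrite -scalemxAr mxE.
  apply: cmeasurableM mc _; apply: cmeasurable_mulmx => j.
  exact: (cmeasurable_comp (cmeasurable_coord R j) measurable_snd).
have mw : measurable_fun setT w2.
  apply: measurable_funX; apply: measurable_funX; exact: cmeasurable_normc.
have h1 : change_of_variables (plane \x lebesgue_Cn R n)%E
    (fun y => (f1 y, y.2)) (fun=> 1).
  apply: change_of_variables_prod1 => // y.
  exact: (change_of_variables_planeD (pair_of z)).
have h2 : change_of_variables (plane \x lebesgue_Cn R n)%E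
    (fun y => (y.1, f2 y)) w2.
  apply: (@change_of_variables_prod2 _ _ Pl (n.-tuple Pl) R plane (lebesgue_Cn R n) f2 w2) => // x.
  have cU : c (complex_of x) *: U \in unitmx.
    rewrite unitmxZ ?unitfE ?hartogs_factor_neq0//.
    by have [] := mulmx1_unit unitary_U.
  apply: change_of_variables_ext (linear_change_unit cU) => // y.
  by rewrite detZ Normc.normcM (normc_det_unitary unitary_U) mulr1 normcX.
apply: (change_of_variables_tuple (change_of_variables_comp h1 h2)) => -[x t].
  rewrite /hartogs_map Cn_of_tuple_cons (@row_mxKr _ 1 1 n) (@row_mxEl _ 1 1 n) mxE eqxx mulr1n.
  rewrite row_tuple_row_mx /= /f1 /f2 /= /tuple_mulmx -scalemxAr.
  by congr (tuple_cons (_, _)); rewrite complex_of_planeD.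
rewrite /hartogs_jacobian Cn_of_tuple_cons (@row_mxEl _ 1 1 n) mxE eqxx mulr1n.
by rewrite normcX mulr1.
Qed.

End hartogs_automorphism.

(** * Absence of zeros for n = 1 *)

Lemma bergman_kernel_zero_free (R : realType) (m : nat) (mu : R)
    (K : 'rV[R[i]]_(1 + m.+1) -> 'rV[R[i]]_(1 + m.+1) -> R[i]) p q :
  0 < mu -> is_bergman_kernel (hartogs_domain 1 m.+1 mu) K ->
  hartogs_domain 1 m.+1 mu p -> hartogs_domain 1 m.+1 mu q -> K p q <> 0.
Proof.
move=> mu0 hK Dp Dq Kpq.
(* Translating by the z-part of [q] makes [q] the image of a point with z-part 0. [U] aligns the
   last axis with the zeta-part of [q], and [s] compensates the factor at 0. *)
pose z := q 0 (lshift m.+1 0); pose L := last_coord 1 m.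
have [U [a [uU qU]]] := unitary_with_row (rsubmx q).
pose s : R[i]^o := a / hartogs_factor mu z 0.
have c0 := hartogs_factor_neq0 mu z 0.
have sq : hartogs_map mu z U (s *: delta_mx 0 L) = q.
  rewrite /hartogs_map.
  have -> : (s *: delta_mx 0 L : 'rV[R[i]]_(1 + m.+1)) 0 (lshift m.+1 0) = 0.
    by rewrite !mxE (_ : (_ == L) = false) ?andbF ?mulr0.
  have -> : rsubmx (s *: delta_mx 0 L : 'rV[R[i]]_(1 + m.+1)) = s *: delta_mx 0 ord_max.
    by apply/rowP => j; rewrite !mxE.
  rewrite -scalemxAl scalerA /s mulrC divfK// -qU add0r.
  rewrite -[RHS](hsubmxK q); congr row_mx.
  by apply/rowP => j; rewrite ord1 !mxE mulr1n.
pose p' := hartogs_inv mu z U p.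
have Dp' : hartogs_domain 1 m.+1 mu p' by exact: hartogs_domain_inv.
have pE : hartogs_map mu z U p' = p by exact: hartogs_invK.
have Ds : hartogs_domain 1 m.+1 mu (s *: delta_mx 0 L).
  by apply/(hartogs_domain_map mu z uU _); rewrite sq.
have s1 : normc s < 1.
  by have := hartogs_last_coord_lt1 mu0 Ds; rewrite !mxE !eqxx mulr1.
have p1 : normc (p' 0 L) < 1 := hartogs_last_coord_lt1 mu0 Dp'.
have J0 (v : 'rV_(1 + m.+1)) : hartogs_jacobian mu z v != 0 by rewrite expf_neq0// hartogs_factor_neq0.
have cv := @bergman_kernel_series R 1 m mu mu0 K hK
  (hartogs_map mu z U) (hartogs_inv mu z U) (hartogs_jacobian mu z)
  (@holomorphic_hartogs_map R m mu z U) (@holomorphic_hartogs_inv R m mu z U)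
  (hartogs_mapK mu z uU) (hartogs_domain_map mu z uU)
  (fun v => @hartogs_domain_inv R m mu z U uU v)
  (@holomorphic_hartogs_jacobian R m mu z) J0
  (change_of_variables_hartogs_map mu z uU) p' s Dp' s1.
(* A zero of the kernel forces the sum of the series to be 0; its closed form contradicts this. *)
rewrite pE sq Kpq in cv.
pose t := (p' 0 L)^* * s.
have t1 : normc t < 1.
  rewrite Normc.normcM normcJ (le_lt_trans _ s1)// ler_piMl ?normc_ge0//.
  exact: ltW.
have [F FE F0] : exists2 F : R, (m.+1)`!%:R = F & 0 < F.
  by exists (m.+1)`!%:R => //; rewrite ltr0n fact_gt0.
(* From [(k + m + 2) 'C(k + m + 1, m + 1) = (m + 2) 'C(k + m + 2, m + 2)], the coefficient
   [(k + m + 1) 'C(k + m + 1, m + 1)] is [(m + 2) 'C(k + m + 2, m + 2) - 'C(k + m + 1, m + 1)]. *)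
pose l : seq (R * nat) := [:: (F * m.+2%:R, m.+2); (- F, m.+1)].
have cv0 := @binsum_comb_cvg R l t t1.
pose b : R[i]^o := (hartogs_cst 1 m mu)%:C.
pose u N : R[i]^o := b * \sum_(k < N) (\sum_(x <- l) x.1 * 'C(k + x.2, x.2)%:R)%:C * t ^+ k.
pose lim_u : R[i]^o := b * \sum_(x <- l) x.1%:C * (1 - t)^-1 ^+ x.2.+1.
have cv1 : (u @ \oo --> lim_u)%classic by exact: (cvgM (cvg_cst b) cv0).
have uE : (fun N => \sum_(k < N) t ^+ k * ((hartogs_norm_sq 1 m mu k)^-1)%:C : R[i]^o) = u.
  apply/funext => N; rewrite /u mulr_sumr; apply: eq_bigr => k _.
  rewrite hartogs_norm_sqV natrM FE expr1 big_cons big_seq1 /=.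
  rewrite [RHS]mulrA mulrC; congr (_ * _).
  rewrite -rmorphM; congr (_%:C); rewrite -mulrA; congr (_ * _).
  have /(congr1 (fun x => x%:R : R)) := mul_bin_diag (k + m.+1).+1 m.+1.
  rewrite /= !natrM -addnS => E.
  rewrite -[F * m.+2%:R * _]mulrA -E addnS -natr1; ring.
rewrite uE in cv.
have lim0 : lim_u = 0.
  rewrite (cvg_unique (@norm_hausdorff _ _) cv1 cv).
  by rewrite [X in _ * (X * _)]conjc0 mul0r mulr0.
have t1' : 1 - t != 0.
  rewrite subr_eq0; apply/eqP => t1E; move: t1.
  by rewrite -t1E -[1]/(1%:C) normcR normr1 ltxx.
have b0 : b != 0 by rewrite -normc_gt0 normcR normr_gt0 gt_eqF// hartogs_cst_gt0.
have FC0 : F%:C != 0 :> R[i] by rewrite -normc_gt0 normcR normr_gt0 gt_eqF.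
(* Because [normc t < 1 <= m + 1]. *)
have mt0 : m.+1%:R + t != 0.
  rewrite addrC addr_eq0; apply/eqP => tE; move: t1.
  by rewrite tE -[- _]add0r normc_distC subr0 normc_nat ltNge ler1n.
(* The two terms combine through [m + 1 + t = (m + 2) - (1 - t)]. *)
have lim_uE : lim_u = b * (F%:C * (1 - t)^-1 ^+ m.+3 * (m.+1%:R + t)).
  rewrite /lim_u big_cons big_seq1 /= rmorphM rmorph_nat rmorphN.
  have -> : m.+1%:R + t = m.+2%:R - (1 - t) by rewrite -natr1; ring.
  by rewrite mulrBr -[_ * (1 - t)]mulrA exprSr; congr (_ * _); field.
have y0 : (1 - t)^-1 ^+ m.+3 != 0 by rewrite expf_neq0// invr_eq0.
have : lim_u != 0 by rewrite lim_uE mulf_neq0// mulf_neq0// mulf_neq0.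
by rewrite lim0 eqxx.
Qed.

Theorem theorem3 (R : realType) (n m : nat) (mu : R)
    (K : 'rV[R[i]]_(n + m) -> 'rV[R[i]]_(n + m) -> R[i])
    (n_ge1 : (1 <= n)%N) (m_ge1 : (1 <= m)%N) (mu_gt0 : 0 < mu)
    (K_kernel : is_bergman_kernel (hartogs_domain n m mu) K) :
  (n = 1%N ->
    forall p q : 'rV[R[i]]_(n + m),
      hartogs_domain n m mu p -> hartogs_domain n m mu q -> K p q <> 0) /\
  (m = 1%N -> (2 <= n)%N ->
    exists p q : 'rV[R[i]]_(n + m),
      [/\ hartogs_domain n m mu p, hartogs_domain n m mu q & K p q = 0]).
Proof.
split=> [n1 p q|m1 n2]; last first.
  by subst m; exact: bergman_kernel_has_zero n2 mu_gt0 K_kernel.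
subst n; case: m m_ge1 K K_kernel p q => // m _ K K_kernel p q.
exact: bergman_kernel_zero_free mu_gt0 K_kernel.
Qed.
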